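(* Let $d\ge 3$ and let $(\mathbb G_i)_{i\in\mathbb N}$ be a sequence of independent uniformly random $d$-regular graphs with the number of vertices tending to infinity. Let $C$ be a closed subset of $\overline{X_d}$ with respect to the local-global topology. Suppose that $C$ does not contain any typical graphings. Then $\mathbb P(\mathbb G_i\in C)\to 0$ as $i\to\infty$.
   Context: $[k]=\{1,\dots,k\}$. $U^{r,k}$ is the (finite) set of isomorphism classes of triples $(H,o,f)$ where $(H,o)$ is a rooted graph of radius at most $r$ with maximum degree at most $d$ and $f:V(H)\to[k]$; $\mathcal M(U^{r,k})$ is the set of probability measures on it with total variation distance $d_{TV}$. For a finite graph $G$ with maximum degree at most $d$ and $f:V(G)\to[k]$, $\mu_{r,G,f}\in\mathcal M(U^{r,k})$ is the law of the rooted $f$-colored ball of radius $r$ around a uniformly random vertex of $G$, and $Q_{r,G,k}=\{\mu_{r,G,f}: f:V(G)\to[k]\}$. The colored neighborhood distance is $$d_{CN}(G,G')=\sum_{k=1}^\infty\sum_{r=1}^\infty 2^{-k-r}d_H(Q_{r,G,k},Q_{r,G',k}),$$ $d_H$ being Hausdorff distance in $(\mathcal M(U^{r,k}),d_{TV})$. $X_d$ is the set of all finite graphs with maximum degree at most $d$ (graphs at distance $0$ identified), and $\overline{X_d}$ is the completion of $(X_d,d_{CN})$, a compact metric space; its topology is the local-global topology. A graphing is a graph $\mathcal G$ on a Polish space $\Omega$ with a Borel probability measure $\nu$, with Borel measurable edge set, all degrees at most $d$, such that $\int_A e(x,B)\,d\nu(x)=\int_B e(x,A)\,d\nu(x)$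 for all measurable $A,B\subseteq\Omega$, where $e(x,B)$ is the number of edges from $x$ to $B$. For graphings, $Q_{r,\mathcal G,k}$ is defined in the same way using measurable colorings $f:\Omega\to[k]$ and a $\nu$-random vertex, and $d_{CN}$ and local-global convergence ($d_{CN}\to0$) extend to graphings. Elements of $\overline{X_d}$ are represented by graphings, and graphings at $d_{CN}$-distance $0$ are identified. A graphing $\mathcal G\in\overline{X_d}$ is typical if there is an infinite $S'\subseteq\mathbb N$ (of sizes $n$ with $dn$ even) such that if $(\mathbb G_n)_{n\in S'}$ are independent uniformly random $d$-regular graphs with $|V(\mathbb G_n)|=n$, then $(\mathbb G_n)_{n\in S'}$ converges locally-globally to $\mathcal G$ with probability $1$. *)

(* Defs.v *)
From HB Require Import structures.
From mathcomp Require Import all_boot all_order all_algebra finmap.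
From mathcomp Require Import generic_quotient.
From mathcomp Require Import all_classical all_reals all_analysis.

Set Implicit Arguments.
Unset Strict Implicit.
Unset Printing Implicit Defensive.

Import Order.TTheory GRing.Theory Num.Theory.
Import numFieldNormedType.Exports.

Local Open Scope classical_set_scope.
Local Open Scope ring_scope.
Local Open Scope quotient_scope.

(* Finite simple graphs are labelled by 'I_n. They are nonempty, since
   neighborhood statistics need a random vertex; so [sgraph 0] is empty. *)
Definition is_sgraph (n : nat) (E : {set 'I_n * 'I_n}) : bool :=
  [&& (0 < n)%N, [forall i, (i, i) \notin E]
    & [forall i, forall j, ((i, j) \in E) == ((j, i) \in E)]].

Definition sgraph (n : nat) : Type := {E : {set 'I_n * 'I_n} | is_sgraph E}.

Definition adj (n : nat) (G : sgraph n) (i j : 'I_n) : Prop :=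
  (i, j) \in val G.

Definition degree (n : nat) (G : sgraph n) (i : 'I_n) : nat :=
  #|[pred j | (i, j) \in val G]|.

Definition max_degree_le (d n : nat) (G : sgraph n) : bool :=
  [forall i, degree G i <= d]%N.

Definition regular (d n : nat) (G : sgraph n) : bool :=
  [forall i, degree G i == d].

Definition Xgraph (d : nat) : Type :=
  {n : nat & {G : sgraph n | max_degree_le d G}}.

Definition reg_graph (d n : nat) : Type := {G : sgraph n | regular d G}.

Lemma regular_max_degree (d n : nat) (G : sgraph n) :
  regular d G -> max_degree_le d G.
Proof. by move=> /forallP h; apply/forallP => i; rewrite (eqP (h i)). Qed.

Definition Xgraph_of (d n : nat) (G : reg_graph d n) : Xgraph d :=
  existT _ n (exist _ (val G) (regular_max_degree (valP G))).

Fixpoint gball (V : Type) (e : V -> V -> Prop) (r : nat) (v : V) : set V :=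
  if r is r'.+1 then
    gball e r' v `|` [set y | exists2 x, gball e r' v x & e x y]
  else [set v].

Definition pre_rcgraph (k : nat) : Type :=
  {n : nat & (sgraph n * 'I_n * {ffun 'I_n -> 'I_k})%type}.

Definition rc_graph (k : nat) (H : pre_rcgraph k) : sgraph (tag H) :=
  (tagged H).1.1.
Definition rc_root (k : nat) (H : pre_rcgraph k) : 'I_(tag H) :=
  (tagged H).1.2.
Definition rc_color (k : nat) (H : pre_rcgraph k) : 'I_(tag H) -> 'I_k :=
  (tagged H).2.
Arguments rc_color {k} H _.

(* Radius at most r means that every vertex is within distance r of the root;
   in particular the graph is connected. *)
Definition is_rcgraph (d r k : nat) (H : pre_rcgraph k) : bool :=
  `[< gball (adj (rc_graph H)) r (rc_root H) = setT >] &&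
  max_degree_le d (rc_graph H).

Definition rcgraph (d r k : nat) : Type :=
  {H : pre_rcgraph k | is_rcgraph d r H}.

(* H is isomorphic, as a rooted colored graph, to the subgraph of (V, e)
   induced on B, rooted at v and colored by f. *)
Definition rc_iso (k : nat) (H : pre_rcgraph k)
    (V : Type) (e : V -> V -> Prop) (B : set V) (v : V) (f : V -> 'I_k) : Prop :=
  exists phi : 'I_(tag H) -> V,
    [/\ set_bij setT B phi, phi (rc_root H) = v,
        (forall i j, adj (rc_graph H) i j <-> e (phi i) (phi j))
      & (forall i, f (phi i) = rc_color H i)].

Definition rcgraph_iso (d r k : nat) : rel (rcgraph d r k) := fun H H' =>
  `[< rc_iso (val H) (adj (rc_graph (val H'))) setT (rc_root (val H'))
        (rc_color (val H')) >].

Lemma rcgraph_iso_refl (d r k : nat) : reflexive (@rcgraph_iso d r k).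
Proof.
move=> H; apply/asboolP; exists id; split => //.
by split => // x _; exists x.
Qed.

Lemma rcgraph_iso_sym (d r k : nat) : symmetric (@rcgraph_iso d r k).
Proof.
suff h H H' : rcgraph_iso H H' -> @rcgraph_iso d r k H' H.
  by move=> H H'; apply/idP/idP; exact: h.
move=> /asboolP[phi [bphi rphi ephi cphi]]; apply/asboolP.
have [_ injphi surphi] := bphi.
have /choice[psi psiK] y : exists x, phi x = y by have [x _ <-] := surphi y I; exists x.
exists psi; split.
- split => //.
  + by move=> y y' _ _ yy'; rewrite -(psiK y) yy' psiK.
  + by move=> x _; exists (phi x) => //; apply: injphi; rewrite ?in_setT ?psiK.
- by apply: injphi; rewrite ?in_setT ?psiK.
- by move=> i j; rewrite ephi !psiK.
- by move=> i; rewrite -cphi psiK.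
Qed.

Lemma rcgraph_iso_trans (d r k : nat) : transitive (@rcgraph_iso d r k).
Proof.
move=> H2 H1 H3 /asboolP[phi [bphi rphi ephi cphi]].
move=> /asboolP[psi [bpsi rpsi epsi cpsi]]; apply/asboolP.
exists (psi \o phi); split.
- exact: set_bij_comp bpsi.
- by rewrite /= rphi.
- by move=> i j; rewrite ephi epsi.
- by move=> i; rewrite /= cpsi cphi.
Qed.

Definition rcgraph_equiv (d r k : nat) : equiv_rel (rcgraph d r k) :=
  EquivRel (@rcgraph_iso d r k) (@rcgraph_iso_refl d r k)
    (@rcgraph_iso_sym d r k) (@rcgraph_iso_trans d r k).

(* The set U^{r,k} of isomorphism classes of rooted colored graphs. *)
Definition U (d r k : nat) : Type := {eq_quot (@rcgraph_equiv d r k)}.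

Definition ball_class (d r k : nat) (V : Type) (e : V -> V -> Prop)
    (f : V -> 'I_k) (v : V) (u : U d r k) : Prop :=
  exists H : rcgraph d r k,
    \pi_(U d r k) H = u /\ rc_iso (val H) e (gball e r v) v f.

(* Measures on the finite set U d r k are given by their values on all subsets.
   For a graphing with a Borel coloring, the vertex set below is Borel (bounded
   degree Borel graphs are unions of finitely many Borel partial functions), so
   the law is a probability measure. *)
Definition color_law (R : realType) (d r k : nat) (V : Type)
    (e : V -> V -> Prop) (p : set V -> R) (f : V -> 'I_k) : set (U d r k) -> R :=
  fun A => p [set v | exists2 u, A u & ball_class e f v u].

Definition dTV (R : realType) (T : Type) (mu mu' : set T -> R) : R :=
  sup [set `|mu A - mu' A| | A in [set: set T]].

Definition hausdorff_dist (R : realType) (M : Type) (dist : M -> M -> R)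
    (A B : set M) : R :=
  Num.max (sup [set inf [set dist a b | b in B] | a in A])
          (sup [set inf [set dist a b | a in A] | b in B]).

Definition qfamily (R : realType) (d : nat) : Type :=
  forall r k : nat, set (set (U d r k) -> R).

Definition dCN (R : realType) (d : nat) (Q Q' : qfamily R d) : R :=
  fine (\sum_(1 <= k <oo) \sum_(1 <= r <oo)
    (2 ^- (k + r) * hausdorff_dist (@dTV R _) (Q r k) (Q' r k))%:E)%E.

Definition unif_vertex (R : realType) (n : nat) (A : set 'I_n) : R :=
  #|[pred v | `[< A v >]]|%:R / n%:R.

Definition Qgraph (R : realType) (d n : nat) (G : sgraph n) : qfamily R d :=
  fun r k => [set color_law (adj G) (@unif_vertex R n) f
             | f in [set: 'I_n -> 'I_k]].
Arguments Qgraph R d {n} G r k.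

Definition dX (R : realType) (d : nat) (G G' : Xgraph d) : R :=
  dCN (Qgraph R d (val (tagged G))) (Qgraph R d (val (tagged G'))).

Lemma hausdorff_dist_refl (R : realType) (M : Type) (dist : M -> M -> R)
    (A : set M) :
  (forall x y, 0 <= dist x y) -> (forall x, dist x x = 0) ->
  hausdorff_dist dist A A = 0.
Proof.
move=> d0 dxx.
have inf0 (f : M -> R) a : A a -> f a = 0 -> (forall b, 0 <= f b) ->
    inf [set f b | b in A] = 0.
  move=> Aa fa f0; apply/eqP; rewrite eq_le; apply/andP; split.
  - by apply: ge_inf; [exists 0 => _ [b _ <-] | exists a].
  - by apply: lb_le_inf; [exists 0, a | move=> _ [b _ <-]].
have supA0 (f : M -> R) : (forall a, A a -> f a = 0) ->
    sup [set f a | a in A] = 0.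
  move=> f0; have [->|/set0P[a Aa]] := eqVneq A set0.
    by rewrite image_set0 sup0.
  suff -> : [set f a | a in A] = [set 0] by rewrite sup1.
  apply/seteqP; split=> [_ [b Ab <-]|_ ->]; first exact: f0.
  by exists a => //; exact: f0.
rewrite /hausdorff_dist !supA0 ?maxxx// => a Aa.
- exact: (inf0 (dist^~ a) a).
- exact: (inf0 (dist a) a).
Qed.

Lemma dTV_ge0 (R : realType) (T : Type) (mu mu' : set T -> R) :
  0 <= dTV mu mu'.
Proof.
have [h|h] := pselect (has_sup [set `|mu A - mu' A| | A in [set: set T]]).
  apply: (le_trans (normr_ge0 (mu set0 - mu' set0))).
  by apply: ub_le_sup; [exact: h.2 | exists set0].
by rewrite /dTV sup_out.
Qed.

Lemma dTV_refl (R : realType) (T : Type) (mu : set T -> R) : dTV mu mu = 0.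
Proof.
rewrite /dTV; suff -> : [set `|mu A - mu A| | A in [set: set T]] = [set 0].
  by rewrite sup1.
apply/seteqP; split=> [_ [A _ <-]|_ ->]; first by rewrite subrr normr0.
by exists set0 => //; rewrite subrr normr0.
Qed.

Lemma dX_refl (R : realType) (d : nat) (G : Xgraph d) : dX R G G = 0.
Proof.
rewrite /dX /dCN eseries0 ?fine0// => k _ _; rewrite eseries0// => r _ _.
by rewrite hausdorff_dist_refl ?mulr0//; [exact: dTV_ge0 | exact: dTV_refl].
Qed.

Definition cauchy_seq (R : realType) (X : Type) (dist : X -> X -> R)
    (u : nat -> X) : Prop :=
  forall eps : R, 0 < eps ->
    exists N, forall m n, (N <= m)%N -> (N <= n)%N -> dist (u m) (u n) < eps.

Definition cauchy_class (R : realType) (X : Type) (dist : X -> X -> R)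
    (u : nat -> X) : set (nat -> X) :=
  [set v | cauchy_seq dist v /\ (fun n => dist (u n) (v n)) @ \oo --> (0 : R)].

(* Points are equivalence classes of Cauchy sequences; points of X at distance
   zero are thereby identified. *)
Definition completion (R : realType) (X : Type) (dist : X -> X -> R) : Type :=
  {c : set (nat -> X) |
    exists2 u, cauchy_seq dist u & c = cauchy_class dist u}.

Section completion.
Context (R : realType) (X : Type) (dist : X -> X -> R).
Local Notation Xb := (completion dist).

Definition completion_seq (x : Xb) : nat -> X := s2val (cid2 (svalP x)).

Definition completion_dist (x y : Xb) : R :=
  limn (fun n => dist (completion_seq x n) (completion_seq y n)).

Definition completion_open (A : set Xb) : Prop :=
  forall x, A x -> exists2 eps : R, 0 < eps &
    [set y | completion_dist x y < eps] `<=` A.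

HB.instance Definition _ := gen_eqMixin Xb.
HB.instance Definition _ := gen_choiceMixin Xb.

Lemma completion_openT : completion_open setT.
Proof. by move=> x _; exists 1. Qed.

Lemma completion_openI : setI_closed completion_open.
Proof.
move=> A B oA oB x [/oA[e e0 eA] /oB[e' e'0 eB]].
exists (Num.min e e'); first by rewrite lt_min e0.
by move=> y /=; rewrite lt_min => /andP[/eA ? /eB].
Qed.

Lemma completion_open_bigU (I : Type) (f : I -> set Xb) :
  (forall i, completion_open (f i)) -> completion_open (\bigcup_i f i).
Proof.
move=> fo x [i _ /fo[e e0 ef]]; exists e => // y /ef fy; by exists i.
Qed.

HB.instance Definition _ := isOpenTopological.Build Xb
  completion_openT completion_openI completion_open_bigU.

Hypothesis dist_refl : forall x, dist x x = 0.

Lemma cauchy_seq_cst (x : X) : cauchy_seq dist (fun=> x).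
Proof. by move=> eps eps0; exists 0%N => m n _ _; rewrite dist_refl. Qed.

Definition completion_incl (x : X) : Xb :=
  exist _ (cauchy_class dist (fun=> x))
    (ex_intro2 _ _ (fun=> x) (cauchy_seq_cst x) erefl).

End completion.

(* The compact space of bounded degree graphs with the local-global topology. *)
Definition Xbar (R : realType) (d : nat) : Type := completion (@dX R d).

Definition Xbar_of (R : realType) (d n : nat) (G : reg_graph d n) : Xbar R d :=
  completion_incl (@dX_refl R d) (Xgraph_of G).

Definition separable (T : topologicalType) : Prop :=
  exists2 D : set T, countable D & dense D.

Definition borel (T : ptopologicalType) : Type :=
  g_sigma_algebraType (@open T).

HB.instance Definition _ (T : ptopologicalType) := Measurable.on (borel T).

(* The Polish space comes with a chosen complete metric, but only its Borel
   structure is used. *)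
Record graphing (R : realType) (d : nat) := Graphing {
  space : completePseudoMetricType R;
  space_hausdorff : hausdorff_space space;
  space_separable : separable space;
  vertex_law : probability (borel space) R;
  edge : set (borel space * borel space);
  edge_measurable : measurable edge;
  edge_irrefl : forall x, ~ edge (x, x);
  edge_sym : forall x y, edge (x, y) -> edge (y, x);
  edge_degree : forall x, ([set y | edge (x, y)] #<= `I_d)%card;
  edge_unimodular : forall A B : set (borel space),
    measurable A -> measurable B ->
    (\int[vertex_law]_(x in A) counting ([set y | edge (x, y)] `&` B) =
     \int[vertex_law]_(x in B) counting ([set y | edge (x, y)] `&` A))%E }.

Arguments edge {R d} g _.

Definition Qgraphing (R : realType) (d : nat) (g : graphing R d) : qfamily R d :=
  fun r k => [set color_law (fun x y => edge g (x, y))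
                    (fun A => fine (vertex_law g A)) f
             | f in [set f : borel (space g) -> 'I_k |
                      forall c, measurable (f @^-1` [set c])]].
Arguments Qgraphing {R d} g r k.

(* The graphing g represents the point x of the completion. *)
Definition represents (R : realType) (d : nat) (g : graphing R d)
    (x : Xbar R d) : Prop :=
  (fun n => dCN (Qgraph R d (val (tagged (completion_seq x n)))) (Qgraphing g))
    @ \oo --> (0 : R).

Definition uniform_random_graph (R : realType) (disp : measure_display)
    (T : measurableType disp) (P : probability T R) (d n : nat)
    (G : T -> reg_graph d n) : Prop :=
  forall g : reg_graph d n, measurable (G @^-1` [set g]) /\
    P (G @^-1` [set g]) = (#|{: reg_graph d n}|%:R^-1)%:E.

Definition independent_graphs (R : realType) (disp : measure_display)
    (T : measurableType disp) (P : probability T R) (d : nat)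
    (I : choiceType) (n : I -> nat) (G : forall i, T -> reg_graph d (n i)) : Prop :=
  forall (J : {fset I}) (A : forall i, set (reg_graph d (n i))),
    P (\bigcap_(i in [set` J]) G i @^-1` A i) =
    (\prod_(i <- J) P (G i @^-1` A i))%E.

(* Random d-regular graphs on n vertices exist for d * n even and n > d; without
   the latter condition on the sizes, the last clause could hold vacuously. *)
Definition typical (R : realType) (d : nat) (g : graphing R d) : Prop :=
  exists S : set nat,
    [/\ infinite_set S,
        (forall n, S n -> ~~ odd (d * n) /\ (d < n)%N)
      & forall (disp : measure_display) (T : measurableType disp)
          (P : probability T R) (G : forall n : S, T -> reg_graph d (val n)),
          (forall n, uniform_random_graph P (G n)) -> independent_graphs P G ->
          {ae P, forall w, forall eps : R, 0 < eps ->
            \forall N \near \oo, forall n : S, (N <= val n)%N ->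
              dCN (Qgraph R d (val (G n w))) (Qgraphing g) < eps}].

(* Main.v *)
(* If P(G_i in C) does not tend to 0, then along infinitely many sizes n a
   positive fraction of the d-regular graphs on n vertices lies in C. Two sets
   of d-regular graphs of positive density contain graphs that differ in o(n)
   edges: lift them to the configuration model, where simple pairings have at
   least polynomially small probability while the symmetric group has
   exponential isoperimetry. Since d_CN is totally bounded, some graph a_n in C
   then has almost all d-regular graphs on n vertices within a small distance.

   To find the limit of the a_n as a graphing, label each vertex of a_n by the
   bit sequence recording the colors, for countably many colorings, of all
   vertices reached from it by walks. The laws of these labels have an
   ultralimit on the Cantor space; deleting the first step of all walks defines
   a graphing on it, and properties depending on finitely many bits pass from
   the graphs to the graphing. The colorings include epsilon-nets for all
   neighborhood statistics, which makes the convergence local-global.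

   A subsequence of the a_n converges to this graphing, so it represents a point
   of C; by Borel-Cantelli random regular graphs of these sizes converge to it
   almost surely, so it is typical. *)
Require Import Defs.
From HB Require Import structures.
From mathcomp Require Import all_boot all_order all_algebra perm.
From mathcomp Require Import all_classical all_reals all_analysis.
From mathcomp Require Import measurable_realfun.
From mathcomp Require Import ring lra zify.

Set Implicit Arguments.
Unset Strict Implicit.
Unset Printing Implicit Defensive.

Import Order.TTheory GRing.Theory Num.Theory.
Import numFieldNormedType.Exports.

Local Open Scope ring_scope.

(** * Isoperimetry in the symmetric group *)

Section perm_concentration.
Variable R : realType.

(** The polynomial bound for simple pairings comes from switchings: half of all pairings have
    boundedly many defective edges, and one transposition lowers their number at the cost of a
    factor [N ^ 2]. In the limit the obstacle is that equality of two points of the Cantor space,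
    hence adjacency and ball classes, involves infinitely many bits. Colorings that separate the
    points of a ball reduce it to finitely many bits on the closure of the labels, a set of full
    measure; elsewhere all steps are made trivial. A step is named by the color of its target, so it
    is undone by the step named by the color of its origin. This yields both the symmetry of the
    edges and the invariance of the measure. Hausdorff convergence needs two approximations.
    Colorings of the graphs are replaced by those of a finite net whose size does not depend on the
    graph, and these exist on the limit as well. Measurable colorings of the limit are replaced by
    ones that read finitely many bits, and these can be pulled back to the graphs. *)

Lemma expR_le_quadratic (x : R) : `|x| <= 2^-1 -> expR x <= 1 + x + 2 * x ^+ 2.
Proof.
rewrite ler_norml => /andP[x1 x2].
have y0 : 0 < 1 - x by lra.
have h := expR_ge1Dx (- x); rewrite expRN in h.
have e0 := expR_gt0 x.
have h2 : (1 - x) * expR x <= 1.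
  by rewrite -[leRHS](mulVf (lt0r_neq0 e0)) ler_pM2r.
rewrite -(ler_pM2l y0); apply: (le_trans h2).
rewrite -subr_ge0 (_ : _ - _ = x ^+ 2 * (1 - 2 * x)); first by apply: mulr_ge0; [exact: sqr_ge0|lra].
ring.
Qed.

Definition perm_mean (n : nat) (f : {perm 'I_n} -> R) : R :=
  (\sum_s f s) / n`!%:R.

Definition tperm_lipschitz (n : nat) (c : R) (f : {perm 'I_n} -> R) : Prop :=
  forall s i j, `|f (s * tperm i j)%g - f s| <= c.

Lemma lift_perm0_bij (n : nat) :
  bijective (fun js : 'I_n.+1 * {perm 'I_n} => lift_perm ord0 js.1 js.2).
Proof.
apply: inj_card_bij; last by rewrite card_prod !card_Sn card_ord.
move=> [j s] [j' s'] /= e.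
have ej : j = j' by rewrite -(lift_perm_id ord0 j s) e lift_perm_id.
rewrite ej in e *; congr pair; apply/permP => k.
by apply: (@lift_inj _ j'); rewrite -!(lift_perm_lift ord0) e.
Qed.

Lemma sum_perm_lift (n : nat) (V : nmodType) (f : {perm 'I_n.+1} -> V) :
  \sum_s f s = \sum_j \sum_s f (lift_perm ord0 j s).
Proof.
rewrite (reindex _ (onW_bij _ (lift_perm0_bij n))) /=.
by rewrite pair_bigA.
Qed.

Lemma lift_tperm (n : nat) (j : 'I_n.+1) (a b : 'I_n) :
  lift_perm j j (tperm a b) = tperm (lift j a) (lift j b).
Proof.
apply/permP => k; case: (unliftP j k) => [k'|] ->.
  rewrite lift_perm_lift; case: (tpermP a b k') => [->|->|/eqP ka /eqP kb].
  - by rewrite tpermL.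
  - by rewrite tpermR.
  - by rewrite tpermD // (inj_eq (@lift_inj _ j)) eq_sym.
by rewrite lift_perm_id tpermD // eq_sym neq_lift.
Qed.

Lemma sum_perm_fiber (n : nat) (f : {perm 'I_n.+1} -> R) (j : 'I_n.+1) :
  \sum_s f (lift_perm ord0 j s) = \sum_(s : {perm 'I_n.+1} | s ord0 == j) f s.
Proof.
rewrite [RHS]big_mkcond [RHS]sum_perm_lift [RHS](bigD1 j) //= [X in _ + X]big1 ?addr0.
  by apply: eq_bigr => s _; rewrite lift_perm_id eqxx.
move=> k kj; apply: big1 => s _.
by rewrite lift_perm_id (negbTE kj).
Qed.

(** A martingale argument that reveals the image of one point at a time. Swapping the values [j] and
    [j'] maps one fiber onto the other and moves [f] by at most [c], so the conditional means [g j]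
    lie within [c] of the mean; each revealed point then costs a factor [expR (2 * c ^+ 2)]. *)
Lemma perm_exp_moment (n : nat) (c : R) (f : {perm 'I_n} -> R) :
  0 <= c -> c <= 2^-1 -> tperm_lipschitz c f ->
  \sum_s expR (f s - perm_mean f) <= n`!%:R * expR (2 * c ^+ 2 * n%:R).
Proof.
move=> c0 c1; elim: n f => [|n IH] f fL.
  rewrite mulr0 expR0 mulr1 /perm_mean fact0 divr1.
  have E (h : {perm 'I_0} -> R) : \sum_s h s = h 1%g.
    apply: big_pred1 => s /=; apply/esym/eqP/permP => -[//].
  by rewrite !E subrr expR0.
pose g j := perm_mean (fun s => f (lift_perm ord0 j s)).
pose M := perm_mean f.
have nf0 : 0 < n`!%:R :> R by rewrite ltr0n fact_gt0.
have n10 : 0 < n.+1%:R :> R by rewrite ltr0n.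
have sumg : \sum_j g j = n.+1%:R * M.
  rewrite /M /perm_mean sum_perm_lift -mulr_suml factS natrM invfM.
  by rewrite mulrCA mulVKf// gt_eqF.
have gg j j' : `|g j - g j'| <= c.
  rewrite /g /perm_mean -mulrBl normrM [X in _ * X]ger0_norm ?invr_ge0 ?(ltW nf0)//.
  rewrite ler_pdivrMr//.
  have -> : \sum_s f (lift_perm ord0 j s) =
            \sum_s f (lift_perm ord0 j' s * tperm j j')%g.
    rewrite (@sum_perm_fiber _ f) (@sum_perm_fiber _ (fun s => f (s * tperm j j')%g)).
    rewrite (reindex_inj (mulIg (tperm j j'))) /=; apply: eq_bigl => s.
    by rewrite permM (canF_eq (tpermK _ _)) tpermL.
  rewrite -sumrB; apply: (le_trans (ler_norm_sum _ _ _)).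
  apply: (le_trans (ler_sum _ (fun s _ => fL _ _ _))).
  by rewrite sumr_const cardT -cardE card_Sn mulr_natr.
have gM j : `|g j - M| <= c.
  rewrite -(ler_pM2l n10) -[X in X * _ <= _](gtr0_norm n10) -normrM mulrBr -sumg.
  have -> : n.+1%:R * g j = \sum_(j' < n.+1) g j by rewrite sumr_const card_ord mulr_natl.
  rewrite -sumrB; apply: (le_trans (ler_norm_sum _ _ _)).
  apply: (le_trans (ler_sum _ (fun i _ => gg _ _))).
  by rewrite sumr_const card_ord mulr_natl.
rewrite sum_perm_lift.
have step j : \sum_s expR (f (lift_perm ord0 j s) - M) <=
    n`!%:R * expR (2 * c ^+ 2 * n%:R) * expR (g j - M).
  have -> : \sum_s expR (f (lift_perm ord0 j s) - M) =
      (\sum_s expR (f (lift_perm ord0 j s) - g j)) * expR (g j - M).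
    rewrite mulr_suml; apply: eq_bigr => s _; rewrite -expRD; congr expR; lra.
  rewrite ler_pM2r ?expR_gt0//; apply: IH => s a b.
  rewrite -[in lift_perm _ _ (s * _)%g](lift_permM ord0 j j) lift_tperm; exact: fL.
apply: (le_trans (ler_sum _ (fun j _ => step j))).
rewrite -mulr_sumr factS natrM.
(* The linear terms cancel because the [g j] average to [M]; only the quadratic term survives. *)
have sumexp : \sum_j expR (g j - M) <= n.+1%:R * expR (2 * c ^+ 2).
  apply: (@le_trans _ _ (\sum_(j < n.+1) (1 + (g j - M) + 2 * c ^+ 2))).
    apply: ler_sum => j _; apply: (le_trans (expR_le_quadratic (le_trans (gM j) c1))).
    have : (g j - M) ^+ 2 <= c ^+ 2 by rewrite -real_normK ?num_real// lerXn2r ?nnegrE.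
    lra.
  rewrite !big_split /= sumrN !sumr_const !card_ord sumg.
  rewrite -(mulr_natl M) subrr addr0 -(mulr_natl (2 * c ^+ 2)).
  rewrite -[X in X + _]mulr1 -mulrDr ler_pM2l//.
  exact: expR_ge1Dx.
apply: (@le_trans _ _ (n`!%:R * expR (2 * c ^+ 2 * n%:R) * (n.+1%:R * expR (2 * c ^+ 2)))).
  by rewrite ler_pM2l// mulr_gt0// expR_gt0.
rewrite -(natr1 n) [X in _ <= _ * expR X]mulrDr mulr1 expRD.
by rewrite le_eqVlt; apply/orP; left; apply/eqP; ring.
Qed.

Definition perm_ham (n : nat) (s t : {perm 'I_n}) : nat :=
  #|[pred i | s i != t i]|.

Lemma perm_ham_tperm (n : nat) (s t : {perm 'I_n}) (i j : 'I_n) :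
  (perm_ham (s * tperm i j)%g t <= perm_ham s t + 2)%N.
Proof.
have sub : [pred k | (s * tperm i j)%g k != t k] \subset
    predU [pred k | s k != t k] (pred2 ((s^-1)%g i) ((s^-1)%g j)).
  apply/fintype.subsetP => k; rewrite !inE permM.
  case: tpermP => [e|e|_ _ ->] // _; by rewrite -e permK eqxx ?orbT.
apply: (leq_trans (subset_leq_card sub)).
rewrite -(leq_add2r #|[predI [pred k | s k != t k] & (pred2 ((s^-1)%g i) ((s^-1)%g j))]|).
rewrite cardUI -addnA leq_add2l (leq_trans _ (leq_addr _ _))//.
by rewrite card2; case: (_ != _).
Qed.

(* Apply the exponential moment bound to a multiple of the Hamming distance to A. *)
Lemma perm_isoperimetry (n : nat) (eta : R) (A B : {set {perm 'I_n}}) :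
  0 < eta -> eta <= 1 ->
  (forall a b, a \in A -> b \in B -> eta * n%:R <= (perm_ham b a)%:R) ->
  #|A|%:R * #|B|%:R <= n`!%:R ^+ 2 * expR (- (eta ^+ 2 * n%:R / 64)).
Proof.
move=> eta0 eta1 far.
have nf0 : 0 < n`!%:R :> R by rewrite ltr0n fact_gt0.
have [->|/set0Pn[a0 a0A]] := eqVneq A finset.set0.
  by rewrite cards0 mul0r mulr_ge0// ?sqr_ge0 ?expR_ge0.
pose D s := perm_ham s [arg min_(a < a0 in A) perm_ham s a].
have DA s : exists2 a, a \in A & D s = perm_ham s a.
  by rewrite /D; case: arg_minnP => // a aA _; exists a.
have Dle s a : a \in A -> (D s <= perm_ham s a)%N.
  by move=> aA; rewrite /D; case: arg_minnP => // b bA; apply.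
have Dt s i j : (D (s * tperm i j)%g <= D s + 2)%N.
  have [a aA ->] := DA s; apply: (leq_trans (Dle _ _ aA)).
  exact: perm_ham_tperm.
(* [l] maximizes [l * eta - 16 * l ^+ 2], whose second term comes from two moment bounds at
   Lipschitz constant [2 * l]; the maximum is [eta ^+ 2 / 64]. *)
pose l : R := eta / 32.
pose F s := l * (D s)%:R.
have l0 : 0 < l by rewrite /l; lra.
have FL : tperm_lipschitz (2 * l) F.
  move=> s i j; rewrite /F -mulrBr normrM gtr0_norm// mulrC ler_pM2r//.
  have h1 := Dt s i j; have := Dt (s * tperm i j)%g i j.
  rewrite -mulgA tperm2 mulg1 => h2.
  rewrite ler_norml; apply/andP; split.
    by rewrite lerBrDl lerBlDr -natrD ler_nat.
  by rewrite lerBlDl -natrD ler_nat.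
have FL' : tperm_lipschitz (2 * l) (fun s => - F s).
  by move=> s i j; rewrite -normrN opprD !opprK; exact: FL.
have l2 : 2 * l <= 2^-1 by rewrite /l; lra.
have l20 : 0 <= 2 * l by lra.
have H1 := perm_exp_moment l20 l2 FL; have H2 := perm_exp_moment l20 l2 FL'.
have meanN : perm_mean (fun s => - F s) = - perm_mean F.
  by rewrite /perm_mean sumrN mulNr.
rewrite meanN in H2; set M := perm_mean F in H1 H2.
set K := n`!%:R * _ in H1 H2.
(* The mean [M] enters the bounds for [A] and [B] with opposite signs and disappears from their
   product. *)
have HA : #|A|%:R * expR M <= K.
  apply: le_trans H2; rewrite (bigID [in A]) /= ler_wpDr//.
    by apply: sumr_ge0 => s _; exact: expR_ge0.
  rewrite mulr_natl -sumr_const; apply: ler_sum => s sA.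
  rewrite ler_expR opprK /F.
  have -> : D s = 0%N; last by rewrite mulr0 oppr0 add0r.
  apply/eqP; rewrite -leqn0; apply: (leq_trans (Dle _ _ sA)).
  by rewrite leqn0; apply/eqP/eq_card0 => k; rewrite !inE eqxx.
have HB : #|B|%:R * expR (l * (eta * n%:R) - M) <= K.
  apply: le_trans H1; rewrite (bigID [in B]) /= ler_wpDr//.
    by apply: sumr_ge0 => s _; exact: expR_ge0.
  rewrite mulr_natl -sumr_const; apply: ler_sum => s sB.
  rewrite ler_expR lerD2r ler_pM2l//; have [a aA ->] := DA s; exact: far.
have e0 := expR_gt0 (l * (eta * n%:R)).
rewrite -(ler_pM2r e0) -[leRHS]mulrA -expRD.
have -> : #|A|%:R * #|B|%:R * expR (l * (eta * n%:R)) =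
   (#|A|%:R * expR M) * (#|B|%:R * expR (l * (eta * n%:R) - M)).
  rewrite [RHS]mulrACA -expRD; congr (_ * expR _); lra.
apply: (@le_trans _ _ (K * K)).
  by apply: ler_pM => //; rewrite mulr_ge0// expR_ge0.
rewrite /K mulrACA -expr2 -expRD ler_wpM2l ?sqr_ge0// ler_expR /l.
by rewrite le_eqVlt; apply/orP; left; apply/eqP; field.
Qed.

End perm_concentration.

Local Close Scope ring_scope.

(** * The configuration model *)

(** A word is a list of [m] edges: [(i, false)] and [(i, true)] are the two half-edges of edge [i],
    and the word gives the vertex at each half-edge. Loops and multiple edges are allowed. *)
Local Notation word n m := {ffun 'I_m * bool -> 'I_n}.

Section words.
Variables (n d m : nat).
Implicit Types w : word n m.

Definition mate (p : 'I_m * bool) : 'I_m * bool := (p.1, ~~ p.2).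

Definition dart w (p : 'I_m * bool) : 'I_n * 'I_n := (w p, w (mate p)).

Definition darts w : {set 'I_n * 'I_n} := [set dart w p | p : 'I_m * bool].

Definition balanced w : Prop := forall v, #|[pred p | w p == v]| = d.

Definition is_loop w (i : 'I_m) : bool := w (i, false) == w (i, true).

(** The other edge is given by a half-edge [p] and not by its index, so that both orientations of a
    parallel copy are covered. *)
Definition parallel w (i : 'I_m) (p : 'I_m * bool) : bool :=
  [&& p.1 != i, w p == w (i, false) & w (mate p) == w (i, true)].

Definition bad_edge w (i : 'I_m) : bool :=
  is_loop w i || [exists p, parallel w i p].

Definition nbad w : nat := #|[pred i | bad_edge w i]|.

Lemma mateK : involutive mate.
Proof. by move=> [i b]; rewrite /mate /= negbK. Qed.

Lemma dart_inj w : nbad w = 0 -> injective (dart w).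
Proof.
move=> /card0_eq nb [i b] [j c] [e1 e2].
have := nb i; rewrite !inE /bad_edge => /norP[/eqP loopi /existsPn par].
have [ij|nij] := eqVneq i j; last first.
  case: b e1 e2 => /= e1 e2.
    have := par (mate (j, c)).
    by rewrite /parallel mateK -e1 -e2 !eqxx eq_sym nij.
  have := par (j, c).
  by rewrite /parallel -e1 -e2 !eqxx eq_sym nij.
subst j; have [->//|bc] := eqVneq b c.
by case: b bc e1 e2 loopi; case: c => //= _ -> // ->.
Qed.

Lemma darts_sgraph w : 0 < n -> nbad w = 0 -> is_sgraph (darts w).
Proof.
move=> n0 nb; apply/and3P; split=> //.
  apply/forallP => v; apply/imsetP => -[[i b] _ [e1 e2]].
  have := card0_eq nb i; rewrite !inE /bad_edge => /norP[/eqP + _]; apply.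
  by move: e1 e2; case: b => <- <-.
have sym : forall u v, (u, v) \in darts w -> (v, u) \in darts w.
  move=> u v /imsetP[p _ [-> ->]]; apply/imsetP; exists (mate p) => //.
  by rewrite /dart mateK.
by apply/forallP => u; apply/forallP => v; apply/eqP; apply/idP/idP; exact: sym.
Qed.

Lemma darts_degree w (v : 'I_n) : injective (dart w) -> balanced w ->
  #|[pred u | (v, u) \in darts w]| = d.
Proof.
move=> dinj bal; rewrite -(bal v).
have sinj : {in [pred p | w p == v] &, injective (fun p => w (mate p))}.
  by move=> p q; rewrite !inE => /eqP pv /eqP qv e; apply: dinj; rewrite /dart e pv qv.
rewrite -(card_in_image sinj); apply: eq_card => u; rewrite !inE.
apply/idP/idP => [/imsetP[p _ [ev eu]]|h].
  by apply/mapP; exists p; rewrite // mem_enum inE ev.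
case/mapP: h => p; rewrite mem_enum inE => /eqP <- ->.
by apply/imsetP; exists p.
Qed.

Definition closed_nbhd w (v : 'I_n) : {set 'I_n} :=
  v |: [set w (mate p) | p in [pred p | w p == v]].

Lemma card_closed_nbhd w v : balanced w -> #|closed_nbhd w v| <= d.+1.
Proof.
move=> bal; rewrite /closed_nbhd cardsU1 -add1n leq_add//; first by case: (_ \notin _).
by rewrite (leq_trans (leq_imset_card _ _)) // bal.
Qed.

Lemma closed_nbhdP w (p : 'I_m * bool) : w (mate p) \in closed_nbhd w (w p).
Proof. by rewrite !inE; apply/orP; right; apply/imsetP; exists p; rewrite ?inE. Qed.

Lemma card_word_preim w (A : {set 'I_n}) : balanced w ->
  #|[pred p | w p \in A]| = d * #|A|.
Proof.
move=> bal; rewrite -[LHS]sum1_card (partition_big w (fun v => v \in A)) //=.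
rewrite mulnC -sum_nat_const; apply: eq_bigr => v vA.
rewrite -(bal v) -sum1_card; apply: eq_bigl => p; rewrite !inE.
by case: eqP => [->|]; rewrite ?vA ?andbF.
Qed.

Definition swap_word (i j : 'I_m) w : word n m :=
  [ffun p => w (tperm (i, true) (j, true) p)].

Lemma swap_wordE (i j : 'I_m) w : i != j ->
  [/\ swap_word i j w (i, false) = w (i, false),
      swap_word i j w (i, true) = w (j, true),
      swap_word i j w (j, false) = w (j, false),
      swap_word i j w (j, true) = w (i, true) &
      forall p, p.1 != i -> p.1 != j -> swap_word i j w p = w p].
Proof.
move=> ij; split; rewrite ?ffunE ?tpermL ?tpermR ?tpermD ?xpair_eqE ?andbF //.
by move=> [k b] /= ki kj; rewrite ffunE tpermD // xpair_eqE eq_sym ?(negbTE ki) ?(negbTE kj).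
Qed.

(* Swapping the heads of a bad edge i and of a good edge j far from it makes
   both edges good. *)
Lemma swap_word_bad w (i j : 'I_m) : bad_edge w i -> ~~ bad_edge w j ->
  w (j, false) \notin closed_nbhd w (w (i, true)) ->
  w (j, true) \notin closed_nbhd w (w (i, false)) ->
  forall l, bad_edge (swap_word i j w) l -> bad_edge w l && (l != i).
Proof.
move=> badi goodj farx fary.
have ij : i != j by apply: contraTneq badi => ->.
have [ei0 ei1 ej0 ej1 el] := swap_wordE w ij.
set w' := swap_word i j w in ei0 ei1 ej0 ej1 el *.
set u := w (i, false) in fary ei0 *; set v := w (i, true) in farx ej1 *.
set x := w (j, false) in farx ej0 *; set y := w (j, true) in fary ei1 *.
have ux : y != u by apply: contra fary => /eqP ->; rewrite !inE eqxx.
have xv : x != v by apply: contra farx => /eqP ->; rewrite !inE eqxx.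
have yu p : p.1 != i -> p.1 != j -> ~ (w' p = u /\ w' (mate p) = y).
  move=> pi pj []; rewrite !el // => e1 e2.
  by move: fary; rewrite -e1 -e2 closed_nbhdP.
have vx p : p.1 != i -> p.1 != j -> ~ (w' p = v /\ w' (mate p) = x).
  move=> pi pj []; rewrite !el // => e1 e2.
  by move: farx; rewrite -e1 -e2 closed_nbhdP.
have yv : y != v.
  by apply: contra fary => /eqP ->; exact: (closed_nbhdP w (i, false)).
have xy : x != y by case/norP: goodj.
have goodi : ~~ bad_edge w' i.
  rewrite /bad_edge /is_loop ei0 ei1 eq_sym (negbTE ux) /=.
  apply/existsPn => -[l b]; apply/negP => /and3P[/= li]; rewrite ei0 ei1 => /eqP h1 /eqP h2.
  have [lj|lj] := eqVneq l j; last by apply: (yu (l, b)).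
  move: h1 h2; rewrite lj /mate /=; case: b => /=; rewrite ej0 ej1 => h1 h2.
    by rewrite h2 eqxx in xy.
  by rewrite h2 eqxx in yv.
have goodj' : ~~ bad_edge w' j.
  rewrite /bad_edge /is_loop ej0 ej1 (negbTE xv) /=.
  apply/existsPn => -[l b]; apply/negP => /and3P[/= lj]; rewrite ej0 ej1 => /eqP h1 /eqP h2.
  have [li|li] := eqVneq l i; last first.
    by apply: (vx (mate (l, b))) => //; rewrite mateK.
  move: h1 h2; rewrite li /mate /=; case: b => /=; rewrite ei0 ei1 => h1 h2.
    by rewrite h1 eqxx in xy.
  by rewrite h2 eqxx in yv.
move=> l badl.
have li : l != i by apply: contraTneq badl => ->.
have lj : l != j by apply: contraTneq badl => ->.
rewrite li andbT; move: badl; rewrite /bad_edge /is_loop /parallel !el //.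
move=> /orP[->//|/existsP[[q b] /= /and3P[ql /eqP h1 /eqP h2]]].
apply/orP; right; apply/existsP.
have [qi|qi] := eqVneq q i.
  case: b h1 h2; rewrite qi /mate /= ei0 ei1 => h1 h2.
    case: (yu (l, true)) => //; by rewrite /mate /= !el.
  case: (yu (l, false)) => //; by rewrite /mate /= !el.
have [qj|qj] := eqVneq q j.
  case: b h1 h2; rewrite qj /mate /= ej0 ej1 => h1 h2.
    case: (vx (l, false)) => //; by rewrite /mate /= !el.
  case: (vx (l, true)) => //; by rewrite /mate /= !el.
by exists (q, b); rewrite /= ql -h1 -h2 !el // !eqxx.
Qed.

(** The partner [j] must avoid the bad edges, at most [t.+1], and the edges having a prescribed end
    in one of two closed neighborhoods. Each neighborhood has at most [d.+1] vertices with [d]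
    half-edges each, whence [2 * (d * d.+1)]. The swap makes the set of bad edges strictly
    smaller. *)
Lemma exists_swap w (t : nat) : balanced w -> nbad w <= t.+1 -> 0 < nbad w ->
  2 * (d * d.+1) + t.+1 < m ->
  exists i j : 'I_m, nbad (swap_word i j w) <= t.
Proof.
move=> bal badt bad0 mbig.
have /card_gt0P[i badi] := bad0; rewrite !inE in badi.
pose Ax := [pred j : 'I_m | w (j, false) \in closed_nbhd w (w (i, true))].
pose Ay := [pred j : 'I_m | w (j, true) \in closed_nbhd w (w (i, false))].
have cA (b c : bool) :
    #|[pred j : 'I_m | w (j, b) \in closed_nbhd w (w (i, c))]| <= d * d.+1.
  apply: (@leq_trans #|[pred p | w p \in closed_nbhd w (w (i, c))]|).
    rewrite -(card_in_image (f := fun j : 'I_m => (j, b))); last by move=> k l _ _ [].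
    apply/subset_leq_card/fintype.subsetP => p /mapP[j]; rewrite mem_enum !inE => h ->; exact: h.
  by rewrite card_word_preim // leq_mul // card_closed_nbhd.
have : #|predU [pred j | bad_edge w j] (predU Ax Ay)| < #|'I_m|.
  rewrite card_ord; apply: leq_ltn_trans mbig.
  apply: (leq_trans (n := nbad w + (#|Ax| + #|Ay|))).
    have U (A B : pred 'I_m) : #|predU A B| <= #|A| + #|B| by rewrite -cardUI leq_addr.
    by apply: (leq_trans (U _ _)); rewrite leq_add2l; exact: U.
  rewrite addnC leq_add // mul2n -addnn leq_add //; exact: cA.
rewrite ltnNge => /negP h.
have [j] : exists j, j \notin predU [pred j | bad_edge w j] (predU Ax Ay).
  apply: contrapT => all; apply: h; rewrite subset_leq_card //.
  apply/fintype.subsetP => j _; apply/negPn/negP => hj; apply: all; by exists j.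
rewrite 3!inE => /norP[goodj]; rewrite inE => /norP[jx jy].
exists i, j; rewrite -ltnS (leq_trans _ badt) //.
have sw := swap_word_bad badi goodj jx jy.
apply: proper_card; rewrite fintype.properE; apply/andP; split.
  by apply/fintype.subsetP => l; rewrite !inE => /sw /andP[].
apply/fintype.subsetPn; exists i; rewrite ?inE //.
by apply/negP => /sw; rewrite eqxx andbF.
Qed.

End words.

(** * Random pairings and their defects *)

Section pairing.
Variables (n d m N : nat) (cell : 'I_N -> 'I_n) (iota : 'I_m * bool -> 'I_N).
Hypothesis cellE : forall v, #|[pred q | cell q == v]| = d.
Hypothesis iota_bij : bijective iota.

(** The configuration model: each vertex is a cell of [d] points, and [s] places the points on the
    half-edges, which are numbered by [iota]. *)
Definition pword (s : {perm 'I_N}) : word n m :=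
  [ffun p => cell (s (iota p))].

Lemma pairing_card : N = m.*2.
Proof.
have := bij_eq_card iota_bij.
by rewrite card_prod card_bool !card_ord muln2.
Qed.

Lemma pword_balanced s : balanced d (pword s).
Proof.
move=> v; rewrite -(cellE v).
have inj : injective (fun p => s (iota p)).
  by move=> p q /perm_inj/(bij_inj iota_bij).
rewrite -(fintype.card_image inj); apply: eq_card => q; rewrite [RHS]inE.
have [iota' iK iK'] := iota_bij.
apply/idP/idP => [/mapP[p]|qv].
  by rewrite mem_enum inE ffunE => pv ->.
apply/mapP; exists (iota' ((s^-1)%g q)); last by rewrite iK' permKV.
by rewrite mem_enum inE ffunE iK' permKV.
Qed.

(** Exchanging positions [q1] and [q] preserves [Pr] and [c], so the event at [q1] is equinumerous
    with the same event at each [q] in [Q]. For a fixed [s] at most [d] positions carry a point of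
    the cell [c s]; summing over [Q] gives the bound. *)
Lemma card_cell_position (Pr : pred {perm 'I_N}) (c : {perm 'I_N} -> 'I_n)
    (Q : pred 'I_N) (q1 : 'I_N) : Q q1 ->
  (forall q s, Q q -> Pr (tperm q1 q * s)%g = Pr s /\ c (tperm q1 q * s)%g = c s) ->
  #|[pred s | Pr s && (cell (s q1) == c s)]| * #|Q| <= d * #|Pr|.
Proof.
move=> Qq1 inv; rewrite mulnC -sum_nat_const.
have -> : \sum_(q in Q) #|[pred s | Pr s && (cell (s q1) == c s)]| =
    \sum_(q in Q) \sum_(s | Pr s) (cell (s q) == c s).
  apply: eq_bigr => q Qq; rewrite -sum1_card [RHS](reindex_inj (mulgI (tperm q1 q))) /=.
  rewrite (eq_bigl (fun s => Pr s && (cell (s q1) == c s))) // big_mkcondr /=.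
  apply: eq_big => [s|s _]; first by case: (inv q s Qq).
  by case: (inv q s Qq) => _ ->; rewrite permM tpermR; case: (_ == _).
rewrite exchange_big /= mulnC -sum_nat_const; apply: leq_sum => s _.
rewrite -big_mkcondr sum1_card -(cellE (c s)) -[X in _ <= X]sum1_card.
rewrite (reindex_inj (@perm_inj _ s)) /= sum1_card.
by apply/subset_leq_card/fintype.subsetP => q /andP[_ qc].
Qed.

Lemma card_predT_perm (k : nat) : #|(predT : pred {perm 'I_k})| = k`!.
Proof. by rewrite -card_Sn; apply: eq_card. Qed.

Lemma card_loops (i : 'I_m) :
  #|[pred s | is_loop (pword s) i]| * N.-1 <= d * N`!.
Proof.
pose p0 := iota (i, false); pose p1 := iota (i, true).
have p01 : p1 != p0 by rewrite (inj_eq (bij_inj iota_bij)) xpair_eqE andbF.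
have H := @card_cell_position predT (fun s => cell (s p0)) (predC1 p0) p1 p01.
rewrite cardC1 card_ord card_predT_perm in H.
apply: leq_trans (H _).
  rewrite leq_mul2r subset_leq_card ?orbT //; apply/fintype.subsetP => s.
  by rewrite !inE /is_loop !ffunE eq_sym.
by move=> q s qp0; split => //; rewrite permM tpermD.
Qed.

(** The two coincidences are exposed one after the other: the half-edge [mate p] can be exchanged
    with every position but that of [(i, true)], then [p] with every position but three, which
    leaves the first coincidence intact. *)
Lemma card_parallel (i : 'I_m) (p : 'I_m * bool) : p.1 != i ->
  #|[pred s | parallel (pword s) i p]| * (N - 3) * N.-1 <= d * (d * N`!).
Proof.
move=> pi; have injiota := bij_inj iota_bij.
pose p0 := iota (i, false); pose p1 := iota (i, true).
pose q0 := iota p; pose q1 := iota (mate p).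
have p01 : p1 != p0 by rewrite (inj_eq injiota) xpair_eqE andbF.
have q01 : q1 != q0.
  by rewrite (inj_eq injiota); apply/eqP => /(congr1 snd) /=; case: (p.2).
have qp b : q0 != iota (i, b).
  by rewrite (inj_eq injiota); apply: contra pi => /eqP ->.
have q1p b : q1 != iota (i, b).
  by rewrite (inj_eq injiota); apply: contra pi => /eqP e; rewrite -[p.1]/((mate p).1) e.
have H1 := @card_cell_position predT (fun s => cell (s p1)) (predC1 p1) q1 (q1p true).
rewrite cardC1 card_ord card_predT_perm in H1.
pose Q := predC (pred3 p0 p1 q1).
have Qq0 : Q q0 by rewrite /Q /= !negb_or !qp eq_sym q01.
have H0 := @card_cell_position (fun s => cell (s q1) == cell (s p1))
   (fun s => cell (s p0)) Q q0 Qq0.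
have cQ : #|Q| = N - 3.
  suff c3 : #|pred3 p0 p1 q1| = 3.
    have e := cardC (pred3 p0 p1 q1); rewrite card_ord c3 in e.
    by rewrite -[RHS](congr1 (subn^~ 3) e) addKn.
  have /card_uniqP : uniq [:: p0; p1; q1].
    by rewrite /= !inE !negb_or !(eq_sym _ q1) !q1p eq_sym p01.
  by move=> /= <-; apply: eq_card => x; rewrite !inE.
apply: leq_trans (leq_mul (leqnn d) (H1 _)); last first.
  by move=> q s qp1; split => //; rewrite permM tpermD // ?q1p // eq_sym.
rewrite mulnA leq_mul2r; apply/orP; right.
apply: leq_trans (H0 _); last first.
  move=> q s; rewrite /Q /= !negb_or => /and3P[h0 h1 h2].
  split; last by rewrite permM tpermD // qp.
  have q0q1 : q0 != q1 by rewrite eq_sym.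
  by rewrite !permM (tpermD q0q1 h2) (tpermD (qp true) h1).
rewrite cQ leq_mul2r subset_leq_card ?orbT //; apply/fintype.subsetP => s.
by rewrite !inE /parallel !ffunE pi /= andbC.
Qed.

(** Loops contribute at most [d] to the mean number of bad edges, parallel pairs at most [d * d]. *)
Lemma sum_nbad : 3 < m ->
  \sum_s nbad (pword s) <= (d + d * d) * N`!.
Proof.
move=> m3; have Nm := pairing_card.
have N3 : 0 < (N - 3) * N.-1 by rewrite muln_gt0; lia.
rewrite -(leq_pmul2r N3).
have h1 : \sum_s nbad (pword s) <=
  \sum_i (#|[pred s | is_loop (pword s) i]| +
    \sum_(p : 'I_m * bool | p.1 != i) #|[pred s | parallel (pword s) i p]|).
  rewrite (eq_bigr (fun s => \sum_i (bad_edge (pword s) i : nat))); last first.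
    by move=> s _; rewrite /nbad -sum1_card big_mkcond; apply: eq_bigr => i _; rewrite inE; case: ifP.
  rewrite exchange_big /=; apply: leq_sum => i _.
  rewrite (eq_bigr (fun p => \sum_s (parallel (pword s) i p : nat))); last first.
    by move=> p _; rewrite -sum1_card big_mkcond; apply: eq_bigr => s _; rewrite inE; case: ifP.
  rewrite exchange_big /= -sum1_card [X in _ <= X + _]big_mkcond -big_split /=.
  apply: leq_sum => s _; rewrite inE /bad_edge; case: (is_loop _ _) => //=.
  rewrite add0n; case: existsP => // -[p hp].
  have pi : p.1 != i by case/and3P: hp.
  by rewrite (bigD1 p) //= hp.
apply: (leq_trans (leq_mul h1 (leqnn _))); rewrite big_distrl /=.
have h2 (i : 'I_m) : (#|[pred s | is_loop (pword s) i]| +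
    \sum_(p : 'I_m * bool | p.1 != i) #|[pred s | parallel (pword s) i p]|) * ((N - 3) * N.-1)
   <= d * N`! * (N - 3) + m.*2 * (d * (d * N`!)).
  rewrite mulnDl leq_add //.
    by rewrite mulnCA mulnC leq_mul // card_loops.
  have -> : m.*2 = #|{: 'I_m * bool}| by rewrite card_prod card_bool card_ord muln2.
  rewrite big_distrl /= -sum_nat_const big_mkcond; apply: leq_sum => p _.
  case: ifP => // pi; by rewrite mulnA card_parallel.
apply: (@leq_trans (\sum_(i < m) (d * N`! * (N - 3) + m.*2 * (d * (d * N`!))))).
  by apply: leq_sum => i _; exact: h2.
rewrite sum_nat_const card_ord.
have {}m3 := m3; rewrite Nm; set F := (_)`!.
have a1 : m <= (m.*2).-1 by lia.
(* This estimate fails at [m = 3], whence the hypothesis [3 < m]. *)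
have a2 : m * m.*2 <= (m.*2 - 3) * (m.*2).-1.
  case: (m) m3 => [|[|[|[|k]]]] // _; nia.
have -> : m * (d * F * (m.*2 - 3) + m.*2 * (d * (d * F))) =
    d * F * (m.*2 - 3) * m + d * d * F * (m * m.*2) by ring.
have -> : (d + d * d) * F * ((m.*2 - 3) * (m.*2).-1) =
    d * F * (m.*2 - 3) * (m.*2).-1 + d * d * F * ((m.*2 - 3) * (m.*2).-1) by ring.
by rewrite leq_add // leq_mul.
Qed.

(** Markov's inequality at twice the bound for the mean. *)
Lemma card_few_bad : 3 < m ->
  N`! <= 2 * #|[pred s | nbad (pword s) <= 2 * (d + d * d)]|.
Proof.
move=> m3; set C := d + d * d.
have := sum_nbad m3; rewrite -/C => H.
pose A := [pred s | nbad (pword s) <= 2 * C].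
have h1 : (2 * C).+1 * #|predC A| <= C * N`!.
  apply: leq_trans H; rewrite mulnC -sum_nat_const [X in _ <= X](bigID A) /=.
  apply: (leq_trans _ (leq_addl _ _)); apply: leq_sum => s.
  by move=> hs; have {hs} : ~~ (nbad (pword s) <= 2 * C) := hs; rewrite -ltnNge.
have e : #|A| + #|predC A| = N`! by rewrite cardC -card_predT_perm.
rewrite -/A; set y := #|predC A| in h1 e; set F := N`! in h1 e *.
have y2 : 2 * y <= F.
  rewrite leqNgt; apply/negP => lt.
  have : C * F <= C * (2 * y) by rewrite leq_mul2l ltnW ?orbT.
  nia.
lia.
Qed.

Lemma pword_swap (i j : 'I_m) (s : {perm 'I_N}) :
  pword (tperm (iota (i, true)) (iota (j, true)) * s)%g = swap_word i j (pword s).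
Proof.
apply/ffunP => p; rewrite !ffunE permM -inj_tperm //; exact: bij_inj.
Qed.

(** Undoing a swap is again a transposition of positions, so every permutation counted on the left
    is one of [N ^ 2] transposed copies of a permutation counted on the right. One without bad edges
    is its own copy, under a trivial transposition. *)
Lemma card_repair (t : nat) : 2 * (d * d.+1) + t.+1 < m ->
  #|[pred s | nbad (pword s) <= t.+1]| <= N ^ 2 * #|[pred s | nbad (pword s) <= t]|.
Proof.
move=> mbig.
pose g (x : ('I_N * 'I_N) * {perm 'I_N}) := (tperm x.1.1 x.1.2 * x.2)%g.
pose A := [pred s | nbad (pword s) <= t].
apply: (@leq_trans #|[seq g x | x in [predX predT & A]]|); last first.
  apply: (leq_trans (leq_image_card _ _)).
  by rewrite cardX cardT -cardE card_prod card_ord.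
apply/subset_leq_card/fintype.subsetP => s; rewrite inE => bs.
have gE a b s' : s' \in A -> s = (tperm a b * s')%g -> s \in [seq g x | x in [predX predT & A]].
  by move=> As ->; apply/mapP; exists ((a, b), s') => //; rewrite mem_enum inE.
have [b0|b0] := posnP (nbad (pword s)).
  have [k _|k0] := pickP 'I_N; first by apply: (gE k k s); rewrite ?inE ?b0 // tperm1 mul1g.
  have : 0 < N by rewrite pairing_card; lia.
  by move=> N0; have := k0 (Ordinal N0).
have [i [j ij]] := exists_swap (pword_balanced s) bs b0 mbig.
apply: (gE (iota (i, true)) (iota (j, true)) (tperm (iota (i, true)) (iota (j, true)) * s)%g).
  by rewrite inE pword_swap.
by rewrite mulgA tperm2 mul1g.
Qed.

(* A uniformly random pairing is simple with at least polynomially small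
   probability; this is all that the exponential concentration needs. *)
Lemma card_simple_pairings :
  let C := 2 * (d + d * d) in 3 < m -> 2 * (d * d.+1) + C < m ->
  N`! <= 2 * (N ^ (2 * C) * #|[pred s | nbad (pword s) == 0]|).
Proof.
move=> C m3 mbig; apply: (leq_trans (card_few_bad m3)); rewrite leq_mul2l /=.
rewrite -/C; elim: C mbig => [|t IH] mbig.
  by rewrite muln0 expn0 mul1n; apply: eq_leq; apply: eq_card => s; rewrite !inE leqn0.
apply: (leq_trans (card_repair mbig)); rewrite mulnS expnD -mulnA leq_mul2l.
by rewrite IH ?orbT //; lia.
Qed.

End pairing.

(** * Words and pairings that represent a regular graph *)

Section regular_edges.
Variables (n d : nat).
Implicit Types G : reg_graph d n.

Definition redges G : {set 'I_n * 'I_n} := val (val G).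

Definition swap (x : 'I_n * 'I_n) := (x.2, x.1).

Lemma redges_irrefl G (i : 'I_n) : (i, i) \notin redges G.
Proof. by have /and3P[_ /forallP h _] := valP (val G); exact: h. Qed.

Lemma redges_sym G (x : 'I_n * 'I_n) : (swap x \in redges G) = (x \in redges G).
Proof.
case: x => i j; have /and3P[_ _ /forallP h] := valP (val G).
by have /forallP/(_ j)/eqP := h i.
Qed.

Lemma card_redges_from G (v : 'I_n) : #|[pred u | (v, u) \in redges G]| = d.
Proof. by have /forallP/(_ v)/eqP := valP G. Qed.

Lemma card_redges G : #|redges G| = n * d.
Proof.
rewrite -sum1_card (partition_big fst predT) //= -[n in n * d]card_ord -sum_nat_const.
apply: eq_bigr => v _; rewrite -(card_redges_from G v) -sum1_card.
rewrite (reindex_onto (fun u => (v, u)) snd) /=; last by move=> [a b] /andP[_ /eqP <-].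
by apply: eq_bigl => u; rewrite !inE !eqxx !andbT.
Qed.

Definition oedges G : {set 'I_n * 'I_n} := [set x in redges G | x.1 < x.2].

Lemma card_oedges G : #|redges G| = (#|oedges G|).*2.
Proof.
have swapK : involutive swap by case.
rewrite -addnn -(cardsID [set x : 'I_n * 'I_n | x.1 < x.2] (redges G)); congr (_ + _).
  by apply: eq_card => x; rewrite !inE.
rewrite -[RHS](card_imset _ (inv_inj swapK)).
apply: eq_card => x; rewrite !inE.
have -> : (x \in [set swap y | y in oedges G]) = (swap x \in oedges G).
  by rewrite -[x in LHS]swapK (mem_imset _ _ (inv_inj swapK)).
rewrite inE redges_sym andbC; case xG : (x \in redges G) => //=.
case: x xG => i j /= ijG; rewrite -leqNgt ltn_neqAle -[X in _ = ~~ X && _]/(j == i).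
case: eqP ijG => // -> iiG; have := redges_irrefl G i; by rewrite iiG.
Qed.

Variable m : nat.
Hypothesis nd_even : n * d = m.*2.
Implicit Types w : word n m.

(** Each edge is written once, from its smaller to its larger end. *)
Lemma graph_word_ex G : exists w : word n m, darts w = redges G.
Proof.
have oG : #|oedges G| = m by apply: double_inj; rewrite -card_oedges card_redges.
pose x (i : 'I_m) := enum_val (cast_ord (esym oG) i).
exists [ffun p => if p.2 then (x p.1).2 else (x p.1).1].
apply/finset.setP => y; apply/imsetP/idP => [[[i b] _ ->]|yG].
  have /setIdP[xG _] : x i \in oedges G by exact: enum_valP.
  rewrite /dart !ffunE /=; case: b; last by rewrite -surjective_pairing.
  by have := redges_sym G (x i); rewrite xG /swap.
have ex z : z \in oedges G -> exists i, x i = z.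
  by move=> zG; exists (cast_ord oG (enum_rank_in zG z)); rewrite /x cast_ordK enum_rankK_in.
have [lt|] := ltnP y.1 y.2.
  have [|i xi] := ex y; first by rewrite inE yG.
  by exists (i, false); rewrite // /dart !ffunE /= xi -surjective_pairing.
rewrite leq_eqVlt => /orP[/eqP/ord_inj e|lt].
  by have := redges_irrefl G y.1; rewrite -{2}e -surjective_pairing yG.
have [|i xi] := ex (swap y); first by rewrite inE redges_sym yG.
by exists (i, true); rewrite // /dart !ffunE /= xi -surjective_pairing.
Qed.

Lemma graph_word_inj G w : darts w = redges G -> injective (dart w).
Proof.
move=> wG; apply/injectiveP/card_uniqP; rewrite size_map -cardE.
have -> : #|[seq dart w x | x <- enum predT]| = #|redges G|.
  rewrite -wG; apply: eq_card => x; apply/mapP/imsetP => -[p _ ->]; exists p => //.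
  by rewrite mem_enum.
by rewrite card_redges nd_even cardT -cardE card_prod card_bool card_ord muln2.
Qed.

Lemma dart_mate w p : dart w (mate p) = swap (dart w p).
Proof. by rewrite /dart mateK. Qed.

(* Matching the darts of two fixed words for the two graphs transports every
   word for the first graph to a word for the second. *)
Lemma card_graph_words_le G1 G2 :
  #|[pred w : word n m | darts w == redges G1]| <=
  #|[pred w : word n m | darts w == redges G2]|.
Proof.
have [w1 w1E] := graph_word_ex G1; have [w2 w2E] := graph_word_ex G2.
have inj1 := graph_word_inj w1E; have inj2 := graph_word_inj w2E.
pose sg (w : word n m) p := odflt p [pick q | dart w1 q == dart w p].
have sgP w p : darts w = redges G1 -> dart w1 (sg w p) = dart w p.
  move=> wE; rewrite /sg; case: pickP => [q /eqP//|no].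
  have /imsetP[q _ e] : dart w p \in darts w1 by rewrite w1E -wE imset_f.
  by have := no q; rewrite -e eqxx.
pose g w : word n m := [ffun p => w2 (sg w p)].
have gd w p : darts w = redges G1 -> dart (g w) p = dart w2 (sg w p).
  move=> wE; rewrite /dart !ffunE; congr (_, w2 _); apply: inj1.
  by rewrite dart_mate !sgP// dart_mate.
rewrite -(@card_in_image _ _ g).
  apply/subset_leq_card/fintype.subsetP => w' /mapP[w]; rewrite mem_enum !inE => /eqP wE ->.
  rewrite -w2E; apply/eqP/finset.setP => x; apply/imsetP/imsetP => -[p _ ->].
    by exists (sg w p) => //; exact: gd.
  have /imsetP[q _ e] : dart w1 p \in darts w by rewrite wE -w1E imset_f.
  by exists q; rewrite // gd//; congr dart; apply: inj1; rewrite sgP.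
move=> w v; rewrite !inE => /eqP wE /eqP vE e; apply/ffunP => p.
suff : dart w p = dart v p by case.
rewrite -(sgP w p wE) -(sgP v p vE); congr (dart w1 _); apply: inj2.
by rewrite -(gd w p wE) -(gd v p vE) e.
Qed.

End regular_edges.

Section fibres.
Variables (n d m N : nat) (cell : 'I_N -> 'I_n) (iota : 'I_m * bool -> 'I_N).
Hypothesis cellE : forall v, #|[pred q | cell q == v]| = d.
Hypothesis iota_bij : bijective iota.
Local Notation pword := (pword cell iota).

Lemma cell_card : N = n * d.
Proof.
rewrite -[LHS]card_ord -sum1_card (partition_big cell predT) //=.
rewrite -[n in n * d]card_ord -sum_nat_const; apply: eq_bigr => v _.
by rewrite -(cellE v) -sum1_card; apply: eq_bigl => q; rewrite !inE.
Qed.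

Let nd_even : n * d = m.*2.
Proof. by rewrite -cell_card (pairing_card iota_bij). Qed.

Lemma graph_word_balanced (G : reg_graph d n) (w : word n m) :
  darts w = redges G -> balanced d w.
Proof.
move=> wG v; have dinj := graph_word_inj nd_even wG.
rewrite -(card_redges_from G v) -(@card_in_image _ _ (fun p => w (mate p))).
  apply: eq_card => u; rewrite [RHS]inE -wG.
  apply/mapP/imsetP => [[p]|[p _ [vp up]]].
    by rewrite mem_enum inE => /eqP <- ->; exists p.
  by exists p; rewrite // mem_enum inE vp.
move=> p q; rewrite !inE => /eqP pv /eqP qv e; apply: dinj.
by rewrite /dart e pv qv.
Qed.

(** Two balanced words are rearrangements of each other; multiplication by the rearrangement [r]
    carries the pairings of one to pairings of the other. *)
Lemma card_word_pairings_le (w1 w2 : word n m) :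
  balanced d w1 -> balanced d w2 ->
  #|[pred s | pword s == w1]| <= #|[pred s | pword s == w2]|.
Proof.
move=> b1 b2; have [iota' iK iK'] := iota_bij.
pose u (w : word n m) := [tuple w (iota' i) | i < N].
have cnt (w : word n m) v : balanced d w -> count_mem v (u w) = d.
  move=> bw; rewrite -(bw v) /= count_map -size_filter.
  rewrite -(@fintype.card_image _ _ iota (bij_inj iota_bij)) cardE; apply: perm_size.
  apply: uniq_perm; [by apply: filter_uniq; exact: enum_uniq|exact: enum_uniq|move=> i].
  rewrite mem_filter !mem_enum andbT /=; apply/idP/mapP => [h|[p]].
    by exists (iota' i); rewrite ?iK' // mem_enum inE.
  by rewrite mem_enum inE => h ->; rewrite iK.
have /tuple_permP[r ur] : perm_eq (u w2) (u w1).
  by apply/allP => v _; apply/eqP; rewrite /= !cnt.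
have ur' i : w2 (iota' i) = w1 (iota' (r i)).
  have ut : u w2 = [tuple tnth (u w1) (r i) | i < N] by apply: val_inj; exact: ur.
  by have := congr1 (fun t => tnth t i) ut; rewrite !tnth_mktuple.
rewrite -(@fintype.card_image _ _ (fun s => (r * s)%g) (@mulgI _ r)).
apply/subset_leq_card/fintype.subsetP => s' /mapP[s].
rewrite mem_enum !inE => /eqP sw ->; apply/eqP/ffunP => p.
have := ur' (iota p); rewrite iK => ->; rewrite -sw !ffunE permM.
by rewrite iK'.
Qed.

Definition graph_pairings (G : reg_graph d n) : {set {perm 'I_N}} :=
  [set s | darts (pword s) == redges G].

(** All d-regular graphs have equally many words, and all their words have equally many pairings: a
    uniform pairing conditioned on being simple is a uniform d-regular graph. The inequality, being
    claimed for all pairs, amounts to equality. *)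
Lemma card_graph_pairings_le G1 G2 : #|graph_pairings G1| <= #|graph_pairings G2|.
Proof.
have E G : #|graph_pairings G| =
    #|[pred w : word n m | darts w == redges G]| *
    #|[pred s | pword s == pword 1%g]|.
  rewrite -sum1_card (partition_big pword (fun w => darts w == redges G)) /=; last first.
    by move=> s; rewrite inE.
  rewrite -sum_nat_const; apply: eq_bigr => w /eqP wG.
  have b1 := pword_balanced cellE iota_bij 1%g; have bw := graph_word_balanced wG.
  transitivity #|[pred s | pword s == w]|.
    rewrite -sum1_card; apply: eq_bigl => s; rewrite !inE.
    by case: (pword s =P w) => [->|_]; rewrite ?andbF // wG eqxx.
  by apply/eqP; rewrite eqn_leq !card_word_pairings_le.
by rewrite !E leq_mul2r (card_graph_words_le nd_even) orbT.
Qed.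

End fibres.

Local Open Scope ring_scope.

(** * Closeness of dense sets of regular graphs *)

Section close.
Variable R : realType.

(** The term of degree [k.+1] of the exponential series already dominates. *)
Lemma exp_beats_power (c eps : R) (k : nat) : 0 < c -> 0 < eps ->
  exists n0, forall n, (n0 <= n)%N -> n%:R ^+ k * expR (- (c * n%:R)) < eps.
Proof.
move=> c0 e0; pose K : R := (k.+1)`!%:R / c ^+ k.+1.
have K0 : 0 < K by rewrite divr_gt0 ?exprn_gt0// ltr0n fact_gt0.
exists (Num.bound (K / eps)).+1 => n nn.
have n0 : 0 < n%:R :> R by rewrite ltr0n (leq_trans _ nn).
have Kn : K / eps < n%:R.
  apply: (lt_le_trans (archi_boundP _)); first by rewrite ltW// divr_gt0.
  by rewrite ler_nat (leq_trans _ nn).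
have h : (c * n%:R) ^+ k.+1 / (k.+1)`!%:R <= expR (c * n%:R).
  apply: le_trans (expR_ge1Dxn k _); last by rewrite mulr_ge0 ?ltW.
  by rewrite lerDr.
rewrite expRN ltr_pdivrMr ?expR_gt0//.
apply: (@lt_le_trans _ _ (eps * ((c * n%:R) ^+ k.+1 / (k.+1)`!%:R))); last by rewrite ler_pM2l.
rewrite ltr_pdivrMr// in Kn.
rewrite exprMn (exprS n%:R) -[ltLHS]mul1r.
have -> : eps * (c ^+ k.+1 * (n%:R * n%:R ^+ k) / (k.+1)`!%:R) =
   (n%:R * eps) / K * n%:R ^+ k.
  rewrite /K; field.
  by rewrite !gt_eqF ?exprn_gt0// ltr0n fact_gt0.
by rewrite ltr_pM2r ?exprn_gt0// ltr_pdivlMr// mul1r.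
Qed.

(** A position where the permutations differ affects two darts, its own and that of its mate. *)
Lemma perm_ham_darts (n m N : nat) (cell : 'I_N -> 'I_n)
    (iota : 'I_m * bool -> 'I_N) (s t : {perm 'I_N}) : injective iota ->
  (#|darts (pword cell iota s) :\: darts (pword cell iota t)| <= 2 * perm_ham s t)%N.
Proof.
move=> iinj.
pose D := [pred p | s (iota p) != t (iota p)].
pose D' := [pred p | s (iota (mate p)) != t (iota (mate p))].
have cD : (#|D| <= perm_ham s t)%N.
  rewrite -(@fintype.card_image _ _ iota iinj).
  by apply/subset_leq_card/fintype.subsetP => i /mapP[p]; rewrite mem_enum => h ->.
have cD' : (#|D'| <= perm_ham s t)%N.
  have inj' : injective (fun p => iota (mate p)).
    by move=> p q /iinj /(can_inj (@mateK _)).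
  rewrite -(@fintype.card_image _ _ _ inj').
  by apply/subset_leq_card/fintype.subsetP => i /mapP[p]; rewrite mem_enum => h ->.
apply: (@leq_trans #|predU D D'|); last first.
  by rewrite mul2n -addnn (leq_trans _ (leq_add cD cD'))// -cardUI leq_addr.
apply: (leq_trans _ (leq_imset_card (dart (pword cell iota s)) (predU D D'))).
apply/subset_leq_card/fintype.subsetP => x; rewrite inE => /andP[xt /imsetP[p _ xp]].
apply/imsetP; exists p => //; apply: contraNT xt; rewrite inE negb_or.
rewrite !inE !negbK => /andP[/eqP h1 /eqP h2].
by apply/imsetP; exists p => //; rewrite xp /dart !ffunE h1 h2.
Qed.

Definition edge_close (n : nat) (eta : R) (E1 E2 : {set 'I_n * 'I_n}) : Prop :=
  #|E1 :\: E2|%:R <= eta * n%:R /\ #|E2 :\: E1|%:R <= eta * n%:R.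

Lemma regular_even (d n : nat) (G : reg_graph d n) : (n * d)%N = (((n * d)./2).*2)%N.
Proof. by have := card_oedges G; rewrite card_redges => ->; rewrite doubleK. Qed.

(* Two sets of d-regular graphs of positive density are close: lift them to
   pairings, where simple pairings have polynomial density and exponential
   isoperimetry holds. *)
Lemma dense_sets_close (d : nat) (delta eta : R) : (0 < d)%N -> 0 < delta -> 0 < eta ->
  exists n0, forall n, (n0 <= n)%N -> forall A B : {set reg_graph d n},
    (0 < #|{: reg_graph d n}|)%N ->
    delta * #|{: reg_graph d n}|%:R <= #|A|%:R ->
    delta * #|{: reg_graph d n}|%:R <= #|B|%:R ->
    exists G1 G2, [/\ G1 \in A, G2 \in B & edge_close eta (redges G1) (redges G2)].
Proof.
move=> d0 del0 eta0.
pose C := (2 * (d + d * d))%N.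
(* Pairings at Hamming distance [h] have dart sets that differ by at most [2 * h] each way, and
   [h < et * (n * d)] must yield at most [eta * n]; isoperimetry also asks for [et <= 1]. *)
pose et := Num.min 1 (eta / (2 * d%:R)).
have et0 : 0 < et by rewrite /et lt_min ltr01 divr_gt0// mulr_gt0// ltr0n.
have et1 : et <= 1 by rewrite /et ge_min lexx.
(* Each of the two sets loses a factor [2 * N ^ (2 * C)] against all pairings; multiplied, the two
   losses give the exponent [4 * C] and the constant [delta ^+ 2 / 4]. *)
have [n1 Hn1] := @exp_beats_power (et ^+ 2 / 64) (delta ^+ 2 / 4) (4 * C)
  (divr_gt0 (exprn_gt0 2 et0) (ltr0n _ 64)) (divr_gt0 (exprn_gt0 2 del0) (ltr0n _ 4)).
exists (maxn n1 (2 * (2 * (d * d.+1) + C + 4)))%N => n nn A B reg0 dA dB.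
have [G0 _] : exists G, G \in {: reg_graph d n} by apply/card_gt0P.
pose N := (n * d)%N; pose m := N./2.
have Nm : N = m.*2 :> nat by rewrite /m /N -(regular_even G0).
have nN : (n <= N)%N by rewrite leq_pmulr.
have mbig : (2 * (d * d.+1) + C + 4 <= m)%N by lia.
pose k := #|{: 'I_n * 'I_d}|.
have kN : k = N by rewrite /k card_prod !card_ord.
pose cell : 'I_k -> 'I_n := fun q => (enum_val q).1.
have cellE v : #|[pred q | cell q == v]| = d.
  rewrite -[RHS]card_ord -[LHS]sum1_card -[RHS]sum1_card.
  rewrite (reindex (fun x : 'I_n * 'I_d => enum_rank x)) /=; last first.
    by apply: onW_bij; exact: enum_rank_bij.
  rewrite (reindex_onto (fun a : 'I_d => (v, a)) snd) /=.
    by apply: eq_bigl => a; rewrite !inE /cell enum_rankK /= !eqxx.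
  by move=> [a b]; rewrite !inE /cell enum_rankK /= => /eqP ->.
have kpos : #|{: 'I_m * bool}| = k.
  by rewrite kN card_prod card_bool card_ord muln2.
pose iota (x : 'I_m * bool) : 'I_k := cast_ord kpos (enum_rank x).
have iota_bij : bijective iota.
  exists (fun i => enum_val (cast_ord (esym kpos) i)) => i.
    by rewrite /iota cast_ordK enum_rankK.
  by rewrite /iota enum_valK cast_ordKV.
pose fib := @graph_pairings n d m k cell iota.
pose phi := #|fib G0|.
have fibE G : #|fib G| = phi.
  by apply/eqP; rewrite eqn_leq !(card_graph_pairings_le cellE iota_bij).
(* The pairings whose graph lies in [X]. All fibers have size [phi], so the density among simple
   pairings is the density among graphs. *)
pose L (X : {set reg_graph d n}) := [set s | [exists G in X, s \in fib G]].
have cL X : #|L X| = (#|X| * phi)%N.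
  rewrite -sum_nat_const -[LHS]sum1_card.
  rewrite (eq_bigr (fun G => \sum_s (s \in fib G : nat))%N); last first.
    by move=> G _; rewrite -(fibE G) -sum1_card big_mkcond; apply: eq_bigr => s _; case: ifP.
  rewrite exchange_big /= big_mkcond; apply: eq_bigr => s _; rewrite inE.
  case: ifP => [/existsP[G /andP[GX sG]]|/negbT nex].
    rewrite (bigD1 G) //= sG big1 // => G' /andP[G'X G'G]; apply/eqP; rewrite eqb0.
    apply: contra G'G; rewrite !inE in sG *; move: sG => /eqP -> /eqP e.
    by apply/eqP/val_inj/val_inj.
  rewrite big1 // => G GX; apply/eqP; rewrite eqb0.
  by apply: contra nex => sG; apply/existsP; exists G; rewrite GX.
have n0 : (0 < n)%N by lia.
have simp : (#|[pred s | nbad (pword cell iota s) == 0]| <= #|{: reg_graph d n}| * phi)%N.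
  rewrite -cardsT -cL; apply/subset_leq_card/fintype.subsetP => s; rewrite inE => /eqP nb.
  have bal := pword_balanced cellE iota_bij s.
  pose H : sgraph n := exist (fun E => is_true (is_sgraph E)) _ (darts_sgraph n0 nb).
  have reg : regular d H.
    by apply/forallP => v; apply/eqP; exact: (darts_degree v (dart_inj nb) bal).
  rewrite inE; apply/existsP; exists (exist (fun G => is_true (regular d G)) H reg).
  by rewrite inE /= inE.
have simple := @card_simple_pairings n d m k cell iota cellE iota_bij.
have {}simple : (k`! <= 2 * (k ^ (2 * C) * (#|{: reg_graph d n}| * phi)))%N.
  apply: (leq_trans (simple _ _)); [lia|by rewrite -/C; lia|].
  by rewrite !leq_mul.
set r := #|{: reg_graph d n}| in reg0 dA dB simple.
have kf0 : 0 < k`!%:R :> R by rewrite ltr0n fact_gt0.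
apply: contrapT => nclose.
have far a b : a \in L A -> b \in L B -> et * k%:R <= (perm_ham b a)%:R.
  rewrite !inE => /existsP[G1 /andP[G1A]]; rewrite inE => /eqP aG.
  move=> /existsP[G2 /andP[G2B]]; rewrite inE => /eqP bG.
  rewrite leNgt; apply/negP => lt; apply: nclose; exists G1, G2; split => //.
  have bound (j : nat) : (j <= 2 * perm_ham b a)%N -> j%:R <= eta * n%:R.
    move=> hj; apply: (@le_trans _ _ (2 * (perm_ham b a)%:R)); first by rewrite -natrM ler_nat.
    have etd : et <= eta / (2 * d%:R) by rewrite /et ge_min lexx orbT.
    have dR : 0 < d%:R :> R by rewrite ltr0n.
    apply: (@le_trans _ _ (2 * (eta / (2 * d%:R) * k%:R))).
      by rewrite ler_pM2l// (le_trans (ltW lt))// ler_wpM2r.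
    rewrite kN natrM le_eqVlt; apply/orP; left; apply/eqP; field.
    by rewrite gt_eqF.
  have hs : perm_ham b a = perm_ham a b by apply: eq_card => i; rewrite !inE eq_sym.
  split; apply: bound; rewrite -aG -bG.
    by rewrite hs; apply: perm_ham_darts; exact: bij_inj.
  by apply: perm_ham_darts; exact: bij_inj.
have := perm_isoperimetry et0 et1 far; rewrite !cL.
have [nA nB] : (delta * (r * phi)%:R <= (#|A| * phi)%:R /\ delta * (r * phi)%:R <= (#|B| * phi)%:R).
  by rewrite !natrM !mulrA !ler_wpM2r.
have k0 : 0 < k%:R :> R by rewrite ltr0n kN muln_gt0 n0.
have P0 : 0 < k%:R ^+ (2 * C) :> R by rewrite exprn_gt0.
have low : k`!%:R / (2 * k%:R ^+ (2 * C)) <= (r * phi)%:R :> R.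
  by rewrite ler_pdivrMr ?mulr_gt0// -natrX -!natrM ler_nat mulnC -mulnA.
have dlow : delta * (k`!%:R / (2 * k%:R ^+ (2 * C))) <= delta * (r * phi)%:R by rewrite ler_pM2l.
have dpos : 0 <= delta * (k`!%:R / (2 * k%:R ^+ (2 * C))).
  by rewrite mulr_ge0 ?(ltW del0)// divr_ge0// ?(ltW kf0)// mulr_ge0// ltW.
move=> up.
have {up} := le_trans (ler_pM dpos dpos (le_trans dlow nA) (le_trans dlow nB)) up.
have := Hn1 k; rewrite kN => /(_ (leq_trans _ nN)).
move=> /(_ (leq_trans (leq_maxl _ _) nn)).
have eP : k%:R ^+ (4 * C) = (k%:R ^+ (2 * C)) ^+ 2 :> R.
  by rewrite -exprM; congr (_ ^+ _); rewrite mulnAC.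
rewrite -kN (mulrAC (et ^+ 2)) eP; move: dlow dpos P0 {low} => _ _.
set P := k%:R ^+ (2 * C); set F := k`!%:R in kf0 *; set e := expR _ => P0 lt.
rewrite leNgt => /negP; apply.
have -> : delta * (F / (2 * P)) * (delta * (F / (2 * P))) = F ^+ 2 * (delta ^+ 2 / 4 / P ^+ 2).
  by field; rewrite gt_eqF.
by rewrite ltr_pM2l ?exprn_gt0// ltr_pdivlMr ?exprn_gt0// mulrC.
Qed.

End close.

Local Open Scope classical_set_scope.
Local Open Scope ring_scope.

(** * The colored neighborhood distance *)

Section laws.
Variables (R : realType) (T : Type).
Implicit Types mu : set T -> R.

(** Finite additivity on all subsets suffices for laws on the finite sets [U d r k], and it passes
    to preimages under arbitrary maps. *)
Definition is_law mu : Prop :=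
  [/\ forall A, 0 <= mu A, mu setT = 1
    & forall A B, A `&` B = set0 -> mu (A `|` B) = mu A + mu B].

Lemma law_ge0 mu A : is_law mu -> 0 <= mu A.
Proof. by case. Qed.

Lemma law_setC mu A : is_law mu -> mu (~` A) = 1 - mu A.
Proof.
move=> [_ mu1 muD]; rewrite -mu1 -(setUv A) muD ?setICr//; lra.
Qed.

Lemma law_le1 mu A : is_law mu -> mu A <= 1.
Proof.
by move=> lmu; have := law_ge0 (~` A) lmu; rewrite law_setC// subr_ge0.
Qed.

Lemma law_dist_le1 mu mu' A : is_law mu -> is_law mu' -> `|mu A - mu' A| <= 1.
Proof.
move=> l l'; have := law_ge0 A l; have := law_ge0 A l'.
have := law_le1 A l; have := law_le1 A l' => *.
by rewrite ler_norml; apply/andP; split; lra.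
Qed.

Lemma dTV_le mu mu' e : (forall A, `|mu A - mu' A| <= e) -> dTV mu mu' <= e.
Proof.
move=> h; apply: ge_sup; first by exists `|mu set0 - mu' set0|, set0.
by move=> _ [A _ <-].
Qed.

Lemma dTV_ub mu mu' A : is_law mu -> is_law mu' -> `|mu A - mu' A| <= dTV mu mu'.
Proof.
move=> l l'; apply: ub_le_sup; last by exists A.
by exists 1 => _ [B _ <-]; exact: law_dist_le1.
Qed.

Lemma dTV_le1 mu mu' : is_law mu -> is_law mu' -> dTV mu mu' <= 1.
Proof. by move=> l l'; apply: dTV_le => A; exact: law_dist_le1. Qed.

Lemma dTV_sym mu mu' : dTV mu mu' = dTV mu' mu.
Proof. by rewrite /dTV; congr (sup (_ @` _)); apply/funext => A; rewrite distrC. Qed.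

Lemma dTV_triangle mu2 mu1 mu3 : is_law mu1 -> is_law mu2 -> is_law mu3 ->
  dTV mu1 mu3 <= dTV mu1 mu2 + dTV mu2 mu3.
Proof.
move=> l1 l2 l3; apply: dTV_le => A.
by apply: (le_trans (ler_distD (mu2 A) _ _)); rewrite lerD// dTV_ub.
Qed.

Definition law_family (Q : set (set T -> R)) : Prop := Q !=set0 /\ Q `<=` is_law.

Local Notation hd := (hausdorff_dist (@dTV R T)).

Lemma hausdorff_le Q Q' e : law_family Q -> law_family Q' ->
  (forall mu, Q mu -> exists2 mu', Q' mu' & dTV mu mu' <= e) ->
  (forall mu', Q' mu' -> exists2 mu, Q mu & dTV mu mu' <= e) -> hd Q Q' <= e.
Proof.
move=> [[a Qa] _] [[b Qb] _] h h'; rewrite /hausdorff_dist ge_max; apply/andP; split.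
- apply: ge_sup; first by eexists; exists a.
  move=> _ [mu Qmu <-]; have [mu' Qmu' le] := h _ Qmu.
  apply: le_trans le; apply: ge_inf; last by exists mu'.
  by exists 0 => _ [nu _ <-]; exact: dTV_ge0.
- apply: ge_sup; first by eexists; exists b.
  move=> _ [mu' Qmu' <-]; have [mu Qmu le] := h' _ Qmu'.
  apply: le_trans le; apply: ge_inf; last by exists mu.
  by exists 0 => _ [nu _ <-]; exact: dTV_ge0.
Qed.

Lemma hausdorff_sym Q Q' : hd Q Q' = hd Q' Q.
Proof.
rewrite /hausdorff_dist maxC; congr Num.max; congr (sup (_ @` _));
  by apply/funext => mu; congr (inf (_ @` _)); apply/funext => nu; rewrite dTV_sym.
Qed.

(** Infima need not be attained, so partners are extracted from strict inequalities. Distances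
    between laws are at most 1, which makes the supremum a true upper bound. *)
Lemma hausdorff_ex Q Q' e mu : law_family Q -> law_family Q' -> Q mu ->
  hd Q Q' < e -> exists2 mu', Q' mu' & dTV mu mu' < e.
Proof.
move=> [_ lQ] [[b Qb] lQ'] Qmu lt.
have /inf_lt : inf [set dTV mu nu | nu in Q'] < e.
  apply: le_lt_trans lt; rewrite /hausdorff_dist le_max; apply/orP; left.
  apply: ub_le_sup; last by exists mu.
  exists 1 => _ [nu Qnu <-]; apply: (@le_trans _ _ (dTV nu b)).
    by apply: ge_inf; [exists 0 => _ [? _ <-]; exact: dTV_ge0|exists b].
  by apply: dTV_le1; [exact: lQ|exact: lQ'].
by case=> [|_ [nu Qnu <-] h]; [exists (dTV mu b), b|exists nu].
Qed.

Lemma hausdorff_ge0 Q Q' : law_family Q -> law_family Q' -> 0 <= hd Q Q'.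
Proof.
move=> lQ lQ'; rewrite leNgt; apply/negP => lt; have [mu Qmu] := lQ.1.
have [nu _] := hausdorff_ex lQ lQ' Qmu lt.
by rewrite ltNge dTV_ge0.
Qed.

Lemma hausdorff_le1 Q Q' : law_family Q -> law_family Q' -> hd Q Q' <= 1.
Proof.
move=> lQ lQ'; have [a Qa] := lQ.1; have [b Qb] := lQ'.1.
apply: hausdorff_le => // [mu Qmu|mu Qmu].
  by exists b => //; apply: dTV_le1; [exact: lQ.2|exact: lQ'.2].
by exists a => //; apply: dTV_le1; [exact: lQ.2|exact: lQ'.2].
Qed.

Lemma hausdorff_triangle Q2 Q1 Q3 : law_family Q1 -> law_family Q2 -> law_family Q3 ->
  hd Q1 Q3 <= hd Q1 Q2 + hd Q2 Q3.
Proof.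
move=> l1 l2 l3; apply/ler_addgt0Pr => e e0.
have e2 : 0 < e / 2 by rewrite divr_gt0.
have lt12 : hd Q1 Q2 < hd Q1 Q2 + e / 2 by rewrite ltrDl.
have lt23 : hd Q2 Q3 < hd Q2 Q3 + e / 2 by rewrite ltrDl.
have step (Qa Qb Qc : set (set T -> R)) (a b : R) mu :
    law_family Qa -> law_family Qb -> law_family Qc -> Qa mu ->
    hd Qa Qb < a -> hd Qb Qc < b -> exists2 rho, Qc rho & dTV mu rho <= a + b.
  move=> la lb lc Qmu ab bc; have [nu Qnu h] := hausdorff_ex la lb Qmu ab.
  have [rho Qrho h'] := hausdorff_ex lb lc Qnu bc.
  exists rho => //; apply: (le_trans (dTV_triangle (mu2 := nu) _ _ _)).
  - exact: la.2.
  - exact: lb.2.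
  - exact: lc.2.
  exact: lerD (ltW h) (ltW h').
have E : hd Q1 Q2 + hd Q2 Q3 + e = (hd Q1 Q2 + e / 2) + (hd Q2 Q3 + e / 2).
  by rewrite addrACA -splitr.
rewrite E; apply: hausdorff_le => // mu Qmu.
  exact: step l1 l2 l3 Qmu lt12 lt23.
have lt21 : hd Q2 Q1 < hd Q1 Q2 + e / 2 by rewrite (hausdorff_sym Q2).
have lt32 : hd Q3 Q2 < hd Q2 Q3 + e / 2 by rewrite (hausdorff_sym Q3).
have [rho Qrho h] := step _ _ _ _ _ _ l3 l2 l1 Qmu lt32 lt21; rewrite addrC in h.
by exists rho => //; rewrite dTV_sym.
Qed.

End laws.

(** * Weighted double series *)

Section weighted_sums.
Variable R : realType.
Implicit Types f g : nat -> nat -> R.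

(** Kept in the extended reals, where nonnegative series can be added and compared freely; [dCN] is
    [fine] of such a sum. *)
Definition wsum f : \bar R :=
  (\sum_(1 <= k <oo) \sum_(1 <= r <oo) (2 ^- (k + r) * f r k)%:E)%E.

Let w0 (k r : nat) : 0 <= 2 ^- (k + r) :> R.
Proof. by rewrite invr_ge0 exprn_ge0. Qed.

Lemma wsum_le f g :
  (forall r k, (0 < r)%N -> (0 < k)%N -> 0 <= f r k /\ f r k <= g r k) ->
  (wsum f <= wsum g)%E.
Proof.
move=> h; rewrite /wsum.
rewrite [leLHS]eseries_cond [leRHS]eseries_cond; apply: lee_nneseries.
  move=> k _ /= k0; apply: nneseries_ge0 => r r0 _.
  by rewrite lee_fin mulr_ge0//; have [] := h _ _ r0 k0.
move=> k /= k0; rewrite [leLHS]eseries_cond [leRHS]eseries_cond; apply: lee_nneseries.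
  by move=> r _ /= r0; rewrite lee_fin mulr_ge0//; have [] := h _ _ r0 k0.
move=> r /= r0; rewrite lee_fin ler_wpM2l//; by have [] := h _ _ r0 k0.
Qed.

Lemma wsum_ge0 f : (forall r k, (0 < r)%N -> (0 < k)%N -> 0 <= f r k) -> (0 <= wsum f)%E.
Proof.
move=> f0; apply: nneseries_ge0 => k k0 _; apply: nneseries_ge0 => r r0 _.
by rewrite lee_fin mulr_ge0// f0.
Qed.

Lemma wsumD f g :
  (forall r k, (0 < r)%N -> (0 < k)%N -> 0 <= f r k) ->
  (forall r k, (0 < r)%N -> (0 < k)%N -> 0 <= g r k) ->
  wsum (fun r k => f r k + g r k) = (wsum f + wsum g)%E.
Proof.
move=> f0 g0; rewrite /wsum -nneseriesD; first last.
- by move=> k k0 _; apply: nneseries_ge0 => r r0 _; rewrite lee_fin mulr_ge0// g0.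
- by move=> k k0 _; apply: nneseries_ge0 => r r0 _; rewrite lee_fin mulr_ge0// f0.
rewrite eseries_cond [RHS]eseries_cond; apply: eq_eseriesr => k /= k0.
rewrite -nneseriesD; first last.
- by move=> r r0 _; rewrite lee_fin mulr_ge0// g0.
- by move=> r r0 _; rewrite lee_fin mulr_ge0// f0.
by apply: eq_eseriesr => r _; rewrite mulrDr EFinD.
Qed.

Lemma nneseries_half (K : nat) : (\sum_(K.+1 <= k <oo) (2 ^- k)%:E = (2 ^- K)%:E :> \bar R)%E.
Proof.
rewrite -nneseries_addn; last by move=> i; rewrite lee_fin invr_ge0 exprn_ge0.
have := @cvg_geometric_eseries_half R 1 K; rewrite mul1r => /cvg_lim <- //.
by apply: eq_eseriesr => k _; rewrite mul1r natrX.
Qed.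

Lemma nneseries_half_mul1 : (\sum_(1 <= k <oo) (2 ^- k * 1)%:E = 1 :> \bar R)%E.
Proof.
have := nneseries_half 0; rewrite expr0 invr1 => <-.
by apply: eq_eseriesr => k _; rewrite mulr1.
Qed.

Lemma wsum_const (a b : nat -> R) : (forall k, 0 <= a k) -> (forall r, 0 <= b r) ->
  (\sum_(1 <= r <oo) (2 ^- r * b r)%:E)%E \is a fin_num ->
  wsum (fun r k => a k * b r) =
  ((\sum_(1 <= k <oo) (2 ^- k * a k)%:E) * (\sum_(1 <= r <oo) (2 ^- r * b r)%:E))%E.
Proof.
move=> a0 b0 bf; rewrite /wsum muleC -(fineK bf) -nneseriesZl; last first.
  by move=> k _; rewrite lee_fin mulr_ge0// invr_ge0 exprn_ge0.
apply: eq_eseriesr => k _; rewrite (fineK bf) muleC -nneseriesZl; last first.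
  by move=> r _; rewrite lee_fin mulr_ge0// invr_ge0 exprn_ge0.
apply: eq_eseriesr => r _; rewrite -EFinM exprD invfM; congr (_%:E); ring.
Qed.

Lemma wsum1 (c : R) : 0 <= c -> wsum (fun _ _ => c) = c%:E.
Proof.
move=> c0.
have := @wsum_const (fun=> c) (fun=> 1) (fun=> c0) (fun=> ler01).
rewrite nneseries_half_mul1 => /(_ isT); rewrite mule1 mulr1 => ->.
transitivity (c%:E * \sum_(1 <= k <oo) (2 ^- k * 1)%:E)%E; last by rewrite nneseries_half_mul1 mule1.
rewrite -nneseriesZl; last by move=> k _; rewrite lee_fin mulr1 invr_ge0 exprn_ge0.
by apply: eq_eseriesr => k _; rewrite -EFinM mulr1 mulrC.
Qed.

Lemma half_tail (K : nat) :
  (\sum_(1 <= k <oo) (2 ^- k * (K < k)%:R)%:E = (2 ^- K)%:E :> \bar R)%E.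
Proof.
rewrite -nneseries_half eseries_cond [RHS]eseries_cond.
rewrite eseries_mkcond [RHS]eseries_mkcond; apply: eq_eseriesr => k _ /=.
by case: k => [//|k] /=; rewrite !ltnS; case: (K <= k)%N; rewrite ?mulr1 ?mulr0.
Qed.

(** The summand is at least 1 outside the square [r, k <= K], so it dominates the tail of every
    distance series. *)
Lemma wsum_tails (K : nat) :
  wsum (fun r k => (K < k)%:R + (K < r)%:R) = (2 ^- K + 2 ^- K)%:E.
Proof.
rewrite wsumD; [|by move=> *; exact: ler0n|by move=> *; exact: ler0n].
have := @wsum_const (fun k => (K < k)%:R) (fun=> 1) (fun=> ler0n _ _) (fun=> ler01).
rewrite nneseries_half_mul1 half_tail mule1 => /(_ isT) h1.
have := @wsum_const (fun=> 1) (fun k => (K < k)%:R) (fun=> ler01) (fun=> ler0n _ _).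
rewrite nneseries_half_mul1 half_tail mul1e => /(_ isT) h2.
rewrite EFinD -{1}h1 -h2; congr (wsum _ + wsum _)%E; apply/funext => r; apply/funext => k;
  by rewrite ?mulr1 ?mul1r.
Qed.

End weighted_sums.

Section dCN.
Variables (R : realType) (d : nat).
Implicit Types Q : qfamily R d.

(** For [k = 0] a nonempty graph has no coloring and the family is empty, hence the restriction to
    [0 < k]. *)
Definition proper_qfamily Q : Prop := forall r k, (0 < k)%N -> law_family (Q r k).

Local Notation hq Q Q' := (fun r k => hausdorff_dist (@dTV R _) (Q r k) (Q' r k)).

Lemma hausdorff_itv Q Q' r k : proper_qfamily Q -> proper_qfamily Q' -> (0 < k)%N ->
  0 <= hq Q Q' r k <= 1.
Proof.
move=> pQ pQ' k0; have lQ := pQ r k k0; have lQ' := pQ' r k k0.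
by apply/andP; split; [exact: hausdorff_ge0 lQ lQ'|exact: hausdorff_le1 lQ lQ'].
Qed.

Lemma dCN_wsum Q Q' : proper_qfamily Q -> proper_qfamily Q' ->
  (dCN Q Q')%:E = wsum (hq Q Q').
Proof.
move=> pQ pQ'; rewrite /dCN -/(wsum (hq Q Q')) fineK// ge0_fin_numE; last first.
  by apply: wsum_ge0 => r k _ k0; have /andP[] := hausdorff_itv r pQ pQ' k0.
apply: (@le_lt_trans _ _ (wsum (fun _ _ => 1))); last by rewrite wsum1// ltry.
by apply: wsum_le => r k _ k0; have /andP[] := hausdorff_itv r pQ pQ' k0.
Qed.

Lemma dCN_ge0 Q Q' : proper_qfamily Q -> proper_qfamily Q' -> 0 <= dCN Q Q'.
Proof.
move=> pQ pQ'; rewrite -lee_fin dCN_wsum//.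
by apply: wsum_ge0 => r k _ k0; have /andP[] := hausdorff_itv r pQ pQ' k0.
Qed.

Lemma dCN_sym Q Q' : dCN Q Q' = dCN Q' Q.
Proof.
change (fine (wsum (hq Q Q')) = fine (wsum (hq Q' Q))); congr (fine (wsum _)).
by apply/funext => r; apply/funext => k; exact: hausdorff_sym.
Qed.

Lemma dCN_triangle Q2 Q1 Q3 : proper_qfamily Q1 -> proper_qfamily Q2 ->
  proper_qfamily Q3 -> dCN Q1 Q3 <= dCN Q1 Q2 + dCN Q2 Q3.
Proof.
move=> p1 p2 p3.
have fin_le (x y z : R) (X Y Z : \bar R) :
    x%:E = X -> y%:E = Y -> z%:E = Z -> (X <= Y + Z)%E -> x <= y + z.
  by move=> <- <- <-; rewrite -EFinD lee_fin.
apply: fin_le (dCN_wsum p1 p3) (dCN_wsum p1 p2) (dCN_wsum p2 p3) _.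
rewrite -wsumD; first last.
- by move=> r k _ k0; have /andP[] := hausdorff_itv r p2 p3 k0.
- by move=> r k _ k0; have /andP[] := hausdorff_itv r p1 p2 k0.
apply: wsum_le => r k _ k0; split.
  by have /andP[] := hausdorff_itv r p1 p3 k0.
by apply: hausdorff_triangle; [exact: p1|exact: p2|exact: p3].
Qed.

(** Finitely many pairs [(r, k)] control the distance: the tails weigh less than [e / 2], the rest
    at most [e / 4]. *)
Lemma dCN_small (e : R) : 0 < e -> exists K : nat, exists2 e', 0 < e' &
  forall Q Q', proper_qfamily Q -> proper_qfamily Q' ->
    (forall r k, (0 < r)%N -> (0 < k)%N -> (r <= K)%N -> (k <= K)%N ->
       hausdorff_dist (@dTV R _) (Q r k) (Q' r k) <= e') -> dCN Q Q' < e.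
Proof.
move=> e0.
have [K hK] : exists K : nat, 2 ^- K + 2 ^- K < e / 2.
  exists (Num.bound (4 / e)); set K := Num.bound _.
  have : 4 / e < K%:R by apply: archi_boundP; rewrite divr_ge0// ltW.
  have K2 : K%:R <= 2 ^+ K :> R by rewrite -natrX ler_nat ltnW// ltn_expl.
  have p0 : 0 < 2 ^+ K :> R by rewrite exprn_gt0.
  rewrite ltr_pdivrMr// => h.
  have h2 : 4 < 2 ^+ K * e by apply: (lt_le_trans h); rewrite ler_pM2r.
  have -> : 2 ^- K + 2 ^- K = 2 / 2 ^+ K :> R by field; rewrite gt_eqF.
  by rewrite ltr_pdivrMr//; lra.
exists K, (e / 4); first by rewrite divr_gt0.
move=> Q Q' pQ pQ' h; rewrite -lte_fin dCN_wsum//.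
apply: (@le_lt_trans _ _ (wsum (fun r k => e / 4 + ((K < k)%:R + (K < r)%:R)))).
  apply: wsum_le => r k r0 k0.
  have /andP[h0 h1] := hausdorff_itv r pQ pQ' k0.
  split=> //; have [rK|Kr] := leqP r K; have [kK|Kk] := leqP k K => /=.
  - by have := h r k r0 k0 rK kK; lra.
  - lra.
  - lra.
  - lra.
rewrite wsumD; first last.
- by move=> r k _ _; rewrite addr_ge0.
- by move=> r k _ _; rewrite divr_ge0// ltW.
rewrite wsum1 ?wsum_tails; last by rewrite divr_ge0// ltW.
by rewrite -EFinD lte_fin; lra.
Qed.

End dCN.

Local Open Scope quotient_scope.

(** * Rooted balls *)

Section gball.
Variables (V : Type) (e : V -> V -> Prop).

Lemma gball_le (r s : nat) (v : V) : (r <= s)%N -> gball e r v `<=` gball e s v.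
Proof.
move=> /subnK <-; elim: (s - r)%N => [//|m IH] x /IH h; by left.
Qed.

Lemma gball_root (r : nat) (v : V) : gball e r v v.
Proof. by apply: (@gball_le 0 r). Qed.

End gball.

Section rc_iso.
Variable k : nat.

Lemma rc_iso_transport (H : pre_rcgraph k) (V V' : Type)
    (e : V -> V -> Prop) (e' : V' -> V' -> Prop) (B : set V) (B' : set V')
    (v : V) (v' : V') (f : V -> 'I_k) (f' : V' -> 'I_k) (phi : V -> V') :
  set_bij B B' phi -> phi v = v' ->
  (forall x y, B x -> B y -> e x y <-> e' (phi x) (phi y)) ->
  (forall x, B x -> f' (phi x) = f x) ->
  rc_iso H e B v f -> rc_iso H e' B' v' f'.
Proof.
move=> bphi pv pe pf [psi [bpsi pr psie psif]].
have Bpsi i : B (psi i) by have [h _ _] := bpsi; exact: h.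
exists (phi \o psi); split.
- exact: set_bij_comp bphi.
- by rewrite /= pr.
- by move=> i j; rewrite psie pe.
- by move=> i /=; rewrite pf// psif.
Qed.

Variables (d r : nat).

Lemma rc_iso_uniq (H H' : rcgraph d r k) (V : Type) (e : V -> V -> Prop) (B : set V)
    (v : V) (f : V -> 'I_k) :
  rc_iso (val H) e B v f -> rc_iso (val H') e B v f -> rcgraph_iso H H'.
Proof.
move=> [phi [bphi pr pe pf]] [psi [bpsi qr qe qf]]; apply/asboolP.
have [fphi iphi sphi] := bphi; have [fpsi ipsi spsi] := bpsi.
have /choice[g gE] i : exists j, psi j = phi i.
  by have [j _ <-] := spsi _ (fphi i I); exists j.
exists g; split.
- split=> //.
  + move=> i j _ _ gij; apply: iphi; rewrite ?in_setT//.
    by rewrite -!gE gij.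
  + move=> j _; have [i _ ij] := sphi _ (fpsi j I); exists i => //.
    by apply: ipsi; rewrite ?in_setT// gE.
- by apply: ipsi; rewrite ?in_setT// gE pr qr.
- by move=> i j; rewrite pe -!gE -qe.
- by move=> i; rewrite -qf gE pf.
Qed.

Lemma ball_class_uniq (V : Type) (e : V -> V -> Prop) (f : V -> 'I_k) (v : V)
    (u u' : U d r k) : ball_class e f v u -> ball_class e f v u' -> u = u'.
Proof.
move=> [H [<- h]] [H' [<- h']]; apply/eqmodP => /=.
exact: (rc_iso_uniq h h').
Qed.

Lemma ball_class_transport (V V' : Type)
    (e : V -> V -> Prop) (e' : V' -> V' -> Prop)
    (v : V) (v' : V') (f : V -> 'I_k) (f' : V' -> 'I_k) (phi : V -> V') (u : U d r k) :
  set_bij (gball e r v) (gball e' r v') phi -> phi v = v' ->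
  (forall x y, gball e r v x -> gball e r v y -> e x y <-> e' (phi x) (phi y)) ->
  (forall x, gball e r v x -> f' (phi x) = f x) ->
  ball_class e f v u -> ball_class e' f' v' u.
Proof.
move=> h1 h2 h3 h4 [H [Hu iso]]; exists H; split=> //.
exact: rc_iso_transport h1 h2 h3 h4 iso.
Qed.

End rc_iso.

Section finite_balls.
Variables (d n : nat) (G : sgraph n).
Hypothesis degG : max_degree_le d G.

Lemma adj_sym (x y : 'I_n) : adj G x y -> adj G y x.
Proof.
have /and3P[_ _ /forallP h] := valP G; have /forallP/(_ y)/eqP := h x.
by rewrite /adj => ->.
Qed.

Lemma adj_irrefl (x : 'I_n) : ~ adj G x x.
Proof. by have /and3P[_ /forallP h _] := valP G; apply/negP; exact: h. Qed.

Definition gballb (r : nat) (v : 'I_n) : pred 'I_n := fun x => `[< gball (adj G) r v x >].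

Lemma card_gball (r : nat) (v : 'I_n) : (#|gballb r v| <= d.+1 ^ r)%N.
Proof.
elim: r => [|r IH].
  rewrite expn0 -(card1 v); apply/subset_leq_card/fintype.subsetP => x /asboolP /= ->.
  by rewrite inE.
rewrite expnS mulSn.
pose N := [pred x | [exists y, (y \in gballb r v) && ((y, x) \in val G)]].
have sub : gballb r.+1 v \subset predU (gballb r v) N.
  apply/fintype.subsetP => x /asboolP[h|[y yB yx]]; rewrite inE; apply/orP; [left|right].
    exact/asboolP.
  by rewrite inE; apply/existsP; exists y; rewrite yx andbT; exact/asboolP.
apply: (leq_trans (subset_leq_card sub)).
apply: (@leq_trans (#|gballb r v| + #|N|)); first by rewrite -cardUI leq_addr.
apply: leq_add => //; apply: (@leq_trans (#|gballb r v| * d)); last by rewrite mulnC leq_mul2l IH orbT.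
rewrite -sum_nat_const.
apply: (@leq_trans (\sum_(y in gballb r v) \sum_x ((y, x) \in val G))); last first.
  apply: leq_sum => y _; have /forallP/(_ y) := degG; rewrite /degree => h.
  apply: leq_trans h; rewrite -sum1_card [leqRHS]big_mkcond.
  by apply: leq_sum => x _; rewrite inE; case: ifP.
rewrite exchange_big -sum1_card big_mkcond; apply: leq_sum => x _ /=.
rewrite inE; case: existsP => // -[y /andP[yB yx]].
by rewrite (bigD1 y) //= yx.
Qed.

Variables (r k : nat) (f : 'I_n -> 'I_k) (v : 'I_n).

Let B := gballb r v.

Let vB : v \in B.
Proof. by apply/asboolP; exact: gball_root. Qed.

Let EB : {set 'I_#|B| * 'I_#|B|} := [set ij | (enum_val ij.1, enum_val ij.2) \in val G]%SET.

Let EB_sgraph : is_sgraph EB.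
Proof.
apply/and3P; split.
- by apply/card_gt0P; exists v.
- by apply/forallP => i; rewrite inE; apply/negP; exact: adj_irrefl.
- by apply/forallP => i; apply/forallP => j; rewrite !inE; apply/eqP;
    apply/idP/idP; exact: adj_sym.
Qed.

Let HB : sgraph #|B| := exist (fun E => is_true (is_sgraph E)) EB EB_sgraph.

Let root : 'I_#|B| := enum_rank_in vB v.

Let PB : pre_rcgraph k := existT _ #|B| (HB, root, [ffun i => f (enum_val i)]).

Let PB_rc : is_rcgraph d r PB.
Proof.
apply/andP; split.
  apply/asboolP/seteqP; split=> // i _.
  (* The restriction to [s <= r] keeps every intermediate vertex in the ball, so the walk survives
     in the induced subgraph. *)
  suff h s : (s <= r)%N -> forall j, gball (adj G) s v (enum_val j) ->
      gball (adj HB) s root j.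
    by apply: h => //; have := enum_valP i => /asboolP.
  elim: s => [|s IH] sr j.
    by move=> /= jv; apply: enum_val_inj; rewrite jv enum_rankK_in.
  move=> [h|[y yB yj]]; first by left; apply: IH => //; exact: ltnW.
  right.
  have yB' : y \in B by apply/asboolP; apply: gball_le yB; exact: ltnW.
  exists (enum_rank_in vB y).
    by apply: IH; rewrite ?enum_rankK_in// ltnW.
  by rewrite /adj /= inE /= enum_rankK_in.
apply/forallP => i; rewrite /degree /=.
have /forallP/(_ (enum_val i)) := degG; apply: leq_trans.
rewrite /degree -(@fintype.card_image _ _ _ (@enum_val_inj _ (mem B))).
apply/subset_leq_card/fintype.subsetP => x /mapP[j].
by rewrite mem_enum !inE /= => h ->.
Qed.

Lemma ball_class_ex : exists u : U d r k, ball_class (adj G) f v u.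
Proof.
exists (\pi_(U d r k) (exist (fun H => is_true (is_rcgraph d r H)) PB PB_rc)).
eexists; split; first by [].
exists (@enum_val _ (mem B)); split.
- split.
  + by move=> i _; have := enum_valP i => /asboolP.
  + by move=> i j _ _; exact: enum_val_inj.
  + move=> x xB; exists (enum_rank_in vB x) => //.
    by rewrite enum_rankK_in//; apply/asboolP.
- by rewrite enum_rankK_in.
- by move=> i j; rewrite /adj /= inE.
- by move=> i; rewrite /rc_color /= ffunE.
Qed.

End finite_balls.

Lemma tag_tagged (I : Type) (T : I -> Type) (x : {i : I & T i}) :
  x = existT T (tag x) (tagged x).
Proof. by case: x. Qed.

Section U_finite.
Variables (d r k : nat).

Lemma rcgraph_size (H : rcgraph d r k) : (tag (val H) <= d.+1 ^ r)%N.
Proof.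
have /andP[/asboolP hB hd] := valP H.
have := card_gball hd r (rc_root (val H)).
rewrite (_ : #|_| = tag (val H))// -[RHS]card_ord; apply: eq_card => x.
by rewrite inE; apply/asboolP; rewrite hB.
Qed.

(** Representatives have at most [d.+1 ^ r] vertices, so they come from finitely many labelled
    graphs. *)
Lemma U_finite : finite_set [set: U d r k].
Proof.
pose S (m : nat) : set (pre_rcgraph k) :=
  [set H | (exists x, H = existT _ m x)].
have finS m : finite_set (S m).
  have -> : S m = [set existT (fun m => (sgraph m * 'I_m * {ffun 'I_m -> 'I_k})%type) m x | x in [set: _]].
    by apply/seteqP; split=> [H [x ->]|_ [x _ <-]]; exists x.
  by apply: finite_image; exact: finite_finset.
have finT : finite_set (\bigcup_(m in `I_(d.+1 ^ r).+1) S m).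
  by apply: bigcup_finite => //; exact: finite_II.
have [->|/set0P[u0 _]] := eqVneq [set: U d r k] set0; first exact: finite_set0.
pose g (H : pre_rcgraph k) : U d r k :=
  if insub H is Some H' then \pi_(U d r k) (H' : rcgraph d r k) else u0.
apply: (sub_finite_set _ (finite_image g finT)) => u _.
exists (val (repr u)).
  exists (tag (val (repr u))) => /=; first by rewrite ltnS rcgraph_size.
  by exists (tagged (val (repr u))); exact: tag_tagged.
by rewrite /g valK reprK.
Qed.
End U_finite.

(** * Laws on finite sets *)

Section finite_laws.
Variables (R : realType).

Lemma unif_vertex_law (n : nat) : (0 < n)%N -> is_law (@unif_vertex R n).
Proof.
move=> n0; have nR : 0 < n%:R :> R by rewrite ltr0n.
split.
- by move=> A; rewrite divr_ge0.
- rewrite /unif_vertex (_ : #|_| = n) ?divff ?gt_eqF//.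
  by rewrite -[RHS]card_ord; apply: eq_card => x; rewrite !inE; apply/asboolP.
- move=> A B AB; rewrite /unif_vertex -mulrDl -natrD; congr (_%:R / _).
  rewrite -cardUI [X in (_ + X)%N](_ : _ = 0%N) ?addn0.
    by apply: eq_card => x; rewrite !inE asbool_or.
  apply: eq_card0 => x; rewrite !inE; apply/negP => /andP[/asboolP Ax /asboolP Bx].
  by have : set0 x by rewrite -AB.
Qed.

Lemma sgraph_gt0 (n : nat) (G : sgraph n) : (0 < n)%N.
Proof. by have /and3P[] := valP G. Qed.

(** Ball classes are unique, so once every vertex has one, a color law is the image of the vertex
    law under the class map [c]. *)
Lemma color_law_preimage (d r k : nat) (V : Type) (e : V -> V -> Prop)
    (p : set V -> R) (f : V -> 'I_k) (c : V -> U d r k) (A : set (U d r k)) :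
  (forall v, ball_class e f v (c v)) -> color_law e p f A = p (c @^-1` A).
Proof.
move=> cE; rewrite /color_law; congr p; apply/seteqP; split=> v /=.
  by move=> [u Au vu]; rewrite (ball_class_uniq (cE v) vu).
by move=> Av; exists (c v).
Qed.

Lemma preimage_law (V T : Type) (p : set V -> R) (c : V -> T) :
  is_law p -> is_law (fun A => p (c @^-1` A)).
Proof.
move=> [p0 p1 pD]; split=> // A B AB.
by rewrite preimage_setU pD// -preimage_setI AB preimage_set0.
Qed.

Lemma graph_color_law (d n : nat) (G : sgraph n) (r k : nat) (f : 'I_n -> 'I_k) :
  max_degree_le d G -> is_law (@color_law R d r k _ (adj G) (@unif_vertex R n) f).
Proof.
move=> dG; have /choice[c cE] := fun v => ball_class_ex dG r f v.
rewrite (_ : color_law _ _ _ = fun A => unif_vertex R (c @^-1` A)).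
  by apply: preimage_law; apply: unif_vertex_law; exact: sgraph_gt0 G.
by apply/funext => A; exact: color_law_preimage.
Qed.

Lemma Qgraph_proper (d n : nat) (G : sgraph n) :
  max_degree_le d G -> proper_qfamily (Qgraph R d G).
Proof.
move=> dG r [//|k] _; split; first by eexists; exists (fun=> ord0).
by move=> _ [f _ <-]; exact: graph_color_law.
Qed.

Lemma law0 (T : Type) (mu : set T -> R) : is_law mu -> mu set0 = 0.
Proof. by move=> l; have [_ m1 _] := l; rewrite -setCT law_setC// m1 subrr. Qed.

Lemma law_sum (T : Type) (mu : set T -> R) (rank : T -> nat) (m : nat) (A : set T) :
  is_law mu -> (forall x, (rank x < m)%N) ->
  mu A = \sum_(i < m) mu (A `&` rank @^-1` [set i : nat]).
Proof.
move=> l rankm; have [_ _ muD] := l.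
have h j : mu (A `&` [set x | (rank x < j)%N]) =
    \sum_(i < j) mu (A `&` rank @^-1` [set i : nat]).
  elim: j => [|j IH]; first by rewrite big_ord0 (_ : _ `&` _ = set0) ?law0//; apply/seteqP; split=> // x [].
  rewrite big_ord_recr /= -IH -muD.
    rewrite -setIUr; congr (mu (_ `&` _)); apply/seteqP; split=> x /=.
      by rewrite ltnS leq_eqVlt => /orP[/eqP|]; [right|left].
    by case=> [/ltnW|->].
  apply/seteqP; split=> // x [[_ /= xj] [_ /= xj']].
  by rewrite xj' ltnn in xj.
by rewrite -h; congr mu; apply/seteqP; split=> [x Ax|x []//]; split=> //=.
Qed.

Lemma truncn_eq_close (M : nat) (x y : R) : (0 < M)%N -> 0 <= x -> 0 <= y ->
  Num.truncn (M%:R * x) = Num.truncn (M%:R * y) -> `|x - y| <= M%:R^-1.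
Proof.
move=> M0 x0 y0 e; have MR : 0 < M%:R :> R by rewrite ltr0n.
have /truncn_itv/andP[h1 h2] : 0 <= M%:R * x by rewrite mulr_ge0.
have /truncn_itv/andP[h3 h4] : 0 <= M%:R * y by rewrite mulr_ge0.
rewrite e -natr1 in h1 h2; rewrite -natr1 in h4.
rewrite -(ler_pM2l MR) -{1}(gtr0_norm MR) -normrM divff ?gt_eqF// mulrBr.
by rewrite ler_norml; apply/andP; split; lra.
Qed.

(** The pieces are the singletons, named by their rank; additivity reduces every event to them. *)
Lemma dTV_pieces (T : Type) : finite_set [set: T] ->
  exists (m : nat) (piece : 'I_m -> set T), forall (mu mu' : set T -> R) (e : R),
    is_law mu -> is_law mu' -> 0 <= e ->
    (forall i, `|mu (piece i) - mu' (piece i)| <= e) -> dTV mu mu' <= m%:R * e.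
Proof.
move=> /finite_setP[m /card_set_bijP[rank [ranklt rankinj _]]].
exists m, (fun i => rank @^-1` [set i : nat]) => mu mu' e l l' e0 close.
apply: dTV_le => A.
have rankm x : (rank x < m)%N by exact: ranklt.
rewrite (law_sum A l rankm) (law_sum A l' rankm) -sumrB.
apply: (le_trans (ler_norm_sum _ _ _)).
apply: (@le_trans _ _ (\sum_(i < m) e)); last by rewrite sumr_const card_ord mulr_natl.
apply: ler_sum => i _.
have [[x [Ax xi]]|no] := pselect (exists x, A x /\ rank x = i).
  have -> : A `&` rank @^-1` [set i : nat] = rank @^-1` [set i : nat]; last exact: close.
  apply/seteqP; split=> [y []//|y /= yi]; split=> //.
  by rewrite (_ : y = x)//; apply: rankinj; rewrite ?in_setT// xi.
have -> : A `&` rank @^-1` [set i : nat] = set0.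
  by apply/seteqP; split=> // y [Ay yi]; apply: no; exists y.
by rewrite !law0// subrr normr0.
Qed.

(* Laws on a finite set are rounded to a finite grid. *)
Lemma law_key (T : Type) (e : R) : finite_set [set: T] -> 0 < e ->
  exists (K : finType) (key : (set T -> R) -> K),
    forall mu mu', is_law mu -> is_law mu' -> key mu = key mu' -> dTV mu mu' <= e.
Proof.
move=> /dTV_pieces[m [piece dTVm]] e0.
pose M := (Num.bound (m%:R / e)).+1.
pose key (mu : set T -> R) : {ffun 'I_m -> 'I_M.+1} :=
  [ffun i => inord (Num.truncn (M%:R * mu (piece i)))].
exists {ffun 'I_m -> 'I_M.+1}, key => mu mu' l l' kE.
have mM : m%:R / e < M%:R.
  apply: (lt_le_trans (archi_boundP _)); first by rewrite divr_ge0// ltW.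
  by rewrite ler_nat.
have MR : 0 < M%:R :> R by rewrite ltr0n.
apply: (@le_trans _ _ (m%:R * M%:R^-1)).
  apply: dTVm => // i.
  apply: truncn_eq_close => //; [exact: law_ge0|exact: law_ge0|].
  have := congr1 (fun h : {ffun 'I_m -> 'I_M.+1} => (h i : nat)) kE; rewrite !ffunE.
  have bound (nu : set T -> R) : is_law nu -> (Num.truncn (M%:R * nu (piece i)) < M.+1)%N.
    move=> lnu; rewrite ltnS -(ler_nat R).
    have h1 : (Num.truncn (M%:R * nu (piece i)))%:R <= M%:R * nu (piece i).
      by rewrite truncn_le mulr_ge0// law_ge0.
    have h2 : M%:R * nu (piece i) <= M%:R by rewrite ler_piMr// law_le1.
    exact: le_trans h1 h2.
  by rewrite !inordK//; exact: bound.
rewrite ler_pdivrMr//.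
by rewrite mulrC -ler_pdivrMr// ltW.
Qed.

End finite_laws.

(** * Total boundedness through finite keys *)

Section keyed.
Variable X : Type.

(** Total boundedness in the form of a finite partition. In this form finitely many conditions are
    combined by pairing their keys. *)
Definition keyed (P : X -> X -> Prop) : Prop :=
  exists (K : finType) (key : X -> K), forall x y, key x = key y -> P x y.

Lemma keyedT (P : X -> X -> Prop) : (forall x y, P x y) -> keyed P.
Proof. by move=> PT; exists unit, (fun=> tt) => x y _; exact: PT. Qed.

Lemma keyed_forall (m : nat) (P : nat -> X -> X -> Prop) :
  (forall i, (i < m)%N -> keyed (P i)) ->
  keyed (fun x y => forall i, (i < m)%N -> P i x y).
Proof.
elim: m => [|m IH] h; first exact: keyedT.
have [K [key hK]] := IH (fun i im => h i (ltnW im)).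
have [K' [key' hK']] := h m (ltnSn m).
exists (K * K')%type, (fun x => (key x, key' x)) => x y [e e'] i.
rewrite ltnS leq_eqVlt => /orP[/eqP ->|im]; first exact: hK'.
exact: hK.
Qed.

End keyed.

Section graph_key.
Variables (R : realType) (d : nat).

Lemma Xgraph_proper (x : Xgraph d) : proper_qfamily (Qgraph R d (val (tagged x))).
Proof. by apply: Qgraph_proper; exact: (valP (tagged x)). Qed.

(** The key of a family of laws is the set of keys of its members; equal sets provide partners in
    both directions. *)
Lemma hausdorff_keyed (r k : nat) (e : R) : 0 < e -> (0 < k)%N ->
  keyed (fun x y : Xgraph d => hausdorff_dist (@dTV R _)
     (Qgraph R d (val (tagged x)) r k) (Qgraph R d (val (tagged y)) r k) <= e).
Proof.
move=> e0 k0; have [K [key hK]] := law_key (@U_finite d r k) e0.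
pose Q (x : Xgraph d) := Qgraph R d (val (tagged x)) r k.
exists {set K}, (fun x => [set a | `[< exists2 mu, Q x mu & key mu = a >]]%SET) => x y /setP xy.
have [px lx] := Xgraph_proper x r k0; have [py ly] := Xgraph_proper y r k0.
have memK z mu : Q z mu -> `[< exists2 nu, Q z nu & key nu = key mu >].
  by move=> Qmu; apply/asboolP; exists mu.
apply: hausdorff_le => // mu Qmu; have := xy (key mu); rewrite !inE.
- rewrite (memK x)// => /esym/asboolP[nu Qnu _e]; exists nu => //.
  by apply: hK; [exact: lx|exact: ly|].
- rewrite (memK y)// => /asboolP[nu Qnu _e]; exists nu => //.
  by apply: hK; [exact: lx|exact: ly|].
Qed.

Lemma dX_keyed (e : R) : 0 < e -> keyed (fun x y : Xgraph d => dX R x y < e).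
Proof.
move=> e0; have [K [e' e'0 small]] := dCN_small d e0.
have [F [key hkey]] : keyed (fun x y : Xgraph d => forall r, (r < K)%N -> forall k, (k < K)%N ->
    hausdorff_dist (@dTV R _)
     (Qgraph R d (val (tagged x)) r.+1 k.+1) (Qgraph R d (val (tagged y)) r.+1 k.+1) <= e').
  apply: (@keyed_forall _ K (fun r x y => forall k, (k < K)%N -> _)) => r _.
  apply: (@keyed_forall _ K (fun k x y => _)) => k _; exact: hausdorff_keyed.
exists F, key => x y /hkey h; apply: small; [exact: Xgraph_proper..|].
by move=> [//|r] [//|k] _ _ rK kK; exact: h.
Qed.

End graph_key.

Section law_coupling.
Variables (R : realType) (T : Type).

Lemma law_le (mu : set T -> R) (A B : set T) : is_law mu -> A `<=` B -> mu A <= mu B.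
Proof.
move=> l AB; have [_ _ muD] := l; rewrite -(setDUK AB) muD ?setIDK//.
  by rewrite lerDl law_ge0.
by apply/seteqP; split=> // x [? []].
Qed.

Lemma law_le_add (mu : set T -> R) (A B Z : set T) : is_law mu ->
  A `<=` B `|` Z -> mu A <= mu B + mu Z.
Proof.
move=> l AB; have [_ _ muD] := l; apply: (le_trans (law_le l AB)).
have -> : B `|` Z = B `|` (Z `\` B).
  apply/seteqP; split=> x; last by case=> [|[]]; [left|right].
  by have [Bx _|nBx [|]] := pselect (B x); [left|left|right].
rewrite muD ?lerD2l; last by apply/seteqP; split=> // x [? []].
by apply: law_le => // x [].
Qed.

Lemma law_dist_le (mu : set T -> R) (A B Z : set T) : is_law mu ->
  A `<=` B `|` Z -> B `<=` A `|` Z -> `|mu A - mu B| <= mu Z.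
Proof.
move=> l AB BA; have := law_le_add l AB; have := law_le_add l BA => h1 h2.
by rewrite ler_norml; apply/andP; split; lra.
Qed.

End law_coupling.

(** * Effect of changing few edges *)

Section perturbation.

Lemma gball_cons (V : Type) (e : V -> V -> Prop) (r : nat) (v y x : V) :
  e v y -> gball e r y x -> gball e r.+1 v x.
Proof.
move=> vy; elim: r x => [|r IH] x.
  by move=> /= ->; right; exists v.
by move=> [/IH h|[z /IH h zx]]; [left|right; exists z].
Qed.

Lemma gball_sym (V : Type) (e : V -> V -> Prop) (r : nat) (v x : V) :
  (forall a b, e a b -> e b a) -> gball e r v x -> gball e r x v.
Proof.
move=> es; elim: r x => [|r IH] x; first by move=> /= ->.
move=> [/IH h|[y /IH h yx]]; first by left.
by apply: gball_cons h; exact: es.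
Qed.

Lemma gball_eq (V : Type) (e e' : V -> V -> Prop) (r : nat) (v : V) :
  (forall x y, gball e r v x -> e x y <-> e' x y) ->
  forall s, (s <= r)%N -> gball e s v = gball e' s v.
Proof.
move=> h; elim=> [//|s IH] sr /=; rewrite -IH; last exact: ltnW.
congr (_ `|` _); apply/seteqP; split=> y [x xs xy]; exists x => //; apply/h => //;
  by apply: gball_le xs; exact: ltnW.
Qed.

Variables (R : realType) (d n : nat) (G1 G2 : sgraph n).
Hypothesis (deg1 : max_degree_le d G1) (deg2 : max_degree_le d G2).

(** Under the same coloring, the ball classes at [v] agree in the two graphs unless the ball of [v]
    meets an end of a changed edge. There are at most [2 * eta * n] such ends, and each lies in at
    most [d.+1 ^ r] balls, by symmetry of the distance. *)
Lemma Qgraph_edge_close (eta : R) (r k : nat) : (0 < k)%N ->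
  edge_close eta (val G1) (val G2) ->
  hausdorff_dist (@dTV R _) (Qgraph R d G1 r k) (Qgraph R d G2 r k)
    <= 2 * eta * (d.+1 ^ r)%:R.
Proof.
move=> k0 [c12 c21].
have n0 : (0 < n)%N := sgraph_gt0 G1; have nR : 0 < n%:R :> R by rewrite ltr0n.
pose D : {set 'I_n * 'I_n} := ((val G1 :\: val G2) :|: (val G2 :\: val G1))%SET.
pose S : {set 'I_n} := (fst @: D)%SET.
have cS : #|S|%:R <= 2 * eta * n%:R.
  apply: (@le_trans _ _ #|D|%:R); first by rewrite ler_nat leq_imset_card.
  apply: (@le_trans _ _ (#|(val G1 :\: val G2)%SET| + #|(val G2 :\: val G1)%SET|)%:R).
    by rewrite ler_nat cardsU leq_subr.
  by rewrite natrD; lra.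
pose bad : pred 'I_n := fun v => [exists x in S, gballb G1 r v x].
have cbad : unif_vertex R [set v | bad v] <= 2 * eta * (d.+1 ^ r)%:R.
  rewrite /unif_vertex ler_pdivrMr//.
  apply: (@le_trans _ _ (\sum_(x in S) #|gballb G1 r x|)%:R).
    rewrite ler_nat.
    have -> : #|[pred v | `[< [set v | bad v] v >]]| = #|bad|.
      by apply: eq_card => v; rewrite inE; apply/asboolP/idP.
    rewrite -sum1_card.
    have -> : (\sum_(x in S) #|gballb G1 r x| = \sum_v \sum_(x in S) gballb G1 r x v)%N.
      rewrite exchange_big; apply: eq_bigr => x _; rewrite -sum1_card big_mkcond.
      by apply: eq_bigr => v _; rewrite -topredE /=; case: ifP.
    rewrite big_mkcond; apply: leq_sum => v _; rewrite -topredE /=.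
    case: ifP => // /existsP[x /andP[xS /asboolP vx]].
    rewrite (bigD1 x) //= (_ : gballb _ _ _ _)//; apply/asboolP.
    by apply: gball_sym vx; exact: adj_sym.
  apply: (@le_trans _ _ (#|S| * d.+1 ^ r)%:R).
    rewrite ler_nat -sum_nat_const; apply: leq_sum => x _; exact: card_gball.
  by rewrite natrM mulrAC ler_wpM2r.
have good v : ~~ bad v -> forall x y, gball (adj G1) r v x -> adj G1 x y <-> adj G2 x y.
  move=> gv x y vx; have xS : x \notin S.
    by apply: contra gv => xS; apply/existsP; exists x; rewrite xS; apply/asboolP.
  split=> xy; apply/negPn/negP => nxy; move/negP: xS; apply; apply/imsetP;
    exists (x, y) => //; rewrite !inE nxy; apply/orP; [left|right]; exact: xy.
have p1 := Qgraph_proper R deg1 r k0; have p2 := Qgraph_proper R deg2 r k0.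
have main f : dTV (@color_law R d r k _ (adj G1) (@unif_vertex R n) f)
    (@color_law R d r k _ (adj G2) (@unif_vertex R n) f) <= 2 * eta * (d.+1 ^ r)%:R.
  have /choice[c1 c1E] := fun v => ball_class_ex deg1 r f v.
  have /choice[c2 c2E] := fun v => ball_class_ex deg2 r f v.
  have c12E v : ~~ bad v -> c1 v = c2 v.
    move=> /good gv; apply: ball_class_uniq (c1E v) _.
    apply: (@ball_class_transport _ _ _ _ _ (adj G2) (adj G1) v v f f id _ _ _ _ _ (c2E v)) => //.
      by rewrite (gball_eq gv (leqnn r)); split=> // x h; exists x.
    by move=> x y; rewrite -(gball_eq gv (leqnn r)) => vx _; split=> /gv; exact.
  apply: dTV_le => A; rewrite (color_law_preimage _ _ c1E) (color_law_preimage _ _ c2E).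
  apply: le_trans cbad; apply: law_dist_le; first exact: unif_vertex_law.
    move=> v /= Av; have [bv|/c12E gv] := boolP (bad v); first by right.
    by left; rewrite -gv.
  move=> v /= Av; have [bv|/c12E gv] := boolP (bad v); first by right.
  by left; rewrite gv.
by apply: hausdorff_le => // mu [f _ <-]; (eexists; [exists f|exact: main]).
Qed.

End perturbation.

Section close_graphs.
Variables (R : realType) (d : nat).

Lemma dX_edge_close (e : R) : 0 < e -> exists2 eta : R, 0 < eta &
  forall n (G1 G2 : reg_graph d n), edge_close eta (redges G1) (redges G2) ->
    dX R (Xgraph_of G1) (Xgraph_of G2) < e.
Proof.
move=> e0; have [K [e' e'0 small]] := dCN_small d e0.
have D0 : 0 < (d.+1 ^ K)%:R :> R by rewrite ltr0n expn_gt0.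
exists (e' / (2 * (d.+1 ^ K)%:R)); first by rewrite divr_gt0// mulr_gt0.
move=> n G1 G2 close; apply: small; [exact: Xgraph_proper..|].
move=> r k r0 k0 rK kK.
apply: (le_trans (Qgraph_edge_close (regular_max_degree (valP G1)) (regular_max_degree (valP G2)) r k0 close)).
have -> : 2 * (e' / (2 * (d.+1 ^ K)%:R)) * (d.+1 ^ r)%:R = e' * ((d.+1 ^ r)%:R / (d.+1 ^ K)%:R).
  by field; rewrite gt_eqF.
by rewrite ler_piMr ?(ltW e'0)// ler_pdivrMr// mul1r ler_nat leq_pexp2l.
Qed.

End close_graphs.

Local Close Scope quotient_scope.
Local Close Scope classical_set_scope.

(** * Concentration of random regular graphs *)

Section concentration.
Variables (R : realType) (d : nat).

Lemma dX_sym (x y : Xgraph d) : dX R x y = dX R y x.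
Proof. exact: dCN_sym. Qed.

Lemma dX_triangle (y x z : Xgraph d) : dX R x z <= dX R x y + dX R y z.
Proof. by apply: dCN_triangle; exact: Xgraph_proper. Qed.

(** The key classes of density below [delta] contain less than a fraction [e] of all graphs in
    total, so [C] has a member [a] in a dense class. Any [g] in a dense class is within [e] of [a]:
    the two classes contain an edge-close pair, and the path [g], [G1], [G2], [a] has three steps
    below [e / 3]. *)
Lemma random_graph_concentration (e : R) : (0 < d)%N -> 0 < e ->
  exists n0, forall n, (n0 <= n)%N -> (0 < #|{: reg_graph d n}|)%N ->
    forall C : {set reg_graph d n}, e * #|{: reg_graph d n}|%:R <= #|C|%:R ->
    exists2 a, a \in C &
      #|[pred g : reg_graph d n | ~~ (dX R (Xgraph_of g) (Xgraph_of a) < e)]|%:R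
        <= e * #|{: reg_graph d n}|%:R.
Proof.
move=> d0 e0; have e3 : 0 < e / 3 by lra.
have e3E : e = e / 3 + (e / 3 + e / 3) by lra.
have [F [key keyP]] := dX_keyed d e3.
have [eta eta0 closeP] := dX_edge_close d e3.
pose delta := e / (2 * #|F|.+1%:R).
have F0 : 0 < #|F|.+1%:R :> R by rewrite ltr0n.
have del0 : 0 < delta by rewrite divr_gt0// mulr_gt0.
have [n0 dense] := dense_sets_close d0 del0 eta0.
exists n0 => n nn reg0 C hC; set r := #|{: reg_graph d n}| in reg0 hC *.
have r0 : 0 < r%:R :> R by rewrite ltr0n.
pose class (a : F) : {set reg_graph d n} := [set g | key (Xgraph_of g) == a].
pose big (a : F) : bool := delta * r%:R <= #|class a|%:R.
pose smalls : {set reg_graph d n} := [set g | ~~ big (key (Xgraph_of g))].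
have csmall : #|smalls|%:R < e * r%:R.
  apply: (@le_lt_trans _ _ (\sum_(a : F | ~~ big a) #|class a|)%N%:R).
    rewrite ler_nat -sum1_card.
    rewrite (partition_big (fun g => key (Xgraph_of g)) (fun a => ~~ big a)) /=.
      apply: leq_sum => a na; rewrite sum1_card; apply/subset_leq_card/fintype.subsetP => g.
      by move=> /andP[_ ga]; rewrite inE.
    by move=> g; rewrite inE.
  apply: (@le_lt_trans _ _ (#|F|%:R * (delta * r%:R))).
    rewrite natr_sum [leRHS]mulr_natl.
    rewrite -sumr_const big_mkcond; apply: ler_sum => a _.
    case: ifP => [|_]; first by rewrite -ltNge => /ltW.
    by rewrite mulr_ge0 ?ltW.
  rewrite mulrA ltr_pM2r// /delta.
  rewrite mulrA ltr_pdivrMr ?mulr_gt0// -natr1 mulrC ltr_pM2l//.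
  have := ler0n R #|F|; lra.
have [a aC abig] : exists2 a, a \in C & big (key (Xgraph_of a)).
  have /subsetPn[a aC aS] : ~~ (C \subset smalls).
    apply/negP => /subset_leq_card; rewrite -(ler_nat R) => h.
    by have := le_lt_trans (le_trans hC h) csmall; rewrite ltxx.
  by exists a => //; move: aS; rewrite inE negbK.
exists a => //; apply: le_trans (ltW csmall); rewrite ler_nat.
apply/subset_leq_card/fintype.subsetP => g; rewrite !inE.
apply: contra => gbig.
have [G1 [G2 [h1 h2 h12]]] := dense n nn _ _ reg0 gbig abig.
rewrite !inE in h1 h2.
have d1 : dX R (Xgraph_of g) (Xgraph_of G1) < e / 3 by apply: keyP; rewrite (eqP h1).
have d2 : dX R (Xgraph_of G2) (Xgraph_of a) < e / 3 by apply: keyP; rewrite (eqP h2).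
have d12 := closeP _ _ _ h12.
have t2 := le_lt_trans (dX_triangle (Xgraph_of G2) (Xgraph_of G1) (Xgraph_of a)) (ltrD d12 d2).
have t1 := le_lt_trans (dX_triangle (Xgraph_of G1) (Xgraph_of g) (Xgraph_of a)) (ltrD d1 t2).
by rewrite e3E; exact: t1.
Qed.

End concentration.

Local Open Scope classical_set_scope.
Local Open Scope ring_scope.

(** * Laws on the Cantor space *)

(* The Cantor space of bit sequences, with the metric in which two sequences
   first differing at n are at distance 1/(n+1). *)
Definition bseq (R : realType) : Type := nat -> bool.

Section bseq_space.
Variable R : realType.
Local Notation T := (bseq R).

HB.instance Definition _ := gen_eqMixin T.
HB.instance Definition _ := gen_choiceMixin T.
HB.instance Definition _ := isPointed.Build T (fun=> false).

(** The clause [0 < e] serves the triangle inequality: at a bit where one of the two pairs differs,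
    the other radius has to be positive. *)
Definition bseq_ball (x : T) (e : R) (y : T) : Prop :=
  0 < e /\ forall n, x n <> y n -> n.+1%:R^-1 < e.

Lemma bseq_ball_center (x : T) (e : R) : 0 < e -> bseq_ball x e x.
Proof. by move=> e0; split=> // n []. Qed.

Lemma bseq_ball_sym (x y : T) (e : R) : bseq_ball x e y -> bseq_ball y e x.
Proof. by move=> [e0 h]; split=> // n yx; apply: h => xy; apply: yx. Qed.

Lemma bseq_ball_triangle (x y z : T) (e1 e2 : R) :
  bseq_ball x e1 y -> bseq_ball y e2 z -> bseq_ball x (e1 + e2) z.
Proof.
move=> [e10 h1] [e20 h2]; split; first exact: addr_gt0.
move=> n xz; have [xy|/eqP xy] := eqVneq (x n) (y n).
  by apply: (lt_trans (h2 n _)); [rewrite -xy|rewrite ltrDr].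
by apply: (lt_trans (h1 n xy)); rewrite ltrDl.
Qed.

HB.instance Definition _ := hasNbhs.Build T (nbhs_ (entourage_ bseq_ball)).
HB.instance Definition _ := Nbhs_isPseudoMetric.Build R T
  erefl bseq_ball_center bseq_ball_sym bseq_ball_triangle erefl.

Lemma bseq_ballE (x y : T) (e : R) : ball x e y = bseq_ball x e y.
Proof. by []. Qed.

Definition agree (N : nat) (x y : nat -> bool) : Prop := forall n, (n < N)%N -> x n = y n.

Lemma agree_sym N x y : agree N x y -> agree N y x.
Proof. by move=> h n nN; rewrite h. Qed.

Lemma agree_trans N y x z : agree N x y -> agree N y z -> agree N x z.
Proof. by move=> h h' n nN; rewrite h// h'. Qed.

Lemma agree_le N M x y : (N <= M)%N -> agree M x y -> agree N x y.
Proof. by move=> NM h n nN; apply: h; exact: leq_trans NM. Qed.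

Lemma ball_agree (x y : T) (N : nat) : ball x N.+1%:R^-1 y <-> agree N.+1 x y.
Proof.
rewrite bseq_ballE; split=> [[_ h] n nN|h].
  apply: contrapT => /h; rewrite ltf_pV2 ?posrE ?ltr0n// ltr_nat ltnS => Nn.
  by rewrite ltnNge Nn in nN.
split; first by rewrite invr_gt0 ltr0n.
move=> n xyn; rewrite ltf_pV2 ?posrE ?ltr0n// ltr_nat ltnS.
by rewrite leqNgt -ltnS; apply/negP => /h.
Qed.

Lemma agree_ball (x : T) (e : R) : 0 < e -> exists N, forall y, agree N x y -> ball x e y.
Proof.
move=> e0; exists (Num.bound e^-1).+1 => y xy.
have /ball_agree h := xy; apply: le_ball h.
have : e^-1 < (Num.bound e^-1)%:R by apply: archi_boundP; rewrite invr_ge0 ltW.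
move=> h; rewrite invf_ple ?posrE ?ltr0n//.
by apply: (le_trans (ltW h)); rewrite ler_nat.
Qed.

Lemma bseq_cauchy_cvg (F : set_system T) : ProperFilter F -> cauchy F -> cvg F.
Proof.
move=> FF /cauchy_ballP Fc.
have /boolp.choice[xs xsP] n : exists x : T, F (agree n.+1 x).
  have := Fc n.+1%:R^-1; rewrite invr_gt0 ltr0n => /(_ isT) [[A B] /= [FA FB] AB].
  have [x Ax] := filter_ex FA.
  exists x; apply: filterS FB => y By.
  by apply/ball_agree; apply: (AB (x, y)); split.
pose l : T := fun n => xs n n.
have Fl n : F (agree n l).
  elim: n => [|n IH]; first by apply: filterS filterT => y _ m.
  apply: filterS2 IH (xsP n) => y h1 h2 m; rewrite ltnS leq_eqVlt => /orP[/eqP ->|mn].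
    exact: h2.
  exact: h1.
apply/cvg_ex; exists l => A /nbhs_ballP[e /= e0 eA].
have [N hN] := agree_ball l e0.
by apply: filterS (Fl N) => y /hN /eA.
Qed.

HB.instance Definition _ := Uniform_isComplete.Build T bseq_cauchy_cvg.

Lemma nbhs_agree (x : T) (A : set T) : nbhs x A <-> exists N, forall y, agree N x y -> A y.
Proof.
split=> [/nbhs_ballP[e /= e0 eA]|[N hN]].
  by have [N hN] := agree_ball x e0; exists N => y /hN /eA.
apply/nbhs_ballP; exists N.+1%:R^-1; first by rewrite /= invr_gt0 ltr0n.
by move=> y /ball_agree h; apply: hN; exact: agree_le h.
Qed.

Lemma bseq_hausdorff : hausdorff_space T.
Proof.
move=> x y xy; apply/funext => n.
have /(_ (agree n.+1 x) (agree n.+1 y)) [||z [/= h1 h2]] := xy.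
- by apply/nbhs_agree; exists n.+1.
- by apply/nbhs_agree; exists n.+1.
by rewrite h1// h2.
Qed.

Definition bseq_of (s : seq bool) : T := fun n => nth false s n.

Lemma bseq_of_agree (x : T) (N : nat) : agree N x (bseq_of (mkseq x N)).
Proof. by move=> n nN; rewrite /bseq_of nth_mkseq. Qed.

Lemma bseq_separable : separable T.
Proof.
exists (range bseq_of); first exact: sub_countable (card_image_le _ _) (countableP _).
move=> O [x Ox] Oo; have /nbhs_agree[N hN] : nbhs x O by exact: open_nbhs_nbhs.
exists (bseq_of (mkseq x N)); split; last by exists (mkseq x N).
by apply: hN; exact: bseq_of_agree.
Qed.

(** Sets that depend on finitely many bits are the clopen sets of the Cantor space, an algebra that
    generates the Borel sets. *)
Definition fdet (Z : set T) : Prop := exists N, forall x y, agree N x y -> Z x -> Z y.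

Lemma fdet_open (Z : set T) : fdet Z -> open Z.
Proof.
move=> [N hN]; rewrite openE => x Zx; apply/nbhs_agree; exists N => y xy; exact: hN Zx.
Qed.

Lemma fdet_measurable (Z : set (borel T)) : fdet Z -> measurable Z.
Proof. by move=> /fdet_open h; apply: sub_sigma_algebra. Qed.

Lemma fdet_agree (N : nat) (x : T) : fdet (agree N x).
Proof. by exists N => y z yz xy; exact: agree_trans yz. Qed.

Lemma open_fdet (O : set T) : open O ->
  exists F : nat -> set T, (forall i, fdet (F i)) /\ O = \bigcup_i F i.
Proof.
move=> Oo.
pose F (i : nat) : set T :=
  if @unpickle (seq bool) i is Some s then
    (if `[< agree (size s) (bseq_of s) `<=` O >] then agree (size s) (bseq_of s) else set0)
  else set0.
exists F; split=> [i|].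
  rewrite /F; case: unpickle => [s|]; last by exists 0%N.
  by case: asboolP => _; [exact: fdet_agree|exists 0%N].
apply/seteqP; split=> [x Ox|x [i _]].
  have /nbhs_agree[N hN] : nbhs x O by exact: open_nbhs_nbhs.
  exists (pickle (mkseq x N)) => //; rewrite /F pickleK size_mkseq.
  have sub : agree N (bseq_of (mkseq x N)) `<=` O.
    by move=> y h; apply: hN; apply: agree_trans h; exact: bseq_of_agree.
  by rewrite (asboolT sub); apply: agree_sym; exact: bseq_of_agree.
by rewrite /F; case: unpickle => [s|//]; case: asboolP => // h /h.
Qed.

Lemma fdetI (A B : set T) : fdet A -> fdet B -> fdet (A `&` B).
Proof.
move=> [N hN] [M hM]; exists (maxn N M) => x y xy [Ax Bx]; split.
  by apply: hN Ax; apply: agree_le xy; exact: leq_maxl.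
by apply: hM Bx; apply: agree_le xy; exact: leq_maxr.
Qed.

Lemma fdetC (A : set T) : fdet A -> fdet (~` A).
Proof.
by move=> [N hN]; exists N => x y xy nAx Ay; apply: nAx; apply: hN Ay; exact: agree_sym.
Qed.

Lemma fdetT : fdet setT. Proof. by exists 0%N. Qed.

Lemma fdet0 : fdet set0. Proof. by exists 0%N. Qed.

Lemma fdetU (A B : set T) : fdet A -> fdet B -> fdet (A `|` B).
Proof.
by move=> fA fB; rewrite -(setCK (A `|` B)) setCU; apply/fdetC/fdetI; exact: fdetC.
Qed.

Lemma borel_fdetE : @measurable _ (borel T) = <<s fdet >>.
Proof.
rewrite eqEsubset; split.
  apply: smallest_sub; first exact: smallest_sigma_algebra.
  move=> O /open_fdet[F [fF ->]]; apply: sigma_algebra_bigcup => i.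
  by apply: sub_sigma_algebra; exact: fF.
apply: smallest_sub; first exact: smallest_sigma_algebra.
by move=> Z /fdet_open h; apply: sub_sigma_algebra.
Qed.

Lemma measurable_fdet_fun (d : measure_display) (X : measurableType d)
    (g : X -> borel T) : (forall n, measurable [set x | g x n]) ->
  measurable_fun setT g.
Proof.
move=> gn; apply: (@measurability _ _ X (borel T) setT g fdet borel_fdetE).
move=> _ [Z [N hN] <-]; rewrite setTI; elim: N Z hN => [|N IH] Z hN.
  have [[y Zy]|nZ] := pselect (Z !=set0).
    by rewrite (_ : Z = setT) ?preimage_setT//; apply/seteqP; split=> // x _; exact: hN Zy.
  by rewrite (_ : Z = set0) ?preimage_set0//; apply/seteqP; split=> // x Zx; apply: nZ; exists x.
(* Fixing bit [N] to each of its two values leaves a set that depends on the first [N] bits only. *)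
pose upd (b : bool) (y : T) : T := fun n => if n == N then b else y n.
have updN y : upd (y N) y = y by apply/funext => n; rewrite /upd; case: eqP => // ->.
have mupd b : measurable (g @^-1` (upd b @^-1` Z)).
  apply: IH => x y xy; apply: hN => n; rewrite ltnS leq_eqVlt /upd => /orP[/eqP ->|nN].
    by rewrite eqxx.
  by case: ifP => // _; exact: xy.
have -> : g @^-1` Z = ([set x | g x N] `&` g @^-1` (upd true @^-1` Z)) `|`
    (~` [set x | g x N] `&` g @^-1` (upd false @^-1` Z)).
  apply/seteqP; split=> x /=.
    by move=> Zx; case E: (g x N); have := updN (g x); rewrite E => e; [left|right];
      split=> //; rewrite e.
  by case E: (g x N); have := updN (g x); rewrite E => e [[h1 h2]|[h1 h2]] //; rewrite -e.
by apply: measurableU; apply: measurableI => //; apply: measurableC.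
Qed.

End bseq_space.

(** * Measures with prescribed cylinder probabilities *)

Section nested_intervals.
Variables (R : realType) (p : seq bool -> R).
Hypotheses (p_ge0 : forall s, 0 <= p s) (p_nil : p [::] = 1)
  (p_rcons : forall s, p s = p (rcons s false) + p (rcons s true)).
Local Notation T := (bseq R).

(* The word of length n read by u, and the left endpoint of its interval. *)
Fixpoint nest (u : R) (n : nat) : seq bool * R :=
  if n is n'.+1 then
    let: (s, l) := nest u n' in
    let c := l + p (rcons s false) in
    if c <= u then (rcons s true, c) else (rcons s false, l)
  else ([::], 0).

(** Constantly false outside [[0, 1)], so that the reading is defined on the whole line. *)
Definition nest_bit (u : R) (n : nat) : bool := (0 <= u < 1) && last false (nest u n.+1).1.

Lemma nest_mkseq (u : R) (n : nat) : 0 <= u < 1 -> (nest u n).1 = mkseq (nest_bit u) n.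
Proof.
move=> u01; elim: n => [//|n IH]; rewrite mkseqS -IH /nest_bit u01 /=.
by case: (nest u n) => s l /=; case: ifP => _; rewrite last_rcons.
Qed.

(** Consistency [p_rcons] lets the two children of [s] split its interval. The clause that [nest]
    carries the left endpoint locates the cut in the induction. *)
Lemma nest_interval (s : seq bool) : exists l, forall u,
  (0 <= u < 1 /\ (nest u (size s)).1 = s <-> l <= u < l + p s) /\
  (0 <= u < 1 -> (nest u (size s)).1 = s -> (nest u (size s)).2 = l).
Proof.
elim/last_ind: s => [|s b [l IH]].
  by exists 0 => u /=; rewrite p_nil add0r; split=> //; split=> // -[].
have pf := p_ge0 (rcons s false); have pt := p_ge0 (rcons s true); have pr := p_rcons s.
exists (if b then l + p (rcons s false) else l) => u.
have [[h1 h2] h3] := IH u; rewrite size_rcons /=.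
case E : (nest u (size s)) => [s' l'] /=; rewrite E /= in h1 h2 h3.
split; last first.
  move=> u01; case: ifP => _ /= /rcons_inj [ss <-]; rewrite ss in h3 *;
    by rewrite (h3 u01 erefl).
split=> [[u01]|].
  case: ifP => cu /= /rcons_inj [ss bE]; rewrite -bE;
    have ll := h3 u01 ss; have := h1 (conj u01 ss); rewrite ss ll in cu; move=> /andP[? ?].
    by apply/andP; split; lra.
  by move/negbT: cu; rewrite -ltNge => ?; apply/andP; split; lra.
case: b => /andP[a1 a2].
  have [u01 ss] : 0 <= u < 1 /\ s' = s by apply: h2; apply/andP; split; lra.
  by rewrite ss (h3 u01 ss) a1.
have [u01 ss] : 0 <= u < 1 /\ s' = s by apply: h2; apply/andP; split; lra.
by rewrite ss (h3 u01 ss) (leNgt (l + _)) a2.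
Qed.

Lemma nest_bit_agree (u : R) (s : seq bool) : 0 <= u < 1 ->
  agree (size s) (bseq_of R s) (nest_bit u) <-> (nest u (size s)).1 = s.
Proof.
move=> u01; rewrite nest_mkseq//; split=> [h|<-].
  apply: (@eq_from_nth _ false); first by rewrite size_mkseq.
  by move=> i; rewrite size_mkseq => si; rewrite nth_mkseq// -h.
by rewrite size_mkseq; apply: agree_sym; exact: bseq_of_agree.
Qed.

Let D : set (measurableTypeR R) := `[0, 1[.

Let mD : measurable D. Proof. exact: measurable_itv. Qed.

Let phi : measurableTypeR R -> borel T := nest_bit.

Lemma nest_preimage (s : seq bool) : exists l, D `&` phi @^-1` agree (size s) (bseq_of R s) = `[l, l + p s[%classic.
Proof.
have [l hl] := nest_interval s; exists l; apply/seteqP; split=> u /=; rewrite !in_itv /=.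
  move=> [u01 h]; have [[h1 _] _] := hl u; apply: h1; split=> //.
  by apply/(nest_bit_agree s u01).
move=> ul; have [[_ h2] _] := hl u; have [u01 us] := h2 ul; split=> //.
exact/(nest_bit_agree s u01).
Qed.

Lemma measurable_nest_bit : measurable_fun setT phi.
Proof.
apply: measurable_fdet_fun => n.
have -> : [set u : measurableTypeR R | phi u n] =
  \bigcup_(s : seq bool) (if (size s == n.+1) && last false s then
      D `&` phi @^-1` agree (size s) (bseq_of R s) else set0).
  apply/seteqP; split=> u /=.
    move=> h; have /andP[u01 lu] := h.
    exists (mkseq (nest_bit u) n.+1) => //.
    rewrite size_mkseq eqxx andTb -nest_mkseq// lu; split=> //.
    by rewrite nest_mkseq//; apply: agree_sym; exact: bseq_of_agree.
  move=> [s _]; case: ifP => // /andP[/eqP sn ls] [u01 /= us].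
  rewrite /D /= in_itv /= in u01.
  by have /(nest_bit_agree s u01) := us; rewrite sn /phi /nest_bit u01 => ->.
apply: countable_bigcupT_measurable => // s; case: ifP => // _.
by have [l ->] := nest_preimage s; exact: measurable_itv.
Qed.

Definition unit_law : set (measurableTypeR R) -> \bar R := mrestr (@lebesgue_measure R) mD.

HB.instance Definition _ := Measure.on unit_law.

Let unit_lawT : unit_law setT = 1%E.
Proof.
by rewrite /unit_law /mrestr setTI lebesgue_measure_itv /= lte_fin ltr01 oppr0 adde0.
Qed.

HB.instance Definition _ := Measure_isProbability.Build _ _ _ unit_law unit_lawT.

HB.instance Definition _ := isMeasurableFun.Build _ _ _ _ phi measurable_nest_bit.

(** The image of Lebesgue measure on [[0, 1)] under [nest_bit]: the points that read [s] form an
    interval of length [p s]. *)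
Lemma exists_cylinder_probability : exists nu : probability (borel T) R,
  forall s, nu (agree (size s) (bseq_of R s)) = (p s)%:E.
Proof.
exists (distribution unit_law phi) => s.
have [l hl] := nest_preimage s.
rewrite /distribution /pushforward /= /unit_law /mrestr setIC hl lebesgue_measure_itv /= lte_fin.
have := p_ge0 s; rewrite le_eqVlt => /orP[/eqP <-|ps]; first by rewrite addr0 ltxx.
by rewrite ltrDl ps -EFinB addrAC subrr add0r.
Qed.

End nested_intervals.

(** * Ultralimits of laws *)

Section ultralimit.
Variables (R : realType) (F : set_system nat).
Hypothesis FU : UltraFilter F.

Lemma ultra_cvg (a : nat -> R) : (forall j, 0 <= a j <= 1) ->
  exists l : R, a @ F --> l.
Proof.
move=> a01; have FF := @ultra_proper _ _ FU.
have [l [_ cl]] : `[0, 1]%classic `&` cluster (a @ F) !=set0.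
  apply: (@segment_compact R 0 1).
  have h : F (a @^-1` `[0, 1]) by apply: filterS filterT => j _ /=; rewrite in_itv /=.
  exact: h.
exists l => A Al; have [//|FnA] := in_ultra_setVsetC (a @^-1` A) FU.
have : (a @ F) (~` A) by [].
by move=> /cl /(_ Al) [x []].
Qed.

Local Notation T := (bseq R).
Variable Q : nat -> set T -> R.
Hypothesis Q_law : forall j, is_law (Q j).

Definition cylinder (s : seq bool) : set T := agree (size s) (bseq_of R s).

Lemma cylinder_rcons (s : seq bool) :
  cylinder s = cylinder (rcons s false) `|` cylinder (rcons s true).
Proof.
have ag b x : cylinder (rcons s b) x <-> cylinder s x /\ x (size s) = b.
  rewrite /cylinder size_rcons; split=> [h|[h e] n].
    split; last by rewrite -h// /bseq_of nth_rcons ltnn eqxx.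
    by move=> n ns; rewrite -h ?ltnS 1?ltnW// /bseq_of nth_rcons ns.
  rewrite ltnS leq_eqVlt /bseq_of nth_rcons => /orP[/eqP ->|ns]; first by rewrite ltnn eqxx e.
  by rewrite ns -h.
apply/seteqP; split=> x; last by case=> /ag [].
move=> sx; case E : (x (size s)); [right|left]; exact/ag.
Qed.

Lemma cylinder_disjoint (s : seq bool) :
  cylinder (rcons s false) `&` cylinder (rcons s true) = set0.
Proof.
apply/seteqP; split=> // x; rewrite /cylinder !size_rcons => -[/(_ (size s)) h /(_ (size s)) h'].
by move: (h (ltnSn _)) (h' (ltnSn _)); rewrite /bseq_of !nth_rcons ltnn eqxx => <-.
Qed.

(** The limits on cylinders are consistent and so define a probability [nu]. A set that depends on
    finitely many bits is a finite disjoint union of cylinders, to which the limit passes by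
    additivity; this is why the claim stops at [fdet] sets. *)
Lemma ultralimit_law : exists nu : probability (borel T) R,
  forall Z : set T, fdet Z -> (fun j => Q j Z) @ F --> fine (nu Z).
Proof.
have FF := @ultra_proper _ _ FU.
have /boolp.choice[p pP] (s : seq bool) : exists l : R, (fun j => Q j (cylinder s)) @ F --> l.
  by apply: ultra_cvg => j; rewrite law_ge0// law_le1.
have cvg_unique_ (u : nat -> R) (a b : R) : u @ F --> a -> u @ F --> b -> a = b.
  by move=> ua ub; rewrite -(cvg_lim _ ua)// -(cvg_lim _ ub).
have [||s|nu nuE] := @exists_cylinder_probability R p.
- move=> s; have cv := pP s.
  rewrite -(cvg_lim _ cv)//; apply: limr_ge; first by apply/cvg_ex; exists (p s).
  by apply: filterS filterT => j _; exact: law_ge0.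
- apply: cvg_unique_ (pP [::]) _; rewrite (_ : (fun _ => _) = fun=> 1); first exact: cvg_cst.
  by apply/funext => j; have [_ <- _] := Q_law j; congr (Q j _); apply/seteqP; split=> // x _ n.
- apply: cvg_unique_ (pP s) _.
  rewrite (_ : (fun _ => _) = (fun j => Q j (cylinder (rcons s false)) + Q j (cylinder (rcons s true)))).
    by apply: cvgD; exact: pP.
  apply/funext => j; have [_ _ QD] := Q_law j; rewrite cylinder_rcons QD//.
  exact: cylinder_disjoint.
exists nu.
(* Induction on the number [N] of bits beyond [s] on which [Z] depends, splitting [cylinder s] at
   its next bit. *)
have main N : forall s (Z : set T), (forall x y, agree (size s + N) x y -> Z x -> Z y) ->
    (fun j => Q j (cylinder s `&` Z)) @ F --> fine (nu (cylinder s `&` Z)).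
  elim: N => [|N IH] s Z hZ.
    have [[x [sx Zx]]|no] := pselect ((cylinder s `&` Z) !=set0).
      have -> : cylinder s `&` Z = cylinder s.
        apply/seteqP; split=> [y []//|y sy]; split=> //; apply: hZ Zx; rewrite addn0.
        by apply: agree_trans sy; apply: agree_sym.
      by rewrite nuE; exact: pP.
    have -> : cylinder s `&` Z = set0 by apply/seteqP; split=> // x h; apply: no; exists x.
    rewrite measure0 /= (_ : (fun _ => _) = fun=> 0); first exact: cvg_cst.
    by apply/funext => j; exact: law0.
  have dj : (cylinder (rcons s false) `&` Z) `&` (cylinder (rcons s true) `&` Z) = set0.
    by rewrite setIACA cylinder_disjoint set0I.
  have h b : (fun j => Q j (cylinder (rcons s b) `&` Z)) @ F --> fine (nu (cylinder (rcons s b) `&` Z)).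
    by apply: IH => x y; rewrite size_rcons addSnnS; exact: hZ.
  have mZ b : measurable ((cylinder (rcons s b) `&` Z) : set (borel T)).
    apply: fdet_measurable; apply: fdetI; first exact: fdet_agree.
    by exists (size s + N.+1)%N.
  rewrite cylinder_rcons setIUl measureU// fineD ?fin_num_measure//.
  rewrite (_ : (fun _ => _) = (fun j => Q j (cylinder (rcons s false) `&` Z) + Q j (cylinder (rcons s true) `&` Z))).
    by apply: cvgD; exact: h.
  by apply/funext => j; have [_ _ QD] := Q_law j; rewrite QD.
move=> Z [N hN]; have := main N [::] Z hN.
by rewrite (_ : cylinder [::] `&` Z = Z)//; apply/seteqP; split=> [x []//|x Zx]; split.
Qed.

End ultralimit.

(** * Graphings as ultralimits of labelled graphs *)

Section action_graph.
Variables (V : Type) (Lam : Type) (s : Lam -> V -> V).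

Definition act (w : seq Lam) (v : V) : V := foldl (fun x l => s l x) v w.

Definition action_edge (x y : V) : Prop := x <> y /\ exists l, y = s l x.

Lemma act_rcons w l v : act (rcons w l) v = s l (act w v).
Proof. by rewrite /act -cats1 foldl_cat. Qed.

Variable l0 : Lam.
Hypothesis s_l0 : forall v, s l0 v = v.

Lemma act_nseq r v : act (nseq r l0) v = v.
Proof. by elim: r => [//|r IH] /=; rewrite s_l0. Qed.

(** The letter [l0] acts trivially, so words of length exactly [r] account for shorter walks too. *)
Lemma gball_act (r : nat) (v x : V) :
  gball action_edge r v x <-> exists w : r.-tuple Lam, act w v = x.
Proof.
elim: r x => [|r IH] x.
  split=> [->|[w <-]]; first by exists [tuple].
  by rewrite tuple0.
split=> [[/IH[w <-]|[y /IH[w <-]] [_ [l ->]]]|[w <-]].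
- by exists [tuple of rcons w l0]; rewrite /= act_rcons s_l0.
- by exists [tuple of rcons w l]; rewrite /= act_rcons.
have [w' [l wE]] : exists (w' : r.-tuple Lam) l, tval w = rcons w' l.
  case: w => w /= sw; case/lastP: w sw => [//|w l].
  by rewrite size_rcons eqSS => sw; exists (Tuple sw), l.
rewrite wE act_rcons.
have [->|ne] := pselect (s l (act w' v) = act w' v).
  by left; apply/IH; exists w'.
right; exists (act w' v); first by apply/IH; exists w'.
by split; [move=> h; apply: ne|exists l].
Qed.

End action_graph.

Section pattern.
Variables (k r : nat) (Lam : finType) (l0 : Lam).

Definition pattern (V : Type) (s : Lam -> V -> V) (f : V -> 'I_k) (v : V) :
  {ffun r.+1.-tuple Lam * r.+1.-tuple Lam -> bool} * {ffun r.-tuple Lam -> 'I_k} :=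
  ([ffun w : r.+1.-tuple Lam * r.+1.-tuple Lam => `[< act s w.1 v = act s w.2 v >]],
   [ffun w : r.-tuple Lam => f (act s w v)]).

Variables (V V' : Type) (s : Lam -> V -> V) (s' : Lam -> V' -> V').
Hypotheses (s_l0 : forall v, s l0 v = v) (s'_l0 : forall v, s' l0 v = v).

(* The ball of radius r is the set of points reached by words of length r; its
   adjacency involves words of length r + 1. *)
Lemma pattern_ball_class (d : nat) (f : V -> 'I_k) (f' : V' -> 'I_k) (v : V) (v' : V')
    (u : U d r k) : pattern s f v = pattern s' f' v' ->
  ball_class (action_edge s) f v u -> ball_class (action_edge s') f' v' u.
Proof.
move=> [/ffunP pE /ffunP cE].
have eq1 (w w' : r.+1.-tuple Lam) : act s w v = act s w' v <-> act s' w v' = act s' w' v'.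
  have := pE (w, w'); rewrite !ffunE /= => h.
  by split=> e; apply/asboolP; [rewrite -h|rewrite h]; apply/asboolP.
have eq0 (w w' : r.-tuple Lam) l : act s w' v = act s (rcons w l) v <->
    act s' w' v' = act s' (rcons w l) v'.
  have := eq1 [tuple of rcons w' l0] [tuple of rcons w l].
  by rewrite /= !(act_rcons _ w') s_l0 s'_l0.
have eqr (w w' : r.-tuple Lam) : act s w v = act s w' v <-> act s' w v' = act s' w' v'.
  by have := eq0 w' w l0; rewrite !act_rcons s_l0 s'_l0.
have /boolp.choice[wd wdP] x : exists w : r.-tuple Lam,
    gball (action_edge s) r v x -> act s w v = x.
  have [/(gball_act s_l0)[w ew]|nx] := pselect (gball (action_edge s) r v x).
    by exists w.
  by exists [tuple of nseq r l0].
apply: (@ball_class_transport _ _ _ _ _ _ _ _ _ _ _ (fun x => act s' (wd x) v')).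
- split.
  + by move=> x xB; apply/(gball_act s'_l0); exists (wd x).
  + move=> x y; rewrite !inE => xB yB /eqr; by rewrite !wdP.
  + move=> y /(gball_act s'_l0)[w <-]; exists (act s w v).
      by apply/(gball_act s_l0); exists w.
    by apply/eqr; rewrite wdP//; apply/(gball_act s_l0); exists w.
- have /wdP e : gball (action_edge s) r v v by exact: gball_root.
  have /eqr : act s (wd v) v = act s [tuple of nseq r l0] v by rewrite e act_nseq.
  by rewrite act_nseq.
- move=> x y xB yB; rewrite -{1}(wdP x xB) -{1}(wdP y yB).
  split=> -[ne [l le]]; split.
  + by move=> /eqr h; apply: ne.
  + by exists l; move: le; rewrite -!act_rcons => /eq0.
  + by move=> h; apply: ne; apply/eqr.
  + by exists l; move: le; rewrite -!act_rcons => /eq0.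
- by move=> x xB; have := cE (wd x); rewrite !ffunE wdP.
Qed.

End pattern.

Section finitely_determined.
Variable R : realType.
Local Notation T := (bseq R).

(** Also used with [A] equal to [Prop], so that implications and equations between finitely
    determined functions fall under [fdetf_map2]. *)
Definition fdetf (A : Type) (f : T -> A) : Prop :=
  exists N, forall x y, agree N x y -> f x = f y.

Lemma fdetf_fdet (Z : set T) : fdetf Z -> fdet Z.
Proof. by move=> [N hN]; exists N => x y /hN ->. Qed.

Lemma fdet_fdetf (Z : set T) : fdet Z -> fdetf Z.
Proof.
move=> [N hN]; exists N => x y xy; apply/propext; split; apply: hN => //.
exact: agree_sym.
Qed.

Lemma fdetf_coord (n : nat) : fdetf (fun x => x n).
Proof. by exists n.+1 => x y; apply. Qed.

Lemma fdetf_cst (A : Type) (a : A) : fdetf (fun=> a).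
Proof. by exists 0%N. Qed.

Lemma fdetf_comp (A B : Type) (g : A -> B) (f : T -> A) : fdetf f -> fdetf (g \o f).
Proof. by move=> [N hN]; exists N => x y /hN /= ->. Qed.

Lemma fdetf_map2 (A B C : Type) (F : A -> B -> C) (f : T -> A) (g : T -> B) :
  fdetf f -> fdetf g -> fdetf (fun x => F (f x) (g x)).
Proof.
move=> [N hN] [M hM]; exists (maxn N M) => x y xy.
rewrite (hN x y) ?(hM x y)//; apply: agree_le xy; [exact: leq_maxr|exact: leq_maxl].
Qed.

Lemma fdetf_family (I : finType) (A : I -> Type) (f : forall i, T -> A i) :
  (forall i, fdetf (f i)) -> exists N, forall x y, agree N x y -> forall i, f i x = f i y.
Proof.
move=> /boolp.choice[N hN]; exists (\max_i N i) => x y xy i.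
by apply: hN; apply: agree_le xy; exact: leq_bigmax.
Qed.

Lemma fdetf_ffun (I : finType) (A : Type) (f : I -> T -> A) :
  (forall i, fdetf (f i)) -> fdetf (fun x => [ffun i => f i x]).
Proof.
move=> /fdetf_family[N hN]; exists N => x y /hN h; apply/ffunP => i; rewrite !ffunE; exact: h.
Qed.

Lemma fdetf_mkseq (A : Type) (m : nat) (f : nat -> T -> A) :
  (forall i, fdetf (f i)) -> fdetf (fun x => mkseq (f^~ x) m).
Proof.
move=> fi; have [N hN] := @fdetf_family 'I_m (fun=> A) f (fun i => fi i).
exists N => x y /hN h; apply/eq_in_map => i; rewrite mem_iota add0n /= => im.
exact: (h (Ordinal im)).
Qed.

(* Reindexing of coordinates; None yields the constant bit false. *)
Definition reindex_bits (phi : nat -> option nat) (x : T) : T :=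
  fun m => if phi m is Some m' then x m' else false.

Lemma fdetf_reindex (A : Type) (phi : nat -> option nat) (f : T -> A) :
  fdetf f -> fdetf (f \o reindex_bits phi).
Proof.
move=> [N hN]; exists (\max_(m < N) odflt 0 (omap S (phi m)))%N => x y xy /=.
apply: hN => m mN; rewrite /reindex_bits.
case E: (phi m) => [m'|//]; apply: xy.
by apply: leq_trans (leq_bigmax (Ordinal mN)); rewrite /= E.
Qed.

End finitely_determined.
Arguments fdetf_coord {R} n.
Arguments fdetf_cst {R A} a.

(* [h j t] colors the vertices of [G j] with [B t] colors; the coloring [kap]
   separates the neighbors of each vertex, so that words in its colors describe
   walks, and [sep r] separates the vertices of each ball of radius [r]. *)
Section label_system.
Variables (R : realType) (d : nat).
Variables (n : nat -> nat) (G : forall j, sgraph (n j)).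
Hypothesis degG : forall j, max_degree_le d (G j).
Variables (T0 : countType) (B : T0 -> nat) (h : forall j, T0 -> 'I_(n j) -> nat).
Arguments h : clear implicits.
Hypothesis hB : forall j t v, (h j t v < B t)%N.
Arguments hB : clear implicits.
Variables (kap : T0) (sep : nat -> T0).
Hypothesis kapP : forall j (u v w : 'I_(n j)), adj (G j) u v -> adj (G j) u w ->
  h j kap v = h j kap w -> v = w.
Hypothesis sepP : forall j r (u v w : 'I_(n j)),
  gball (adj (G j)) r u v -> gball (adj (G j)) r u w ->
  h j (sep r) v = h j (sep r) w -> v = w.

Local Notation Q := (B kap).
Local Notation Lam := (option 'I_Q).
Local Notation T := (bseq R).

(** By [kapP] at most one neighbor has color [c], so [pick] involves no choice; [None] is the
    trivial letter that pads walks. *)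
Definition gstep (j : nat) (l : Lam) (v : 'I_(n j)) : 'I_(n j) :=
  if l is Some c then odflt v [pick u | ((v, u) \in val (G j)) && (h j kap u == c)] else v.

Arguments gstep : clear implicits.

Lemma gstep_adj j c v : gstep j (Some c) v <> v ->
  adj (G j) v (gstep j (Some c) v) /\ h j kap (gstep j (Some c) v) = c.
Proof. by rewrite /gstep; case: pickP => //= u /andP[vu /eqP uc] _. Qed.

Lemma adj_gstep j (v u : 'I_(n j)) (c : 'I_Q) : adj (G j) v u -> h j kap u = c ->
  gstep j (Some c) v = u.
Proof.
move=> vu uc; rewrite /gstep; case: pickP => [w /andP[vw /eqP wc]|/(_ u)] /=.
  by apply: kapP vw vu _; rewrite wc uc.
by rewrite uc eqxx andbT; move: vu; rewrite /adj => ->.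
Qed.

Lemma adj_action_edge j : adj (G j) = action_edge (gstep j).
Proof.
apply/funext => v; apply/funext => u; apply/propext; split.
  move=> vu; split.
    by move=> e; move: vu; rewrite e; exact: adj_irrefl.
  by exists (Some (Ordinal (hB j kap u))); rewrite (adj_gstep vu).
move=> [ne [[c|] e]]; last by move: ne; rewrite e.
by rewrite e; have [] := @gstep_adj j c v; [rewrite -e => e'; apply: ne|].
Qed.

Lemma gstep_inv j (c c' : 'I_Q) v : h j kap v = c' -> gstep j (Some c) v <> v ->
  gstep j (Some c') (gstep j (Some c) v) = v.
Proof.
move=> vc' ne; have [a _] := gstep_adj ne; apply: adj_gstep => //; exact: adj_sym.
Qed.

Definition label_index := (seq Lam * T0 * nat)%type.

(** The bit with index [(w, t, c)] tells whether the end of the walk [w] has color [c] in the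
    coloring [t]. Prefixing a letter to the walk in every index realizes a step, which is what
    [shift] does. *)
Definition label (j : nat) (v : 'I_(n j)) : T := fun m =>
  if @unpickle label_index m is Some (w, t, c) then h j t (act (gstep j) w v) == c
  else false.

Definition shift_index (l : Lam) (m : nat) : option nat :=
  if @unpickle label_index m is Some (w, t, c) then Some (pickle ((l :: w, t, c) : label_index))
  else None.

Definition shift (l : Lam) : T -> T := reindex_bits (shift_index l).

Lemma shift_label l j v : shift l (label v) = label (gstep j l v).
Proof.
apply/funext => m; rewrite /shift /reindex_bits /shift_index /label.
by case: unpickle => [[[w t] c]|//]; rewrite pickleK.
Qed.

Lemma act_shift_label w j v : act shift w (label v) = label (act (gstep j) w v).
Proof. by elim: w v => [//|l w IH] v /=; rewrite shift_label IH. Qed.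

Lemma fdetf_act_shift (A : Type) (f : T -> A) (w : seq Lam) :
  fdetf f -> fdetf (fun x => f (act shift w x)).
Proof.
elim: w f => [//|l w IH] f ff; exact: fdetf_reindex (IH f ff).
Qed.

(** Decodes the color of the root from its unary bits. Labels give back the original coloring; a
    sequence with none of these bits set gives [B t]. *)
Definition hval (t : T0) (x : T) : nat :=
  index true (mkseq (fun c => x (pickle (([::], t, c) : label_index))) (B t)).

Lemma fdetf_hval t : fdetf (hval t).
Proof. by apply: fdetf_comp; apply: fdetf_mkseq => i; exact: fdetf_coord. Qed.

Lemma hval_label t j v : hval t (label v) = h j t v.
Proof.
rewrite /hval.
have -> : mkseq (fun c => label v (pickle (([::], t, c) : label_index))) (B t) =
    [seq h j t v == c | c <- iota 0 (B t)].
  by apply/eq_map => c; rewrite /label pickleK.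
have hh := hB j t v.
have nthE c : (c < B t)%N -> nth false [seq h j t v == c | c <- iota 0 (B t)] c = (h j t v == c).
  by move=> cB; rewrite (nth_map 0%N) ?size_iota// nth_iota.
apply/eqP; rewrite eqn_leq; apply/andP; split.
  rewrite leqNgt; apply/negP => /(before_find false).
  by rewrite nthE// eqxx.
rewrite leqNgt; apply/negP => lt.
have iB : (index true [seq h j t v == c | c <- iota 0 (B t)] < B t)%N by exact: ltn_trans hh.
have := nth_index false (s := [seq h j t v == c | c <- iota 0 (B t)]) (x := true).
rewrite -index_mem size_map size_iota => /(_ iB).
by rewrite nthE// => /eqP e; rewrite -e ltnn in lt.
Qed.

(* Closure of the set of labels: finitely determined properties of labels of
   graph vertices hold on it. *)
Definition label_closure : set T := [set x | forall N, exists j v, agree N x (@label j v)].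

Local Notation X0 := label_closure.

Lemma label_in_closure j v : X0 (@label j v).
Proof. by move=> N; exists j, v. Qed.

(** The transfer principle from graphs to the limit. An equation between points is first cut down to
    one coordinate, so that it depends on finitely many bits. *)
Lemma closure_ind (Z : T -> Prop) : fdetf Z -> (forall j v, Z (@label j v)) -> X0 `<=` Z.
Proof.
by move=> [N hN] ZL x /(_ N)[j [v xv]]; rewrite /= (hN _ _ xv).
Qed.

Lemma closure_ex (Z : T -> Prop) x : fdetf Z -> X0 x -> Z x -> exists j v, Z (@label j v).
Proof.
by move=> [N hN] /(_ N)[j [v xv]]; rewrite (hN _ _ xv); exists j, v.
Qed.

Lemma closure_shift l x : X0 x -> X0 (shift l x).
Proof.
move=> Xx N.
have [M hM] : exists M, forall y z, agree M y z -> agree N (shift l y) (shift l z).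
  have [M hM] := @fdetf_family R 'I_N (fun=> bool) (fun m y => shift l y m)
    (fun m => fdetf_reindex (shift_index l) (fdetf_coord m)).
  by exists M => y z /hM yz m mN; exact: (yz (Ordinal mN)).
have [j [v xv]] := Xx M; exists j, (gstep j l v); rewrite -shift_label; exact: hM.
Qed.

(** The graph properties of [shift] are available on [X0] only. Trivial steps elsewhere isolate the
    remaining points and give a graph on the whole Cantor space. *)
Definition ostep (l : Lam) (x : T) : T := if `[< X0 x >] then shift l x else x.

Lemma ostep_in l x : X0 x -> ostep l x = shift l x.
Proof. by rewrite /ostep => /asboolT ->. Qed.

Lemma ostep_out l x : ~ X0 x -> ostep l x = x.
Proof. by rewrite /ostep => /asboolF ->. Qed.

Lemma ostep_None x : ostep None x = x.
Proof.
have [Xx|nx] := pselect (X0 x); last exact: ostep_out.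
rewrite ostep_in//; apply/funext => m; move: x Xx.
apply: (@closure_ind (fun x => shift None x m = x m)).
  apply: fdetf_map2; last exact: fdetf_coord.
  exact: fdetf_reindex (fdetf_coord m).
by move=> j v; rewrite shift_label.
Qed.

Lemma closure_ostep l x : X0 x -> X0 (ostep l x).
Proof. by move=> Xx; rewrite ostep_in//; exact: closure_shift. Qed.

Lemma act_ostep_in w x : X0 x -> act ostep w x = act shift w x /\ X0 (act ostep w x).
Proof.
elim: w x => [//|l w IH] x Xx /=; have [h1 h2] := IH _ (closure_ostep l Xx).
by split=> //; rewrite h1 ostep_in.
Qed.

Lemma act_gball j w v r : (size w <= r)%N -> gball (adj (G j)) r v (act (gstep j) w v).
Proof.
move=> wr; apply: (gball_le wr); rewrite adj_action_edge.
by apply/(@gball_act _ _ _ None) => //; exists (in_tuple w).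
Qed.

(** Equality of two points involves infinitely many bits, but the ends of short walks are separated
    by the coloring [sep r], so on [X0] their equality becomes a finitely determined condition. *)
Lemma act_shift_eq r w w' x : (size w <= r)%N -> (size w' <= r)%N -> X0 x ->
  act shift w x = act shift w' x <->
  hval (sep r) (act shift w x) = hval (sep r) (act shift w' x).
Proof.
move=> wr w'r Xx; split=> [->//|e]; apply/funext => m; move: x Xx e.
apply: (@closure_ind (fun x =>
    hval (sep r) (act shift w x) = hval (sep r) (act shift w' x) ->
    act shift w x m = act shift w' x m)).
  apply: (fdetf_map2 (fun P Q : Prop => P -> Q)).
    by apply: fdetf_map2; apply: fdetf_act_shift; exact: fdetf_hval.
  by apply: fdetf_map2; apply: (fdetf_act_shift (f := fun x => x m)); exact: fdetf_coord.
move=> j v; rewrite !act_shift_label !hval_label => e.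
by rewrite (@sepP j r v _ _ (act_gball _ wr) (act_gball _ w'r) e).
Qed.

Lemma label_inj_ball j r (u v w : 'I_(n j)) :
  gball (adj (G j)) r u v -> gball (adj (G j)) r u w -> label v = label w -> v = w.
Proof.
by move=> uv uw e; apply: sepP uv uw _; rewrite -!hval_label e.
Qed.

Lemma ostep_label j l v : ostep l (@label j v) = label (gstep j l v).
Proof. by rewrite ostep_in ?shift_label//; exact: label_in_closure. Qed.

Lemma gstep_label_neq j l v : ostep l (@label j v) <> label v <-> gstep j l v <> v.
Proof.
rewrite ostep_label; split=> ne e; apply: ne; first by rewrite e.
apply: (@label_inj_ball j 1 v) e; last exact: gball_root.
exact: (@act_gball j [:: l]).
Qed.

Local Notation oedge := (action_edge ostep).

Lemma oedge_closure x y : oedge x y -> X0 x /\ X0 y.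
Proof.
move=> [ne [l e]]; have [Xx|nx] := pselect (X0 x).
  by split=> //; rewrite e; exact: closure_ostep.
by move: ne; rewrite e ostep_out.
Qed.

Lemma hval_kap_lt x : X0 x -> (hval kap x < Q)%N.
Proof.
move: x; apply: (@closure_ind (fun x => is_true (hval kap x < Q)%N)); last first.
  by move=> j v; rewrite hval_label.
apply: (fdetf_comp (fun a : nat => is_true (a < Q)%N)); exact: fdetf_hval.
Qed.

Lemma bseq_neqP (x y : T) : x <> y -> exists m, x m <> y m.
Proof.
move=> ne; apply: contrapT => no; apply: ne; apply/funext => m.
by apply: contrapT => nm; apply: no; exists m.
Qed.

Lemma hval_ostep (c : 'I_Q) x : ostep (Some c) x <> x -> hval kap (ostep (Some c) x) = c.
Proof.
have [Xx|nx] := pselect (X0 x); last by rewrite ostep_out.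
(* That the point moves is replaced by one bit [m] that witnesses it, which makes the implication
   finitely determined. *)
rewrite ostep_in// => /bseq_neqP[m]; move: x Xx.
apply: (@closure_ind (fun x => shift (Some c) x m <> x m -> hval kap (shift (Some c) x) = c)).
  apply: (fdetf_map2 (fun P Q : Prop => P -> Q)).
    by apply: (fdetf_map2 (fun a b : bool => a <> b)); [exact: fdetf_reindex (fdetf_coord m)|exact: fdetf_coord].
  by apply: fdetf_map2; [exact: fdetf_reindex (fdetf_hval kap)|exact: fdetf_cst].
move=> j v; rewrite shift_label hval_label => ne.
by have [] := @gstep_adj j c v; first by move=> e; apply: ne; rewrite e.
Qed.

(** A step is named by the color of its target, so the way back is named by the color of the
    origin. *)
Lemma ostep_inv (c c' : 'I_Q) x : hval kap x = c' -> ostep (Some c) x <> x ->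
  ostep (Some c') (ostep (Some c) x) = x.
Proof.
have [Xx|nx] := pselect (X0 x); last by move=> _; rewrite (ostep_out (Some c) nx).
rewrite (ostep_in _ (closure_ostep _ Xx)) (ostep_in (Some c) Xx) => xc' /bseq_neqP[m' ne].
apply/funext => m; move: x Xx xc' ne.
apply: (@closure_ind (fun x => hval kap x = c' -> shift (Some c) x m' <> x m' ->
   shift (Some c') (shift (Some c) x) m = x m)).
  apply: (fdetf_map2 (fun P Q : Prop => P -> Q)).
    by apply: fdetf_map2; [exact: fdetf_hval|exact: fdetf_cst].
  apply: (fdetf_map2 (fun P Q : Prop => P -> Q)).
    by apply: (fdetf_map2 (fun a b : bool => a <> b)); [exact: fdetf_reindex (fdetf_coord m')|exact: fdetf_coord].
  apply: fdetf_map2; last exact: fdetf_coord.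
  exact: (fdetf_act_shift [:: Some c; Some c'] (fdetf_coord m)).
move=> j v; rewrite hval_label !shift_label => vc' ne.
by rewrite gstep_inv// => e; apply: ne; rewrite e.
Qed.

Lemma oedge_sym x y : oedge x y -> oedge y x.
Proof.
move=> xy; have [Xx _] := oedge_closure xy; case: xy => ne [[c|] e]; last first.
  by move: ne; rewrite e ostep_None.
split; first by move=> yx; apply: ne.
exists (Some (Ordinal (hval_kap_lt Xx))); rewrite e ostep_inv//.
by rewrite -e => yx; apply: ne.
Qed.

Definition moving (x : T) : pred 'I_Q := fun c => `[< ostep (Some c) x <> x >].

(** For each moving color one bit shows the move. This finite pattern is shared by the label of some
    graph vertex, whose neighbors of these colors are distinct and number at most [d]. *)
Lemma card_moving x : (#|moving x| <= d)%N.
Proof.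
have [Xx|nx] := pselect (X0 x); last first.
  rewrite (_ : #|_| = 0%N)//; apply: eq_card0 => c; apply/negP => /asboolP.
  by rewrite ostep_out.
have /boolp.choice[m hm] (c : 'I_Q) : exists m, ostep (Some c) x <> x -> shift (Some c) x m <> x m.
  have [e|/bseq_neqP[m ne]] := pselect (ostep (Some c) x = x); first by exists 0%N.
  by exists m => _; rewrite -ostep_in.
pose Z y := [ffun c : 'I_Q => shift (Some c) y (m c) != y (m c)].
have ZF : fdetf Z.
  apply: fdetf_ffun => c; apply: (fdetf_map2 (fun a b : bool => a != b)); last exact: fdetf_coord.
  exact: fdetf_reindex (fdetf_coord (m c)).
have [j [v Zv]] : exists j v, (fun y => Z y = Z x) (@label j v).
  exact: (@closure_ex (fun y => Z y = Z x) x (fdetf_map2 (@eq _) ZF (fdetf_cst _)) Xx erefl).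
apply: (@leq_trans (degree (G j) v)); last by have /forallP := degG j; apply.
have inj : {in moving x &, injective (fun c => gstep j (Some c) v)}.
  have st c : c \in moving x -> gstep j (Some c) v <> v.
    move=> /asboolP /hm ne; have /ffunP/(_ c) := Zv; rewrite !ffunE => e ev.
    by move: e; rewrite shift_label ev eqxx => /esym/eqP /ne.
  move=> c c' cx c'x e; apply: val_inj => /=.
  have [_ <-] := gstep_adj (st _ cx); have [_ <-] := gstep_adj (st _ c'x).
  by rewrite e.
rewrite -(card_in_image inj) /degree; apply/subset_leq_card/fintype.subsetP => u /mapP[c].
rewrite mem_enum => /asboolP /hm ne ->; rewrite inE.
have [] // := @gstep_adj j c v => ev; have /ffunP/(_ c) := Zv; rewrite !ffunE => e.
by move: e; rewrite shift_label ev eqxx => /esym/eqP /ne.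
Qed.

Lemma ostep_inj x : {in moving x &, injective (fun c : 'I_Q => ostep (Some c) x)}.
Proof.
move=> c c' /asboolP cx /asboolP c'x e; apply: val_inj => /=.
by rewrite -(hval_ostep cx) -(hval_ostep c'x) e.
Qed.

Lemma oedge_moving x : [set y | oedge x y] = (fun c : 'I_Q => ostep (Some c) x) @` [set c | c \in moving x].
Proof.
apply/seteqP; split=> y.
  move=> [ne [[c|] e]]; last by move: ne; rewrite e ostep_None.
  by exists c => //; apply/asboolP; rewrite -e => yx; apply: ne.
by move=> [c /asboolP cx <-]; split; [move=> e; apply: cx|exists (Some c)].
Qed.

Lemma oedge_degree x : ([set y | oedge x y] #<= `I_d)%card.
Proof.
rewrite oedge_moving; apply: (card_le_trans (card_image_le _ _)).
have -> : [set c | c \in moving x] = (@enum_val _ (mem (moving x))) @` setT.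
  apply/seteqP; split=> [c cx|_ [i _ <-]]; last exact: enum_valP.
  by exists (enum_rank_in cx c) => //; rewrite enum_rankK_in.
apply: (card_le_trans (card_image_le _ _)).
apply: (@card_le_trans _ _ _ `I_#|moving x|); last by rewrite card_le_II card_moving.
by have := @card_II #|moving x|; rewrite card_eq_le => /andP[].
Qed.

Definition label_law (j : nat) (Z : set T) : R := unif_vertex R (@label j @^-1` Z).

Lemma label_law_law j : is_law (label_law j).
Proof. by apply: preimage_law; apply: unif_vertex_law; exact: sgraph_gt0 (G j). Qed.

Lemma measurable_fdetf (Z : set T) : fdetf Z -> measurable (Z : set (borel T)).
Proof. by move=> /fdetf_fdet; exact: fdet_measurable. Qed.

Lemma measurable_coord m : measurable ([set x | x m] : set (borel T)).
Proof.
apply: measurable_fdetf; apply: (fdetf_comp (fun b : bool => is_true b)).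
exact: fdetf_coord.
Qed.

Lemma fdetf_near_label N : fdetf (fun x : T => exists j v, agree N x (@label j v)).
Proof.
apply: fdet_fdetf; exists N => x y xy [j [v xv]]; exists j, v.
by apply: agree_trans xv; exact: agree_sym.
Qed.

Lemma closure_bigcap : X0 = \bigcap_N [set x | exists j v, agree N x (@label j v)].
Proof. by apply/seteqP; split=> x hx N; [move=> _|]; exact: hx. Qed.

Lemma measurable_closure : measurable (X0 : set (borel T)).
Proof.
rewrite closure_bigcap; apply: bigcapT_measurable => N.
apply: measurable_fdetf; exact: fdetf_near_label.
Qed.

Lemma measurable_ostep l : measurable_fun setT (ostep l : borel T -> borel T).
Proof.
apply: measurable_fdet_fun => m.
have -> : [set x : borel T | ostep l x m] =
   (X0 `&` [set x | shift l x m]) `|` (~` X0 `&` [set x | x m]).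
  apply/seteqP; split=> x /=.
    have [Xx|nx] := pselect (X0 x).
      by rewrite ostep_in// => hx; left.
    by rewrite ostep_out// => hx; right.
  by case=> -[Xx hx]; [rewrite ostep_in|rewrite ostep_out].
apply: measurableU; apply: measurableI.
- exact: measurable_closure.
- apply: measurable_fdetf; apply: (fdetf_comp (fun b : bool => is_true b)).
  exact: fdetf_reindex (fdetf_coord m).
- by apply: measurableC; exact: measurable_closure.
- exact: measurable_coord.
Qed.

Lemma measurable_ostep_preimage l (Z : set (borel T)) : measurable Z ->
  measurable (ostep l @^-1` Z : set (borel T)).
Proof. by move=> mZ; rewrite -[_ @^-1` _]setTI; exact: measurable_ostep. Qed.

Lemma measurable_act_ostep w (Z : set (borel T)) : measurable Z ->
  measurable ((fun x => act ostep w x) @^-1` Z : set (borel T)).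
Proof.
elim: w => [//|l w IH] mZ; exact: (measurable_ostep_preimage l (IH mZ)).
Qed.

Definition moved (c : 'I_Q) : set (borel T) := [set x | ostep (Some c) x <> x].

Lemma moved_closure c : moved c `<=` X0.
Proof. by move=> x mx; have [//|nx] := pselect (X0 x); case: mx; rewrite ostep_out. Qed.

(** The coloring [sep 1] separates a vertex from its neighbors, so on [X0] this finitely determined
    set can replace [moved c]. *)
Definition moved_fdet (c : 'I_Q) : set T :=
  [set x | hval (sep 1) (shift (Some c) x) <> hval (sep 1) x].

Lemma fdetf_moved_fdet c : fdetf (moved_fdet c).
Proof.
apply: (fdetf_map2 (fun a b : nat => a <> b)); last exact: fdetf_hval.
exact: fdetf_reindex (fdetf_hval _).
Qed.

Lemma moved_fdetE c x : X0 x -> moved c x <-> moved_fdet c x.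
Proof.
move=> Xx; rewrite /moved /moved_fdet /= ostep_in//.
by have := @act_shift_eq 1 [:: Some c] [::] x isT isT Xx => /= e; split=> hx /e.
Qed.

Lemma measurable_moved c : measurable (moved c).
Proof.
have -> : moved c = X0 `&` moved_fdet c.
  apply/seteqP; split=> [x mx|x [Xx]]; last by move/(moved_fdetE _ Xx).
  by have Xx := moved_closure mx; split=> //; apply/moved_fdetE.
apply: measurableI; first exact: measurable_closure.
by apply: measurable_fdetf; exact: fdetf_moved_fdet.
Qed.

Definition kolor (c : 'I_Q) : set T := [set x | hval kap x = c].

Lemma fdetf_kolor c : fdetf (kolor c).
Proof. by apply: (fdetf_comp (fun a : nat => a = c)); exact: fdetf_hval. Qed.

Lemma measurable_kolor c : measurable (kolor c : set (borel T)).
Proof. by apply: measurable_fdetf; exact: fdetf_kolor. Qed.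

Lemma measurable_oedge : measurable ([set xy | oedge xy.1 xy.2] : set (borel T * borel T)).
Proof.
have meq (A B' : set (borel T)) : measurable A -> measurable B' ->
    measurable ([set xy : borel T * borel T | A xy.1 <-> B' xy.2]).
  move=> mA mB; have -> : [set xy : borel T * borel T | A xy.1 <-> B' xy.2] =
      (A `*` B') `|` (~` A `*` ~` B').
    apply/seteqP; split=> -[x y] /=.
      move=> e; have [Ax|nA] := pselect (A x); first by left; split=> //; exact/e.
      by right; split=> // /e.
    by case=> -[h1 h2]; split.
  by apply: measurableU; apply: measurableX => //; exact: measurableC.
have biff (a b : bool) : (a <-> b) <-> a = b by split=> [e|->//]; apply/idP/idP => /e.
have -> : ([set xy | oedge xy.1 xy.2] : set (borel T * borel T)) =
  \bigcup_(l : Lam) ((\bigcup_m ~` [set xy : borel T * borel T | xy.1 m <-> xy.2 m]) `&`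
     \bigcap_m [set xy : borel T * borel T | ostep l xy.1 m <-> xy.2 m]).
  apply/seteqP; split=> -[x y] /=.
    move=> [/bseq_neqP[m ne] [l e]]; exists l => //; split.
      by exists m => //= /biff.
    by move=> m' _ /=; rewrite e.
  move=> [l _ [[m _ ne] e]]; split; first by move=> xy; case: ne; rewrite /= xy.
  by exists l; apply/funext => m'; apply/esym/biff; exact: (e m' I).
apply: countable_bigcupT_measurable => // l; apply: measurableI.
  apply: bigcupT_measurable => m; apply: measurableC.
  exact: (meq [set x : borel T | x m] [set x : borel T | x m]) (measurable_coord m) (measurable_coord m).
apply: bigcapT_measurable => m.
apply: (meq (ostep l @^-1` [set x : borel T | x m]) [set x : borel T | x m]); last exact: measurable_coord.
by apply: measurable_ostep_preimage; exact: measurable_coord.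
Qed.

(** Distinct moving colors lead to distinct neighbors, so neighbors can be counted by color. *)
Lemma counting_oedge (x : T) (A : set (borel T)) :
  counting ([set y : borel T | oedge x y] `&` A) =
  (\sum_(c : 'I_Q) (\1_(moved c `&` ostep (Some c) @^-1` A) x)%:E)%E :> \bar R.
Proof.
pose P := [pred c | (c \in moving x) && `[< A (ostep (Some c) x) >]].
pose S := [set y : borel T | oedge x y] `&` A.
have SE : S = (fun i => ostep (Some (@enum_val _ (mem P) i)) x) @` setT.
  apply/seteqP; split=> y.
    rewrite /S oedge_moving => -[[c cx <-] Ac].
    have cP : c \in P by rewrite inE; apply/andP; split=> //; exact/asboolP.
    by exists (enum_rank_in cP c) => //; rewrite enum_rankK_in.
  move=> [i _ <-]; have := enum_valP i; rewrite inE => /andP[h1 /asboolP h2].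
  by split=> //; rewrite oedge_moving; exists (enum_val i).
have cS : (S #= `I_#|P|)%card.
  rewrite SE; apply: card_eq_trans (card_esym card_II).
  apply: inj_card_eq => i i' _ _ /ostep_inj e; apply: enum_val_inj; apply: e.
    by have := enum_valP i; rewrite inE => /andP[].
  by have := enum_valP i'; rewrite inE => /andP[].
rewrite -/S /counting asboolT; last by apply/finite_setP; exists #|P|.
rewrite (card_fset_set cS) -sum1_card natr_sum big_mkcond -sumEFin.
apply: eq_bigr => c _; rewrite indicE inE; congr (_%:E).
case: (boolP (c \in moving x)) => [cx|cx] /=.
  case: asboolP => Ac; first by rewrite mem_set//; split=> //; exact/asboolP.
  by rewrite memNset// => -[_].
by rewrite memNset// => -[mx _]; move/negP: cx; apply; exact/asboolP.
Qed.

(** * Ball classes in the limit *)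

Section balls.
Variables (r k : nat).

(** The coincidence part of [pattern], with equality of points tested by the coloring [sep r.+1] to
    make it finitely determined. *)
Definition eq_pattern (x : T) : {ffun r.+1.-tuple Lam * r.+1.-tuple Lam -> bool} :=
  [ffun w : r.+1.-tuple Lam * r.+1.-tuple Lam =>
    hval (sep r.+1) (act shift w.1 x) == hval (sep r.+1) (act shift w.2 x)].

Lemma fdetf_eq_pattern : fdetf eq_pattern.
Proof.
apply: fdetf_ffun => w; apply: (fdetf_map2 (fun a b : nat => a == b));
  apply: fdetf_act_shift; exact: fdetf_hval.
Qed.

Lemma eq_patternE x w : X0 x ->
  eq_pattern x w = `[< act ostep w.1 x = act ostep w.2 x >].
Proof.
move=> Xx; rewrite ffunE (act_ostep_in w.1 Xx).1 (act_ostep_in w.2 Xx).1.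
have e := @act_shift_eq r.+1 w.1 w.2 x; rewrite !size_tuple leqnn in e.
by apply/eqP/asboolP => hx; apply/(e isT isT Xx).
Qed.

Lemma eq_pattern_label j v w :
  eq_pattern (@label j v) w = `[< act (gstep j) w.1 v = act (gstep j) w.2 v >].
Proof.
rewrite ffunE !act_shift_label !hval_label; apply/eqP/asboolP => [e|->//].
by apply: sepP e; apply: act_gball; rewrite size_tuple.
Qed.

Variable f : T -> 'I_k.

Definition closure_pattern (x : T) :=
  (eq_pattern x, [ffun w : r.-tuple Lam => f (act shift w x)]).

Lemma closure_patternE x : X0 x -> closure_pattern x = pattern r ostep f x.
Proof.
move=> Xx; congr pair; apply/ffunP => w; first by rewrite eq_patternE// ffunE.
by rewrite !ffunE (act_ostep_in w Xx).1.
Qed.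

Lemma fdetf_closure_pattern : fdetf f -> fdetf closure_pattern.
Proof.
move=> ff; apply: (fdetf_map2 pair); first exact: fdetf_eq_pattern.
by apply: fdetf_ffun => w; exact: fdetf_act_shift.
Qed.

Lemma pattern_label j v :
  pattern r ostep f (@label j v) = pattern r (gstep j) (fun u => f (label u)) v.
Proof.
rewrite -closure_patternE; last exact: label_in_closure.
congr pair; apply/ffunP => w; first by rewrite eq_pattern_label ffunE.
by rewrite !ffunE act_shift_label.
Qed.

(** A graph vertex with the same coincidences as [x] supplies the ball: a vertex reached by a word
    gets the value of [f] at the end of the same word from [x]. A point off the closure is isolated
    and has the class of a one-vertex graph. *)
Lemma oball_ex x : exists u : U d r k, ball_class oedge f x u.
Proof.
have [Xx|nx] := pselect (X0 x).
  have [j [v jv]] : exists j v, (fun y => eq_pattern y = eq_pattern x) (@label j v).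
    exact: (@closure_ex (fun y => eq_pattern y = eq_pattern x) x
      (fdetf_map2 (@eq _) fdetf_eq_pattern (fdetf_cst _)) Xx erefl).
  have eqw (w w' : r.-tuple Lam) : act (gstep j) w v = act (gstep j) w' v ->
      act ostep w x = act ostep w' x.
    move=> e; have /ffunP/(_ ([tuple of rcons w None], [tuple of rcons w' None])) := jv.
    rewrite eq_pattern_label eq_patternE//= !act_rcons !ostep_None /= e asboolT//.
    by move=> /esym/asboolP.
  have /boolp.choice[wd wdP] u : exists w : r.-tuple Lam,
      (exists w' : r.-tuple Lam, act (gstep j) w' v = u) -> act (gstep j) w v = u.
    have [[w uw]|nu] := pselect (exists w' : r.-tuple Lam, act (gstep j) w' v = u).
      by exists w.
    by exists [tuple of nseq r None].
  have [u hu] := ball_class_ex (degG j) r (fun u => f (act ostep (wd u) x)) v.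
  exists u; rewrite adj_action_edge in hu; move: hu.
  apply: (@pattern_ball_class k r _ None) => //; first exact: ostep_None.
  congr pair; apply/ffunP => w.
    by have /ffunP/(_ w) := jv; rewrite eq_pattern_label eq_patternE// !ffunE.
  by rewrite !ffunE; congr f; apply: eqw; apply: wdP; exists w.
have one : is_sgraph (finset.set0 : {set 'I_1 * 'I_1}).
  by apply/and3P; split=> //; apply/forallP => i; rewrite ?inE//; apply/forallP => ?; rewrite !inE.
pose H1 : sgraph 1 := exist (fun E => is_true (is_sgraph E)) _ one.
have deg1 : max_degree_le d H1.
  apply/forallP => i; rewrite /degree (_ : #|_| = 0%N)//.
  by apply: eq_card0 => u; rewrite !inE.
have [u hu] := ball_class_ex deg1 r (fun=> f x) ord0.
exists u; move: hu.
have -> : adj H1 = action_edge (fun (_ : Lam) v => v).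
  apply/funext => a; apply/funext => b; apply/propext; split; first by rewrite /adj inE.
  by move=> [ne [l e]]; case: ne.
have out w : act ostep w x = x.
  by elim: w => [//|l w IH] /=; rewrite ostep_out.
have out1 (w : seq Lam) : act (fun (_ : Lam) (v : 'I_1) => v) w ord0 = ord0.
  by elim: w.
apply: (@pattern_ball_class k r _ None) => //; first exact: ostep_None.
by congr pair; apply/ffunP => w; rewrite !ffunE ?out ?out1 //; apply/asboolP/asboolP.
Qed.

Lemma oball_pattern x y u : pattern r ostep f x = pattern r ostep f y ->
  ball_class oedge f x u -> @ball_class d r k _ oedge f y u.
Proof.
move=> e; apply: (@pattern_ball_class k r _ None) => //; exact: ostep_None.
Qed.

Hypothesis mf : forall c, measurable (f @^-1` [set c] : set (borel T)).

Lemma measurable_pattern p : measurable ([set x | pattern r ostep f x = p] : set (borel T)).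
Proof.
have m1 (w w' : seq Lam) : measurable ([set x | act ostep w x = act ostep w' x] : set (borel T)).
  have -> : [set x : T | act ostep w x = act ostep w' x] =
      \bigcap_m (((fun x => act ostep w x) @^-1` [set y : T | y m] `&`
         (fun x => act ostep w' x) @^-1` [set y : T | y m]) `|`
        (~` ((fun x => act ostep w x) @^-1` [set y : T | y m]) `&`
         ~` ((fun x => act ostep w' x) @^-1` [set y : T | y m]))).
    apply/seteqP; split=> x.
      by move=> e m _; rewrite /= e; case: (act _ _ _ _); [left|right].
    move=> e; apply/funext => m; have /= := e m I.
    by case: (act _ w x m); case: (act _ w' x m) => //; case=> -[].
  have pm v m : measurable ((fun x => act ostep v x) @^-1` [set y : T | y m] : set (borel T)).
    by apply: measurable_act_ostep; exact: measurable_coord.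
  apply: bigcapT_measurable => m; apply: measurableU; apply: measurableI.
  - exact: pm.
  - exact: pm.
  - by apply: measurableC; exact: pm.
  - by apply: measurableC; exact: pm.
have -> : [set x : T | pattern r ostep f x = p] =
    (\bigcap_(w in [set: r.+1.-tuple Lam * r.+1.-tuple Lam])
       [set x | `[< act ostep w.1 x = act ostep w.2 x >] = p.1 w]) `&`
    (\bigcap_(w in [set: r.-tuple Lam]) ((fun x => act ostep w x) @^-1` (f @^-1` [set p.2 w]))).
  apply/seteqP; split=> [x <-|x [h1 h2]].
    by split=> w _ /=; rewrite ffunE.
  rewrite [p]surjective_pairing; congr pair; apply/ffunP => w; rewrite ffunE; [exact: (h1 w)|exact: (h2 w)].
apply: measurableI; apply: fin_bigcap_measurable => //; try exact: finite_finset.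
  move=> w _; case: (p.1 w).
    rewrite (_ : [set x | _] = [set x : T | act ostep w.1 x = act ostep w.2 x])//.
    by apply/seteqP; split=> x /=; [move=> hx; apply/asboolP; rewrite hx|move=> hx; apply/asboolP].
  rewrite (_ : [set x | _] = ~` [set x : T | act ostep w.1 x = act ostep w.2 x]); last first.
    by apply/seteqP; split=> x /= => [/asboolPn|/asboolPn/negbTE].
  exact: measurableC.
by move=> w _; apply: measurable_act_ostep; exact: mf.
Qed.

(** The class is a function of the pattern, which takes finitely many values, each on a measurable
    set. *)
Lemma measurable_class (c : T -> U d r k) (A : set (U d r k)) :
  (forall x, ball_class oedge f x (c x)) -> measurable (c @^-1` A : set (borel T)).
Proof.
move=> cE.
have -> : c @^-1` A = \bigcup_(p in [set p | exists x, pattern r ostep f x = p /\ A (c x)])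
    [set x | pattern r ostep f x = p].
  apply/seteqP; split=> x.
    by move=> Ax; exists (pattern r ostep f x) => //; exists x.
  move=> [_ [y [<- Ay]] /= xy]; rewrite /= (_ : c x = c y)//.
  by apply: ball_class_uniq (cE x) _; apply: oball_pattern (cE y).
apply: fin_bigcup_measurable; first exact: finite_finset.
by move=> p _; exact: measurable_pattern.
Qed.

End balls.

(** * The limit law and its graphing *)

Section limit_law.
Variables (F : set_system nat) (FU : UltraFilter F) (nu : probability (borel T) R).
Hypothesis nuP : forall Z : set T, fdet Z -> (fun j => label_law j Z) @ F --> fine (nu Z).

Lemma nu_fdet_eq (Z Z' : set T) : fdetf Z -> fdetf Z' ->
  (forall j, label_law j Z = label_law j Z') -> nu Z = nu Z'.
Proof.
move=> fZ fZ' e; have mZ := measurable_fdetf fZ; have mZ' := measurable_fdetf fZ'.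
rewrite -(fineK (fin_num_measure nu _ mZ)) -(fineK (fin_num_measure nu _ mZ')); congr (_%:E).
have FF := @ultra_proper _ _ FU.
rewrite -(cvg_lim _ (nuP (fdetf_fdet fZ)))// -(cvg_lim _ (nuP (fdetf_fdet fZ')))//.
by rewrite (_ : (fun j => label_law j Z) = (fun j => label_law j Z'))//; apply/funext => j; exact: e.
Qed.

(** All graph labels lie in each set of the intersection [closure_bigcap], so the complement of each
    set is null in the limit, and there are countably many. *)
Lemma nu_closureC : nu (~` X0) = 0%E.
Proof.
apply: measure_negligible; first by apply: measurableC; exact: measurable_closure.
rewrite closure_bigcap setC_bigcap; apply: negligible_bigcup => N.
have fZ := fdetf_near_label N; set Z := [set x | _] in fZ *.
apply/negligibleP; first by apply: measurableC; exact: measurable_fdetf.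
transitivity (nu set0); last exact: measure0.
apply: (@nu_fdet_eq (~` Z) set0); [by apply: fdet_fdetf; apply: fdetC; exact: fdetf_fdet|exact: fdetf_cst|].
move=> j; congr (unif_vertex R _); apply/seteqP; split=> // v /= nZ; apply: nZ.
by exists j, v.
Qed.

Lemma nu_closure_eq (A A' : set (borel T)) : measurable A -> measurable A' ->
  A `&` X0 = A' `&` X0 -> nu A = nu A'.
Proof.
move=> mA mA' e.
have hZ Z : measurable Z -> nu Z = nu (Z `&` X0).
  move=> mZ; rewrite -[in LHS](setUIDK Z X0) measureU//.
  - rewrite [X in (_ + X)%E](_ : _ = 0%E) ?adde0//; apply/eqP; rewrite -measure_le0.
    rewrite -nu_closureC le_measure ?inE//.
    + by apply: measurableD => //; exact: measurable_closure.
    + by apply: measurableC; exact: measurable_closure.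
  - by apply: measurableI => //; exact: measurable_closure.
  - by apply: measurableD => //; exact: measurable_closure.
  - by apply/seteqP; split=> // x [[_ Xx] []].
by rewrite (hZ A)// (hZ A')// e.
Qed.

Definition mover (c' c : 'I_Q) : set (borel T) := kolor c' `&` moved c.

Lemma measurable_mover c' c : measurable (mover c' c).
Proof. by apply: measurableI; [exact: measurable_kolor|exact: measurable_moved]. Qed.

(* A step along color c is inverted by a step along the color of the origin,
   so it preserves the measure. *)
Lemma nu_step_fdet (c c' : 'I_Q) (Z : set T) : fdetf Z ->
  nu (mover c' c `&` ostep (Some c) @^-1` Z) = nu (Z `&` mover c c').
Proof.
move=> fZ; have fZ' := fdetf_reindex (shift_index (Some c)) fZ.
have fS a b : fdetf (kolor a `&` moved_fdet b).
  by apply: (fdetf_map2 and); [exact: fdetf_kolor|exact: fdetf_moved_fdet].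
have f1 : fdetf ((kolor c' `&` moved_fdet c) `&` shift (Some c) @^-1` Z).
  by apply: (fdetf_map2 and); [exact: fS|exact: fZ'].
have f2 : fdetf (Z `&` (kolor c `&` moved_fdet c')).
  by apply: (fdetf_map2 and); [exact: fZ|exact: fS].
transitivity (nu ((kolor c' `&` moved_fdet c) `&` shift (Some c) @^-1` Z)).
  apply: nu_closure_eq.
  - apply: measurableI; first exact: measurable_mover.
    by apply: measurable_ostep_preimage; exact: measurable_fdetf.
  - exact: measurable_fdetf.
  apply/seteqP; split=> x [[[h1 h2] h3] Xx]; split=> //; move: h3; rewrite /= ostep_in// => h3;
    split=> //; split=> //; exact/(moved_fdetE _ Xx).
transitivity (nu (Z `&` (kolor c `&` moved_fdet c'))); last first.
  apply: nu_closure_eq.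
  - exact: measurable_fdetf.
  - by apply: measurableI; [exact: measurable_fdetf|exact: measurable_mover].
  by apply/seteqP; split=> x [[h1 [h2 h3]] Xx]; split=> //; split=> //; split=> //;
    exact/(moved_fdetE _ Xx).
apply: nu_fdet_eq => // j; rewrite /label_law /unif_vertex; congr (_%:R / _).
have mvE b v : moved_fdet b (@label j v) <-> gstep j (Some b) v <> v.
  rewrite -gstep_label_neq; split; [move/moved_fdetE|move=> ?; apply/moved_fdetE => //];
    [by apply; exact: label_in_closure|exact: label_in_closure].
rewrite -(@card_in_image _ _ (gstep j (Some c))).
  apply: eq_card => u; rewrite [RHS]inE; apply/mapP/asboolP => [[v]|].
    rewrite mem_enum inE => -[[h1 h2_] h3_] ->.
    have h3 : Z (label (gstep j (Some c) v)) by rewrite -shift_label; exact: h3_.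
    have h2 := (mvE c v).1 h2_.
    rewrite /kolor /= hval_label in h1.
    split=> //; split; first by rewrite /kolor /= hval_label; have [] := gstep_adj h2.
    by apply: (mvE c' _).2; rewrite (gstep_inv h1 h2) => e; apply: h2.
  move=> [h1 [h2 h3_]]; have h3 := (mvE c' u).1 h3_; rewrite /kolor /= hval_label in h2.
  exists (gstep j (Some c') u); last by rewrite gstep_inv.
  rewrite mem_enum inE; split=> /=; last by rewrite shift_label gstep_inv.
  split; first by rewrite /kolor /= hval_label; have [] := gstep_adj h3.
  by apply: (mvE c _).2; rewrite (gstep_inv h2 h3) => e; apply: h3.
move=> v w; rewrite !inE => -[[h1 /(mvE c v).1 h2] _] [[k1 /(mvE c w).1 k2] _] e.
rewrite /kolor /= hval_label in h1; rewrite /kolor /= hval_label in k1.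
by rewrite -[LHS](gstep_inv h1 h2) -[RHS](gstep_inv k1 k2) e.
Qed.

(** Both sides are finite measures in [Z] that agree on [fdet], a class stable under intersections
    that generates the Borel sets. *)
Lemma nu_step (c c' : 'I_Q) (Z : set (borel T)) : measurable Z ->
  nu (mover c' c `&` ostep (Some c) @^-1` Z) = nu (Z `&` mover c c').
Proof.
pose m1 : {measure set (borel T) -> \bar R} :=
  measure_function_pushforward__canonical__measure_function_Measure
    (mrestr nu (measurable_mover c' c)) (measurable_ostep (Some c)).
pose m2 : {measure set (borel T) -> \bar R} := mrestr nu (measurable_mover c c').
have m12 A : fdetf (A : set T) -> m1 A = m2 A.
  by move=> fA; rewrite /m1 /m2 /= /pushforward /mrestr setIC; exact: nu_step_fdet.
move=> mZ; rewrite setIC; suff : m1 Z = m2 Z by [].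
apply: (@measure_unique _ _ (borel T) (@fdet R) (fun=> setT) (borel_fdetE R) _ _ _ m1 m2) => //.
- by move=> A A'; exact: fdetI.
- by move=> _; exact: fdetT.
- by apply/seteqP; split=> // x _; exists 0%N.
- by move=> A fA; apply: m12; exact: fdet_fdetf.
- move=> _; have mT : measurable (mover c' c) by exact: measurable_mover.
  have -> : m1 setT = nu (mover c' c) by rewrite /m1 /= /pushforward /mrestr preimage_setT setTI.
  by rewrite (le_lt_trans (probability_le1 nu mT))// ltry.
Qed.

Lemma nu_moved_sum (c : 'I_Q) (W : set (borel T)) : measurable W ->
  nu (moved c `&` W) = (\sum_(c' : 'I_Q) nu (mover c' c `&` W))%E.
Proof.
move=> mW.
have mF c' : measurable (mover c' c `&` W) by apply: measurableI => //; exact: measurable_mover.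
have tF : trivIset setT (fun c' => mover c' c `&` W).
  apply/trivIsetP => a b _ _ ab; apply/seteqP; split=> // x [[[ha _] _] [[hb _] _]].
  by move/eqP: ab; apply; apply: val_inj; rewrite /= -ha -hb.
have -> : moved c `&` W = \bigcup_c' (mover c' c `&` W).
  apply/seteqP; split=> [x [mx Wx]|x [c' _ [[_ mx] Wx]]] //.
  exists (Ordinal (hval_kap_lt (moved_closure mx))) => //.
have eT : [set: 'I_Q] = [set` enum 'I_Q].
  by apply/seteqP; split=> c' //= _; rewrite mem_enum.
rewrite measure_fin_bigcup; [|exact: finite_finset|exact: tF|by move=> c' _; exact: mF].
by rewrite eT -fsbig_seq ?enum_uniq// big_enum.
Qed.

Lemma integral_counting_oedge (A A' : set (borel T)) : measurable A -> measurable A' ->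
  (\int[nu]_(x in A) counting ([set y : borel T | oedge x y] `&` A') =
   \sum_(c : 'I_Q) nu (moved c `&` (ostep (Some c) @^-1` A' `&` A)))%E.
Proof.
move=> mA mA'.
under eq_integral do rewrite counting_oedge.
have mE c : measurable (moved c `&` ostep (Some c) @^-1` A').
  by apply: measurableI; [exact: measurable_moved|exact: measurable_ostep_preimage].
rewrite ge0_integral_sum//.
  by apply: eq_bigr => c _; rewrite integral_indic// setIA.
by move=> c; apply/measurable_EFinP; exact: measurable_indic.
Qed.

(** Directed edges from [A] to [A'] are sorted by the colors [c'] of the origin and [c] of the
    target. Reversal exchanges the two colors and preserves [nu] by [nu_step]. *)
Lemma oedge_unimodular (A A' : set (borel T)) : measurable A -> measurable A' ->
  (\int[nu]_(x in A) counting ([set y : borel T | oedge x y] `&` A') =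
   \int[nu]_(x in A') counting ([set y : borel T | oedge x y] `&` A))%E.
Proof.
move=> mA mA'; rewrite !integral_counting_oedge//.
have mW c (X Y : set (borel T)) : measurable X -> measurable Y -> measurable (ostep (Some c) @^-1` X `&` Y : set (borel T)).
  by move=> mX mY; apply: measurableI => //; exact: measurable_ostep_preimage.
rewrite (eq_bigr _ (fun c _ => nu_moved_sum c (mW c _ _ mA' mA))).
rewrite [RHS](eq_bigr _ (fun c _ => nu_moved_sum c (mW c _ _ mA mA'))).
rewrite exchange_big; apply: eq_bigr => c _; apply: eq_bigr => c' _ /=.
have mZ : measurable (A' `&` ostep (Some c) @^-1` A) by rewrite setIC; exact: mW.
have -> : ostep (Some c) @^-1` A `&` A' = A' `&` ostep (Some c) @^-1` A by rewrite setIC.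
rewrite [in RHS]setIC -(nu_step c' c mZ); congr (nu _).
apply/seteqP; split=> x [[h1 h2]] /=.
  by move=> [h3 h4]; split=> //; split=> //; rewrite (ostep_inv h1 h2).
by move=> [h3]; rewrite (ostep_inv h1 h2) => h4; split.
Qed.

Definition limit_graphing : graphing R d :=
  @Graphing R d (bseq R) (@bseq_hausdorff R) (@bseq_separable R) nu
    [set xy | oedge xy.1 xy.2] measurable_oedge (fun x xx => xx.1 erefl)
    (fun x y => @oedge_sym x y) oedge_degree oedge_unimodular.

Lemma near_forall_seq (I : eqType) (s : seq I) (P : I -> nat -> Prop) :
  (forall i, F (P i)) -> F [set j | forall i, i \in s -> P i j].
Proof.
have FF := @ultra_proper _ _ FU; move=> hP; elim: s => [|i s IH].
  by apply: filterS filterT.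
apply: filterS2 (hP i) IH => j h1 h2 i'; rewrite inE => /orP[/eqP ->//|].
exact: h2.
Qed.

Definition nuR (A : set T) : R := fine (nu A).

Lemma nuR_ge0 A : 0 <= nuR A.
Proof. by rewrite /nuR fine_ge0. Qed.

Lemma nuRE (A : set (borel T)) : measurable A -> nu A = (nuR A)%:E.
Proof. by move=> mA; rewrite /nuR fineK// fin_num_measure. Qed.

Lemma nuR_le (A A' : set (borel T)) : measurable A -> measurable A' -> A `<=` A' ->
  nuR A <= nuR A'.
Proof.
by move=> mA mA' AA'; rewrite -lee_fin -!nuRE//; apply: le_measure; rewrite ?inE.
Qed.

Lemma nuRD (A A' : set (borel T)) : measurable A -> measurable A' -> A `&` A' = set0 ->
  nuR (A `|` A') = nuR A + nuR A'.
Proof. by move=> mA mA' AA'; rewrite /nuR measureU// fineD// fin_num_measure. Qed.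

Lemma nuR_U (A A' : set (borel T)) : measurable A -> measurable A' ->
  nuR (A `|` A') <= nuR A + nuR A'.
Proof.
move=> mA mA'; have -> : A `|` A' = A `|` (A' `\` A).
  apply/seteqP; split=> x; last by case=> [|[]]; [left|right].
  by have [Ax _|nA [|]] := pselect (A x); [left|left|right].
have mD : measurable (A' `\` A) by exact: measurableD.
rewrite nuRD// ?lerD2l; first by apply: nuR_le => // x [].
by apply/seteqP; split=> // x [? []].
Qed.

Lemma nuR_bigU (I : eqType) (s : seq I) (A : I -> set (borel T)) : (forall i, measurable (A i)) ->
  measurable [set x | exists2 i, i \in s & A i x] /\
  nuR [set x | exists2 i, i \in s & A i x] <= \sum_(i <- s) nuR (A i).
Proof.
move=> mA; elim: s => [|i s [mS IH]].
  have -> : [set x | exists2 i, i \in [::] & A i x] = set0.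
    by apply/seteqP; split=> // x [].
  by split; [exact: measurable0|rewrite big_nil /nuR measure0].
have -> : [set x | exists2 j, j \in i :: s & A j x] = A i `|` [set x | exists2 j, j \in s & A j x].
  apply/seteqP; split=> x.
    by move=> [j]; rewrite inE => /orP[/eqP ->|js] Aj; [left|right; exists j].
  by case=> [Ai|[j js Aj]]; [exists i; rewrite ?mem_head|exists j; rewrite // inE js orbT].
split; first exact: measurableU.
by rewrite big_cons; apply: (le_trans (nuR_U _ _)) => //; rewrite lerD2l.
Qed.

Lemma nuR_dist_le (A A' Z : set (borel T)) : measurable A -> measurable A' -> measurable Z ->
  A `<=` A' `|` Z -> A' `<=` A `|` Z -> `|nuR A - nuR A'| <= nuR Z.
Proof.
move=> mA mA' mZ s1 s2.
have l1 := le_trans (nuR_le mA (measurableU _ _ mA' mZ) s1) (nuR_U mA' mZ).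
have l2 := le_trans (nuR_le mA' (measurableU _ _ mA mZ) s2) (nuR_U mA mZ).
by rewrite ler_norml; apply/andP; split; lra.
Qed.

Lemma measurable_law (X : Type) (c : T -> X) : (forall A, measurable (c @^-1` A : set (borel T))) ->
  is_law (fun A => nuR (c @^-1` A)).
Proof.
move=> mc; split=> [A||A A' AA'].
- exact: nuR_ge0.
- by rewrite preimage_setT /nuR probability_setT.
- by rewrite preimage_setU nuRD// -preimage_setI AA' preimage_set0.
Qed.

Definition measurable_coloring (k : nat) (f : T -> 'I_k) : Prop :=
  forall c, measurable (f @^-1` [set c] : set (borel T)).

Lemma fdetf_measurable_coloring k (f : T -> 'I_k) : fdetf f -> measurable_coloring f.
Proof.
move=> ff c; apply: measurable_fdetf.
exact: (fdetf_map2 (@eq _) ff (fdetf_cst c)).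
Qed.

Definition limit_color_law (r k : nat) (f : T -> 'I_k) : set (U d r k) -> R :=
  color_law oedge nuR f.

Definition graph_color_law_of (r k : nat) (j : nat) (f : 'I_(n j) -> 'I_k) : set (U d r k) -> R :=
  color_law (adj (G j)) (@unif_vertex R (n j)) f.

Lemma limit_color_lawP r k (f : T -> 'I_k) : measurable_coloring f ->
  is_law (@limit_color_law r k f).
Proof.
move=> mf; have /boolp.choice[c cE] := fun x => @oball_ex r k f x.
rewrite (_ : limit_color_law f = fun A => nuR (c @^-1` A)).
  by apply: measurable_law => A; exact: measurable_class mf _ _ cE.
by apply/funext => A; exact: color_law_preimage.
Qed.

Lemma fdetf_color_law_cvg r k (f : T -> 'I_k) (A : set (U d r k)) : fdetf f ->
  (fun j => @graph_color_law_of r k j (fun v => f (label v)) A) @ F --> limit_color_law f A.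
Proof.
move=> ff; have /boolp.choice[c cE] := fun x => @oball_ex r k f x.
have mf := fdetf_measurable_coloring ff.
(* [Z] asks for some point with class in [A] whose pattern is the one computed from finitely many
   bits of [x]. On the closure, and in particular on graph labels, this is the event that the class
   of [x] lies in [A]. *)
pose Z : set T := [set x | exists y, pattern r ostep f y = closure_pattern r f x /\ A (c y)].
have fZ : fdetf Z.
  apply: (fdetf_comp (fun p => exists y, pattern r ostep f y = p /\ A (c y))).
  exact: fdetf_closure_pattern.
have ZE x : X0 x -> Z x <-> A (c x).
  move=> Xx; split; last by move=> Ax; exists x; rewrite closure_patternE.
  move=> [y [e Ay]]; rewrite (_ : c x = c y)//.
  apply: ball_class_uniq (cE x) _; apply: oball_pattern (cE y).
  by rewrite e closure_patternE.
have -> : limit_color_law f A = fine (nu Z).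
  rewrite /limit_color_law (color_law_preimage _ _ cE) /nuR; congr fine.
  apply: nu_closure_eq; [exact: measurable_class mf _ _ cE|exact: measurable_fdetf|].
  by apply/seteqP; split=> x [h1 Xx]; split=> //; exact/(ZE _ Xx).
rewrite (_ : (fun j => _) = fun j => label_law j Z); first by apply: nuP; exact: fdetf_fdet.
apply/funext => j; rewrite /graph_color_law_of.
have cjE v : @ball_class d r k _ (adj (G j)) (fun v => f (label v)) v (c (label v)).
  rewrite adj_action_edge; apply: (@pattern_ball_class k r _ None) (cE (label v)) => //.
    exact: ostep_None.
  exact: pattern_label.
rewrite (color_law_preimage _ _ cjE) /label_law; congr (unif_vertex R _).
by apply/seteqP; split=> v h1; apply/(ZE _ (label_in_closure v)).
Qed.

Lemma fdetf_color_law_near r k (f : T -> 'I_k) (e : R) : fdetf f -> 0 < e ->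
  F [set j | dTV (@graph_color_law_of r k j (fun v => f (label v))) (limit_color_law f) <= e].
Proof.
move=> ff e0; have FF := @ultra_proper _ _ FU.
have [m [piece dTVm]] := dTV_pieces R (@U_finite d r k).
have m0 : 0 < m.+1%:R :> R by rewrite ltr0n.
pose e' := e / m.+1%:R; have e'0 : 0 < e' by rewrite divr_gt0.
have near_i (i : 'I_m) : F [set j | `|@graph_color_law_of r k j (fun v => f (label v)) (piece i) -
    limit_color_law f (piece i)| <= e'].
  have /cvgrPdist_le /(_ e' e'0) := @fdetf_color_law_cvg r k f (piece i) ff.
  by apply: filterS => j /=; rewrite distrC.
have := near_forall_seq (enum 'I_m) near_i.
apply: filterS => j hj; apply: (@le_trans _ _ (m%:R * e')).
  apply: dTVm; [exact: graph_color_law|exact: limit_color_lawP (fdetf_measurable_coloring ff)|exact: ltW|].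
  by move=> i; apply: hj; rewrite mem_enum.
rewrite /e' mulrA ler_pdivrMr// mulrC ler_pM2l// -natr1; lra.
Qed.

Definition symdiff (A A' : set T) : set T := (A `\` A') `|` (A' `\` A).

Lemma measurable_symdiff (A A' : set (borel T)) : measurable A -> measurable A' ->
  measurable (symdiff A A' : set (borel T)).
Proof. by move=> mA mA'; apply: measurableU; apply: measurableD. Qed.

(** The sets with this property form a sigma-algebra containing [fdet]; countable unions reduce to
    finite ones by continuity of [nu] from below. *)
Lemma fdet_approx (A : set (borel T)) : measurable A ->
  forall e : R, 0 < e -> exists C : set T, fdet C /\ nuR (symdiff A C) <= e.
Proof.
pose appr := [set A : set (borel T) | measurable A /\
  forall e : R, 0 < e -> exists C : set T, fdet C /\ nuR (symdiff A C) <= e].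
suff : @measurable _ (borel T) `<=` appr by move=> sub mA; have [] := sub _ mA.
have apprU A1 A2 : appr A1 -> appr A2 -> appr (A1 `|` A2).
  move=> [m1 h1] [m2 h2]; split; first exact: measurableU.
  move=> e e0; have e2 : 0 < e / 2 by rewrite divr_gt0.
  have [C1 [f1 n1]] := h1 _ e2; have [C2 [f2 n2]] := h2 _ e2.
  exists (C1 `|` C2); split; first exact: fdetU.
  have mC1 := fdet_measurable f1; have mC2 := fdet_measurable f2.
  have s1 := measurable_symdiff m1 mC1; have s2 := measurable_symdiff m2 mC2.
  apply: (@le_trans _ _ (nuR (symdiff A1 C1 `|` symdiff A2 C2))).
    apply: nuR_le; [apply: measurable_symdiff; exact: measurableU|exact: measurableU|].
    move=> x [[a na]|[a na]].
      have [n1' n2'] : ~ C1 x /\ ~ C2 x by split=> cx; apply: na; [left|right].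
      by case: a => ax; [left|right]; left.
    have [n1' n2'] : ~ A1 x /\ ~ A2 x by split=> cx; apply: na; [left|right].
    by case: a => ax; [left|right]; right.
  apply: (le_trans (nuR_U s1 s2)); lra.
rewrite borel_fdetE; apply: smallest_sub; last first.
  move=> C fC; split; first exact: fdet_measurable.
  move=> e e0; exists C; split=> //.
  by rewrite /symdiff setDv setU0 /nuR measure0 ltW.
split.
- split; first exact: measurable0.
  move=> e e0; exists set0; split; first exact: fdet0.
  by rewrite /symdiff setDv setU0 /nuR measure0 ltW.
- move=> A1 [m1 h1]; rewrite setTD; split; first exact: measurableC.
  move=> e /h1[C [fC nC]]; exists (~` C); split; first exact: fdetC.
  by rewrite (_ : symdiff _ _ = symdiff A1 C)// /symdiff !setDE !setCK setUC (setIC C) (setIC (~` C)).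
- suff big (A1 : nat -> set (borel T)) : (forall i, appr (A1 i)) -> appr (\bigcup_i A1 i).
    by move=> A1 h1; exact: big.
  move=> h1; have m1 i : measurable (A1 i) by have [] := h1 i.
  have mU : measurable (\bigcup_i A1 i) by exact: bigcupT_measurable.
  split=> // e e0; have e2 : 0 < e / 2 by rewrite divr_gt0.
  pose D N := \big[setU/set0]_(i < N) A1 i.
  have apprD N : appr (D N).
    rewrite /D; elim: N => [|N IH].
      rewrite big_ord0; split; first exact: measurable0.
      move=> e1 e10; exists set0; split; first exact: fdet0.
      by rewrite /symdiff setDv setU0 /nuR measure0 ltW.
    by rewrite big_ord_recr /=; apply: apprU.
  have mD N : measurable (D N) by have [] := apprD N.
  have DU N : D N `<=` \bigcup_i A1 i.
    by rewrite /D -bigcup_mkord => x [i _ Ax]; exists i.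
  have cvD : nu (D N) @[N --> \oo] --> nu (\bigcup_i A1 i).
    have -> : \bigcup_i A1 i = \bigcup_N D N.
      apply/seteqP; split=> [x [i _ Ax]|x [N _ Dx]]; last exact: DU Dx.
      by exists i.+1 => //; rewrite /D -bigcup_mkord; exists i => /=.
    apply: nondecreasing_cvg_mu => //; first exact: bigcupT_measurable.
    apply/nondecreasing_seqP => N; rewrite subsetEset /D big_ord_recr /=; exact: subsetUl.
  have cvR : nuR (D N) @[N --> \oo] --> nuR (\bigcup_i A1 i).
    by apply: fine_cvg; rewrite fineK ?fin_num_measure.
  have /cvgrPdist_le /(_ _ e2) [N _ /(_ N (leqnn N)) /= close] := cvR.
  have [C [fC nC]] := (apprD N).2 _ e2.
  exists C; split=> //; have mC := fdet_measurable fC.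
  have mR : measurable (\bigcup_i A1 i `\` D N) by exact: measurableD.
  have sub : symdiff (\bigcup_i A1 i) C `<=` (\bigcup_i A1 i `\` D N) `|` symdiff (D N) C.
    move=> x [[ax nc]|[cx na]].
      by have [dx|nd] := pselect (D N x); [right; left|left].
    by right; right; split=> // /DU.
  have mS := measurable_symdiff (mD N) mC.
  apply: (le_trans (nuR_le (measurable_symdiff mU mC) (measurableU _ _ mR mS) sub)).
  apply: (le_trans (nuR_U mR mS)).
  have : nuR (\bigcup_i A1 i) = nuR (D N) + nuR (\bigcup_i A1 i `\` D N).
    by rewrite -nuRD ?setDUK//; apply/seteqP; split=> // x [? []].
  move: close; rewrite ler_norml => /andP[_]; move: (nuR _) (nuR (D N)) (nuR _ ) => a b c *; lra.
Qed.

(** Each color class is approximated up to [e / k] by a set [C c], and [f'] takes a color whose set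
    contains the point. Where [f'] differs from [f], some [C c] is wrong about the point. *)
Lemma coloring_approx k (f : T -> 'I_k) (e : R) : (0 < k)%N -> measurable_coloring f -> 0 < e ->
  exists2 f' : T -> 'I_k, fdetf f' &
    measurable ([set x | f x <> f' x] : set (borel T)) /\ nuR [set x | f x <> f' x] <= e.
Proof.
move=> k0 mf e0; have kR : 0 < k%:R :> R by rewrite ltr0n.
have ek : 0 < e / k%:R by rewrite divr_gt0.
have /boolp.choice[C hC] c := fdet_approx (mf c) ek.
have fC c : fdetf (fun x => `[< C c x >]).
  by apply: (fdetf_comp (fun P : Prop => `[< P >])); apply: fdet_fdetf; have [] := hC c.
pose f' x : 'I_k := odflt (Ordinal k0) [pick c | [ffun c => `[< C c x >]] c].
have ff' : fdetf f'.
  apply: (fdetf_comp (fun p : {ffun 'I_k -> bool} => odflt (Ordinal k0) [pick c | p c])).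
  exact: fdetf_ffun.
have mS c : measurable (symdiff (f @^-1` [set c]) (C c) : set (borel T)).
  by apply: measurable_symdiff; [exact: mf|by apply: fdet_measurable; have [] := hC c].
have mD : measurable ([set x | f x <> f' x] : set (borel T)).
  have -> : [set x | f x <> f' x] = \bigcup_(c in [set: 'I_k]) (f @^-1` [set c] `&` ~` (f' @^-1` [set c])).
    by apply/seteqP; split=> [x ne|x [c _ [/= -> ne]]]; [exists (f x) => //; split=> // e1; apply: ne|move=> e1; apply: ne].
  apply: fin_bigcup_measurable; first exact: finite_finset.
  move=> c _; apply: measurableI; first exact: mf.
  by apply: measurableC; exact: (fdetf_measurable_coloring ff').
exists f' => //; split=> //.
have [mB le] := nuR_bigU (enum 'I_k) mS.
apply: (@le_trans _ _ (nuR [set x | exists2 c, c \in enum 'I_k & symdiff (f @^-1` [set c]) (C c) x])).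
  apply: nuR_le => // x ne; apply: contrapT => no; apply: ne.
  have eqC c : `[< C c x >] = (f x == c).
    apply/asboolP/eqP => [Cx|fx]; apply: contrapT => nn; apply: no; exists c; rewrite ?mem_enum//.
      by right; split.
    by left; split.
  rewrite /f'; case: pickP => [c|/(_ (f x))] /=; rewrite ffunE eqC; first by move/eqP.
  by rewrite eqxx.
apply: (le_trans le); rewrite big_enum.
apply: (@le_trans _ _ (\sum_(c : 'I_k) e / k%:R)).
  by apply: ler_sum => c _; have [] := hC c.
by rewrite sumr_const card_ord -[leLHS]mulr_natl mulrCA divff ?mulr1// gt_eqF.
Qed.

(** A point sent into [D] either stays, and then lies in [D], or moves. The moving ones are split by
    their own color into [Q] sets, each carried into [D] with its measure preserved. *)
Lemma nuR_step_bound l (D : set (borel T)) : measurable D ->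
  nuR (ostep l @^-1` D) <= Q.+1%:R * nuR D.
Proof.
move=> mD; have D0 := nuR_ge0 D; case: l => [c|]; last first.
  rewrite (_ : _ @^-1` _ = D) ?ler_peMl ?ler1n//.
  by apply/seteqP; split=> x /=; rewrite ostep_None.
have mo := measurable_ostep_preimage (Some c) mD.
have mM : measurable (moved c `&` ostep (Some c) @^-1` D).
  by apply: measurableI => //; exact: measurable_moved.
apply: (@le_trans _ _ (nuR (D `|` (moved c `&` ostep (Some c) @^-1` D)))).
  apply: nuR_le => //; first exact: measurableU.
  move=> x /= Dx; have [e|ne] := pselect (ostep (Some c) x = x); first by left; rewrite -e.
  by right.
apply: (le_trans (nuR_U mD mM)); rewrite -natr1 addrC mulrDl mul1r lerD2r.
rewrite -lee_fin -nuRE// nu_moved_sum//.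
apply: (@le_trans _ _ (\sum_(c' : 'I_Q) nu D)%E).
  apply: lee_sum => c' _; rewrite nu_step//; apply: le_measure; rewrite ?inE//.
  by apply: measurableI => //; exact: measurable_mover.
rewrite nuRE// sumEFin lee_fin sumr_const card_ord mulr_natl; exact: lexx.
Qed.

Lemma nuR_act_bound w (D : set (borel T)) : measurable D ->
  nuR ((fun x => act ostep w x) @^-1` D) <= Q.+1%:R ^+ size w * nuR D.
Proof.
move=> mD; elim: w => [|l w IH] /=; first by rewrite expr0 mul1r.
have := nuR_step_bound l (measurable_act_ostep w mD).
rewrite exprS -mulrA => le; apply: (le_trans le); rewrite ler_pM2l//.
Qed.

(** The class at [x] can change only if some word of length [r] leads from [x] into the set where
    the colorings differ; [nuR_act_bound] handles each word. *)
Lemma limit_color_law_dist r k (f f' : T -> 'I_k) (e : R) :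
  measurable_coloring f -> measurable_coloring f' ->
  measurable ([set x | f x <> f' x] : set (borel T)) -> nuR [set x | f x <> f' x] <= e ->
  dTV (@limit_color_law r k f) (limit_color_law f') <=
    #|{: r.-tuple Lam}|%:R * (Q.+1%:R ^+ r * e).
Proof.
move=> mf mf' mD le.
have /boolp.choice[c cE] := fun x => @oball_ex r k f x.
have /boolp.choice[c' cE'] := fun x => @oball_ex r k f' x.
pose S (w : r.-tuple Lam) := (fun x => act ostep w x) @^-1` [set x | f x <> f' x].
have mS w : measurable (S w : set (borel T)) by exact: measurable_act_ostep.
have [mB leB] := nuR_bigU (enum {: r.-tuple Lam}) mS.
have Sle : nuR [set x | exists2 i, i \in enum {: r.-tuple Lam} & S i x] <=
    #|{: r.-tuple Lam}|%:R * (Q.+1%:R ^+ r * e).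
  apply: (le_trans leB); rewrite big_enum.
  apply: (@le_trans _ _ (\sum_(w : r.-tuple Lam) Q.+1%:R ^+ r * e)); last first.
    by rewrite sumr_const mulr_natl.
  apply: ler_sum => w _; apply: (le_trans (nuR_act_bound w mD)).
  by rewrite size_tuple ler_pM2l// exprn_gt0.
apply: dTV_le => A; apply: le_trans Sle.
rewrite /limit_color_law (color_law_preimage _ _ cE) (color_law_preimage _ _ cE').
have eqc x : ~ (exists2 i, i \in enum {: r.-tuple Lam} & S i x) -> c x = c' x.
  move=> no; apply: ball_class_uniq (cE x) _.
  apply: (@pattern_ball_class k r _ None) (cE' x); [exact: ostep_None|exact: ostep_None|].
  congr pair; apply/ffunP => w; rewrite !ffunE; apply: contrapT => ne; apply: no.
  by exists w; [rewrite mem_enum|move=> e1; apply: ne].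
apply: nuR_dist_le => //; [exact: measurable_class mf _ _ cE|exact: measurable_class mf' _ _ cE'| |].
  move=> x /= Ax; have [ex|/eqc ecc] := pselect (exists2 i, i \in enum {: r.-tuple Lam} & S i x); first by right.
  by left; rewrite /= -ecc.
move=> x /= Ax; have [ex|/eqc ecc] := pselect (exists2 i, i \in enum {: r.-tuple Lam} & S i x); first by right.
by left; rewrite /= ecc.
Qed.

Lemma coloring_law_approx r k (f : T -> 'I_k) (e : R) : (0 < k)%N -> measurable_coloring f -> 0 < e ->
  exists2 f' : T -> 'I_k, fdetf f' & dTV (@limit_color_law r k f) (limit_color_law f') <= e.
Proof.
move=> k0 mf e0.
pose M : R := #|{: r.-tuple Lam}|.+1%:R * Q.+1%:R ^+ r.
have M0 : 0 < M by rewrite mulr_gt0 ?exprn_gt0// ltr0n.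
have eM : 0 < e / M by rewrite divr_gt0.
have [f' ff' [mD le]] := coloring_approx k0 mf eM.
exists f' => //.
have dle := @limit_color_law_dist r k f f' _ mf (fdetf_measurable_coloring ff') mD le.
apply: le_trans dle _; rewrite mulrA; apply: (@le_trans _ _ (M * (e / M))); last by rewrite mulrCA divff ?mulr1// gt_eqF.
by rewrite ler_pM2r// ler_pM2r ?exprn_gt0 ?ltr0n// ler_nat.
Qed.

(** One finite list [ts] serves all [j], so that a single set of the ultrafilter controls all its
    colorings. *)
Hypothesis netP : forall (r k : nat) (e : R), 0 < e -> exists ts : seq T0,
  forall j (f : 'I_(n j) -> 'I_k.+1), exists2 t, t \in ts &
    dTV (@graph_color_law_of r k.+1 j f) (@graph_color_law_of r _ j (fun v => inord (h j t v))) <= e.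

Local Notation Qlimit := (@Qgraphing R d limit_graphing).

Lemma Qlimit_law_family r k : (0 < k)%N -> law_family (Qlimit r k).
Proof.
move=> k0; split.
  exists (limit_color_law (fun=> Ordinal k0)), (fun=> Ordinal k0) => //.
  by apply: fdetf_measurable_coloring; exact: fdetf_cst.
by move=> _ [f mf <-]; exact: limit_color_lawP.
Qed.

(** A graph coloring is close to one of the net, which the limit carries as [hval t]. Conversely, a
    coloring of the limit is close in law to one of finitely many finitely determined
    representatives [rep a], which color the graphs through [label]. Only finitely many conditions
    on [j] arise. *)
Lemma hausdorff_near r k (e : R) : (0 < k)%N -> 0 < e ->
  F [set j | hausdorff_dist (@dTV R _) (Qgraph R d (G j) r k) (Qlimit r k) <= e].
Proof.
move=> k0 e0; have FF := @ultra_proper _ _ FU.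
case: k k0 => // k _; have e4 : 0 < e / 4 by rewrite divr_gt0.
have [ts tsP] := netP r k e4.
have near1 (t : T0) : F [set j | dTV (@graph_color_law_of r _ j (fun v => inord (h j t v) : 'I_k.+1))
    (limit_color_law (fun x => inord (hval t x))) <= e / 4].
  have ff : fdetf (fun x => inord (hval t x) : 'I_k.+1).
    by apply: (fdetf_comp (fun a : nat => inord a : 'I_k.+1)); exact: fdetf_hval.
  have := fdetf_color_law_near r ff e4; apply: filterS => j /=.
  by under eq_fun do rewrite hval_label.
have [K [key keyP]] := law_key (@U_finite d r k.+1) e4.
have /boolp.choice[rep repP] (a : K) : exists f' : T -> 'I_k.+1, fdetf f' /\
    forall f, measurable_coloring f -> key (limit_color_law f) = a ->
      dTV (@limit_color_law r k.+1 f) (limit_color_law f') <= e / 4 + e / 4.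
  have [[f [mf fa]]|no] := pselect (exists f : T -> 'I_k.+1, measurable_coloring f /\ key (limit_color_law f) = a).
    have [f' ff' df'] := coloring_law_approx r (ltn0Sn k) mf e4.
    exists f'; split=> // g mg ga.
    apply: (le_trans (dTV_triangle (mu2 := limit_color_law f) _ _ _)); [exact: limit_color_lawP..| |].
      by apply: limit_color_lawP; exact: fdetf_measurable_coloring.
    apply: lerD => //; apply: keyP; [exact: limit_color_lawP..|by rewrite ga].
  by exists (fun=> ord0); split; [exact: fdetf_cst|move=> f mf fa; case: no; exists f].
have near2 (a : K) : F [set j | dTV (@graph_color_law_of r _ j (fun v => rep a (label v)))
    (limit_color_law (rep a)) <= e / 4].
  by apply: fdetf_color_law_near => //; have [] := repP a.
apply: filterS2 (near_forall_seq ts near1) (near_forall_seq (enum K) near2) => j h1 h2 /=.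
have e42 : e / 4 + e / 4 <= e by lra.
have e43 : e / 4 + e / 4 + e / 4 <= e by lra.
apply: hausdorff_le; [exact: Qgraph_proper|exact: Qlimit_law_family| |].
- move=> _ [f _ <-]; have [t tts ft] := tsP j f.
  have ff : fdetf (fun x => inord (hval t x) : 'I_k.+1).
    by apply: (fdetf_comp (fun a : nat => inord a : 'I_k.+1)); exact: fdetf_hval.
  exists (limit_color_law (fun x => inord (hval t x))).
    by exists (fun x => inord (hval t x)) => //; exact: fdetf_measurable_coloring.
  apply: le_trans e42; apply: le_trans (lerD ft (h1 t tts)).
  apply: dTV_triangle; [exact: graph_color_law|exact: graph_color_law|].
  by apply: limit_color_lawP; exact: fdetf_measurable_coloring.
- move=> _ [f mf <-]; have [ff fP] := repP (key (limit_color_law f)).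
  exists (@graph_color_law_of r _ j (fun v => rep (key (limit_color_law f)) (label v))).
    by exists (fun v => rep (key (limit_color_law f)) (label v)).
  rewrite dTV_sym; apply: le_trans e43.
  have hK : key (limit_color_law f) \in enum K by rewrite mem_enum.
  have h2' := h2 _ hK; rewrite /= dTV_sym in h2'.
  apply: le_trans (lerD (fP f mf erefl) h2').
  apply: dTV_triangle; [exact: limit_color_lawP| |exact: graph_color_law].
  by apply: limit_color_lawP; exact: fdetf_measurable_coloring.
Qed.

Lemma Qlimit_proper : proper_qfamily Qlimit.
Proof. by move=> r k k0; exact: Qlimit_law_family. Qed.

Lemma dCN_near (e : R) : 0 < e -> F [set j | dCN (Qgraph R d (G j)) Qlimit < e].
Proof.
move=> e0; have FF := @ultra_proper _ _ FU.
have [K [e' e'0 small]] := dCN_small d e0.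
have nearrk (rk : nat * nat) : F [set j | (0 < rk.2)%N ->
    hausdorff_dist (@dTV R _) (Qgraph R d (G j) rk.1 rk.2) (Qlimit rk.1 rk.2) <= e'].
  have [k0|k0] := posnP rk.2; first by apply: filterS filterT => j _.
  by have := hausdorff_near rk.1 k0 e'0; apply: filterS => j /=.
apply: filterS (near_forall_seq [seq (a, b) | a <- iota 0 K.+1, b <- iota 0 K.+1] nearrk).
move=> j hj; apply: small; [exact: Qgraph_proper|exact: Qlimit_proper|].
move=> r k r0 k0 rK kK; apply: (hj (r, k)) => //.
by apply/allpairsP; exists (r, k); rewrite !mem_iota !add0n !ltnS.
Qed.

End limit_law.

End label_system.

(** * Separating colorings and nets of colorings *)

Lemma greedy_coloring (V : finType) (e : rel V) (D : nat) :
  symmetric e -> (forall v, #|[pred u | e v u]| <= D)%N ->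
  exists c : V -> nat, (forall v, (c v < D.+1)%N) /\
    forall u v, e u v -> c u = c v -> u = v.
Proof.
move=> es eD.
have [c [cD cP]] : exists c : V -> nat, (forall v, (c v < D.+1)%N) /\
    forall u v, u \in enum V -> v \in enum V -> e u v -> c u = c v -> u = v.
  elim: (enum V) => [|x s [c [cD cP]]]; first by exists (fun=> 0%N).
  pose used := [seq c u | u <- enum [pred u | e x u]].
  have [i iD iu] : exists2 i, (i < D.+1)%N & i \notin used.
    apply: contrapT => no; have := uniq_leq_size (iota_uniq 0 D.+1) (s2 := used).
    rewrite size_iota size_map -cardE ltnNge eD => /(_ _)/negP; apply; last by [].
    move=> i; rewrite mem_iota add0n => /andP[_ iD]; apply: contrapT => /negP ni.
    by apply: no; exists i.
  exists (fun v => if v == x then i else c v); split=> [v|u v].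
    by case: ifP.
  have nx w : e x w -> i <> c w.
    by move=> xw iw; move: iu; rewrite iw map_f// mem_enum inE.
  rewrite !inE; case: (eqVneq u x) => [->|ux]; case: (eqVneq v x) => [->|vx] //=.
  - by move=> _ _ /nx.
  - by move=> _ _; rewrite es => /nx ne /esym.
  - exact: cP.
by exists c; split=> // u v; apply: cP; rewrite mem_enum.
Qed.

Lemma gball_trans (V : Type) (e : V -> V -> Prop) (r s : nat) (u v w : V) :
  gball e r u v -> gball e s v w -> gball e (r + s) u w.
Proof.
move=> uv; elim: s w => [|s IH] w; first by move=> /= ->; rewrite addn0.
rewrite addnS => -[/IH h|[z /IH h zw]]; first by left.
by right; exists z.
Qed.

(** Two vertices of a ball of radius [r] are within distance [r + r], so it suffices to color
    greedily the graph that joins vertices at that distance. *)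
Lemma separating_coloring (d n : nat) (G : sgraph n) (r : nat) : max_degree_le d G ->
  exists c : 'I_n -> nat, (forall v, (c v < (d.+1 ^ (r + r)).+1)%N) /\
    forall u v w, gball (adj G) r u v -> gball (adj G) r u w -> c v = c w -> v = w.
Proof.
move=> dG; have gs s a b : gball (adj G) s a b -> gball (adj G) s b a.
  by apply: gball_sym; exact: adj_sym.
have [|v|c [cD cP]] := @greedy_coloring 'I_n (fun v w => gballb G (r + r) v w) (d.+1 ^ (r + r)).
- by move=> v w; apply/asboolP/asboolP; exact: gs.
- exact: card_gball dG (r + r) v.
exists c; split=> // u v w uv uw; apply: cP; apply/asboolP.
by apply: gball_trans uw; exact: gs.
Qed.

Section representation.
Variables (R : realType) (d : nat) (a : nat -> Xgraph d).
Let n j := tag (a j).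
Let G j : sgraph (n j) := val (tagged (a j)).
Let degG j : max_degree_le d (G j) := valP (tagged (a j)).

(** For each key a coloring with that key is chosen in every graph that has one, so the size of the
    net is the number of keys, whatever the graph. Natural numbers as indices make the colorings a
    countable family. *)
Lemma coloring_net (r k : nat) (e : R) : 0 < e ->
  exists p : nat * (forall j, nat -> 'I_(n j) -> nat),
    (forall j i v, (p.2 j i v < k.+1)%N) /\
    forall j (f : 'I_(n j) -> 'I_k.+1), exists2 i, (i < p.1)%N &
      dTV (@graph_color_law_of R d n G r k.+1 j f)
          (graph_color_law_of R G (fun v => inord (p.2 j i v))) <= e.
Proof.
move=> e0; have [K [key keyP]] := law_key (@U_finite d r k.+1) e0.
pose law j := @graph_color_law_of R d n G r k.+1 j.
have ex j i : exists g : 'I_(n j) -> 'I_k.+1,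
    forall f : 'I_(n j) -> 'I_k.+1, enum_rank (key (law _ f)) = i :> nat ->
      enum_rank (key (law _ g)) = i :> nat.
  have [[g gi]|no] := pselect (exists g, enum_rank (key (law j g)) = i :> nat); first by exists g.
  by exists (fun=> ord0) => f fi; case: no; exists f.
pose c j i := projT1 (cid (ex j i)).
exists (#|K|, fun j i v => nat_of_ord (c j i v)); split=> [j i v|j f] /=; first exact: ltn_ord.
exists (enum_rank (key (law j f))); first exact: ltn_ord.
apply: keyP; [exact: graph_color_law (degG j)|exact: graph_color_law (degG j)|].
have := projT2 (cid (ex j (enum_rank (key (law j f))))) f erefl.
rewrite -/(c _ _) => /ord_inj/enum_rank_inj E; rewrite -[LHS]E; congr key; congr (law j _).
by apply/funext => v; rewrite inord_val.
Qed.

Lemma graphing_ultralimit (F : set_system nat) : UltraFilter F ->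
  exists g : graphing R d, proper_qfamily (Qgraphing g) /\
    forall e : R, 0 < e -> F [set j | dCN (Qgraph R d (G j)) (Qgraphing g) < e].
Proof.
move=> FU.
pose SC j r := cid (separating_coloring r (degG j)).
have e0 m : 0 < m.+1%:R^-1 :> R by rewrite invr_gt0.
pose NT (x : nat * nat * nat) := cid (coloring_net x.1.1 x.1.2 (e0 x.2)).
(* [inl r] is the separating coloring of radius [r]; [inr (r, k, m, i)] is the [i]-th net coloring
   with [k.+1] colors for balls of radius [r], up to [m.+1%:R^-1]. *)
pose T0 := (nat + nat * nat * nat * nat)%type.
pose h j (t : T0) (v : 'I_(n j)) : nat :=
  match t with inl r => projT1 (SC j r) v | inr x => (projT1 (NT x.1)).2 j x.2 v end.
pose B (t : T0) : nat :=
  match t with inl r => (d.+1 ^ (r + r)).+1 | inr x => x.1.1.2.+1 end.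
have hB j t v : (h j t v < B t)%N.
  case: t => [r|x] /=; first by have [+ _] := projT2 (SC j r); exact.
  by have [+ _] := projT2 (NT x.1); exact.
have sepP j r (u v w : 'I_(n j)) : gball (adj (G j)) r u v -> gball (adj (G j)) r u w ->
    h j (inl r) v = h j (inl r) w -> v = w.
  by have [_ sepr] := projT2 (SC j r); exact: sepr.
(* The neighbors of [u] lie in its ball of radius 1, so the coloring [inl 1] can name the steps. *)
have kapP j (u v w : 'I_(n j)) : adj (G j) u v -> adj (G j) u w ->
    h j (inl 1%N) v = h j (inl 1%N) w -> v = w.
  by move=> uv uw; apply: (sepP j 1%N u); right; exists u.
have [nu nuP] := ultralimit_law FU (@label_law_law R n G T0 B h (inl 1%N)).
have netP r k (e : R) : 0 < e -> exists ts : seq T0,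
    forall j (f : 'I_(n j) -> 'I_k.+1), exists2 t, t \in ts &
    dTV (@graph_color_law_of R d n G r k.+1 j f)
      (graph_color_law_of R G (fun v => inord (h j t v))) <= e.
  move=> ep; pose m := Num.truncn e^-1.
  have me : m.+1%:R^-1 <= e.
    rewrite invf_ple ?posrE//; apply/ltW; exact: truncnS_gt.
  have [_ net] := projT2 (NT (r, k, m)).
  exists [seq inr (r, k, m, i) | i <- iota 0 (projT1 (NT (r, k, m))).1] => j f.
  have [i iN le] := net j f; exists (inr (r, k, m, i)); last exact: le_trans le me.
  by apply/mapP; exists i => //; rewrite mem_iota.
exists (limit_graphing degG hB kapP sepP FU nuP); split; first exact: Qlimit_proper.
by move=> e ep; exact: dCN_near.
Qed.
End representation.

(** * Points of the completion and typical graphings *)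

Section completion_points.
Variables (R : realType) (d : nat).

Definition completion_point (u : nat -> Xgraph d) (cu : cauchy_seq (@dX R d) u) : Xbar R d :=
  exist _ (cauchy_class (@dX R d) u) (ex_intro2 _ _ u cu erefl).

(** The representative chosen by [completion_seq] need not be [u] itself, but it is equivalent to
    it. *)
Lemma completion_seq_point u (cu : cauchy_seq (@dX R d) u) :
  (fun n => dX R (completion_seq (completion_point cu) n) (u n)) @ \oo --> (0 : R).
Proof.
rewrite /completion_seq; case: (cid2 _) => v /= cv uv.
have : cauchy_class (@dX R d) u u.
  split; first exact: cu.
  rewrite (_ : (fun n => _) = fun=> 0); first exact: cvg_cst.
  by apply/funext => n; exact: dX_refl.
by rewrite uv => -[_]; exact.
Qed.

Definition graphing_dist (g : graphing R d) (x : Xgraph d) : R :=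
  dCN (Qgraph R d (val (tagged x))) (Qgraphing g).

Lemma graphing_dist_ge0 g x : proper_qfamily (Qgraphing g) -> 0 <= graphing_dist g x.
Proof. by move=> pg; apply: dCN_ge0 => //; exact: Xgraph_proper. Qed.

Lemma graphing_dist_triangle g y x : proper_qfamily (Qgraphing g) ->
  graphing_dist g x <= dX R x y + graphing_dist g y.
Proof. by move=> pg; apply: dCN_triangle => //; exact: Xgraph_proper. Qed.

Lemma dX_graphing_dist g x y : proper_qfamily (Qgraphing g) ->
  dX R x y <= graphing_dist g x + graphing_dist g y.
Proof.
move=> pg; rewrite [X in _ + X]/graphing_dist dCN_sym.
by apply: dCN_triangle => //; exact: Xgraph_proper.
Qed.

Lemma represents_point (g : graphing R d) u (cu : cauchy_seq (@dX R d) u) :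
  proper_qfamily (Qgraphing g) -> graphing_dist g \o u @ \oo --> (0 : R) ->
  represents g (completion_point cu).
Proof.
move=> pg ug; rewrite /represents -/(graphing_dist g).
apply: (@squeeze_cvgr _ _ _ _ (fun=> 0) (fun n =>
  dX R (completion_seq (completion_point cu) n) (u n) + graphing_dist g (u n))).
- by apply: nearW => n; rewrite graphing_dist_ge0//=; exact: graphing_dist_triangle.
- exact: cvg_cst.
- by rewrite -[X in _ --> X](addr0 0); apply: cvgD; [exact: completion_seq_point|exact: ug].
Qed.

(** Expresses distances in the completion through the graphing, which is how a limit is shown to lie
    in a closed set. *)
Lemma completion_dist_incl (g : graphing R d) (x : Xbar R d) (a : Xgraph d) :
  proper_qfamily (Qgraphing g) -> represents g x ->
  completion_dist x (completion_incl (@dX_refl R d) a) = graphing_dist g a.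
Proof.
move=> pg xg; rewrite /completion_dist; apply: cvg_lim => //.
set b := completion_seq (completion_incl _ a).
have ba : (fun n => dX R (b n) a) @ \oo --> (0 : R).
  exact: (@completion_seq_point (fun=> a) (cauchy_seq_cst (@dX_refl R d) a)).
set u := completion_seq x.
have ug : (fun n => graphing_dist g (u n)) @ \oo --> (0 : R) by exact: xg.
have bound n : `|dX R (u n) (b n) - graphing_dist g a| <= graphing_dist g (u n) + dX R (b n) a.
  rewrite ler_distlC lerBlDr; apply/andP; split.
    apply: (le_trans (dX_graphing_dist _ (b n) pg)); rewrite addrCA lerD2l addrC.
    exact: graphing_dist_triangle.
  apply: le_trans (graphing_dist_triangle (b n) a pg) _.
  apply: (le_trans (lerD (lexx _) (graphing_dist_triangle (u n) (b n) pg))).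
  rewrite (dX_sym R a (b n)) (dX_sym R (b n) (u n)) addrC addrA; exact: lexx.
apply/subr_cvg0; apply/norm_cvg0P/(@squeeze_cvgr _ _ _ _ (fun=> 0) (fun n =>
    graphing_dist g (u n) + dX R (b n) a)).
- by apply: nearW => n; apply/andP; split; [exact: normr_ge0|exact: bound].
- exact: cvg_cst.
- by rewrite -[X in _ --> X](addr0 0); apply: cvgD; [exact: ug|exact: ba].
Qed.

Lemma closed_limit (C : set (Xbar R d)) (x : Xbar R d) : closed C ->
  (forall e : R, 0 < e -> exists2 y, C y & completion_dist x y < e) -> C x.
Proof.
move=> clC near_x; apply: contrapT => nC.
have oC : completion_open (~` C) by exact: closed_openC clC.
by have [e e0 eC] := oC x nC; have [y Cy /eC] := near_x e e0.
Qed.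

Lemma cauchy_of_limit (g : graphing R d) (u : nat -> Xgraph d) :
  proper_qfamily (Qgraphing g) -> graphing_dist g \o u @ \oo --> (0 : R) ->
  cauchy_seq (@dX R d) u.
Proof.
move=> pg /cvgr0Pnorm_lt ug e e0.
have [N _ NP] := ug (e / 2) (divr_gt0 e0 (ltr0n _ 2)).
exists N => m n mN nN; apply: (le_lt_trans (dX_graphing_dist _ _ pg)).
rewrite (splitr e).
by apply: ltrD; apply: le_lt_trans (ler_norm _) (NP _ _).
Qed.

End completion_points.

Lemma extract_subsequence (A : nat -> nat -> Prop) :
  (forall l N, exists2 m, (N <= m)%N & A l m) ->
  exists2 phi : nat -> nat, {homo phi : i j / (i < j)%N} & forall l, A l (phi l).
Proof.
move=> H; have /boolp.choice[f fP] (x : nat * nat) : exists m, (x.2 <= m)%N /\ A x.1 m.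
  by have [m ? ?] := H x.1 x.2; exists m.
pose phi := fix phi l := if l is l'.+1 then f (l, (phi l').+1) else f (0, 0)%N.
exists phi; last by case=> [|l] /=; [have [] := fP (0, 0)%N|have [] := fP (l.+1, (phi l).+1)].
apply: homo_ltn => [|l]; first exact: ltn_trans.
by have [] := fP (l.+1, (phi l).+1).
Qed.

(** * Uniform random regular graphs *)

Section random_graph_events.
Variables (R : realType) (disp : measure_display) (T : measurableType disp).
Variables (P : probability T R) (d n : nat) (G : T -> reg_graph d n).
Hypothesis G_uniform : uniform_random_graph P G.

Lemma uniform_event (D : set (reg_graph d n)) : measurable (G @^-1` D) /\
  P (G @^-1` D) = (#|[pred g | `[< D g >]]|%:R / #|{: reg_graph d n}|%:R)%:E.
Proof.
have -> : G @^-1` D = \bigcup_(g in D) G @^-1` [set g].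
  by apply/seteqP; split=> [w Dw|w [g Dg /= ->//]]; exists (G w).
have mG g : D g -> measurable (G @^-1` [set g]) by have [] := G_uniform g.
have fD : finite_set D by exact: finite_finset.
split; first exact: fin_bigcup_measurable.
rewrite measure_fin_bigcup//; last first.
  by move=> g g' _ _ [w [/= <- <-]].
pose r := [seq g <- enum {: reg_graph d n} | `[< D g >]].
have rD : D = [set` r].
  apply/seteqP; split=> g /=; rewrite mem_filter mem_enum andbT => Dg; [exact/asboolP|exact/asboolP].
rewrite {1}rD -fsbig_seq; last by rewrite filter_uniq// enum_uniq.
rewrite (eq_bigr (fun=> (#|{: reg_graph d n}|%:R^-1)%:E)); last by move=> g _; exact: (G_uniform g).2.
rewrite big_filter big_enum_cond/= sumEFin; congr (_%:E); rewrite sumr_const -[LHS]mulr_natl.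
by [].
Qed.

Lemma random_graph_card : (0 < #|{: reg_graph d n}|)%N.
Proof.
have : [set: T] !=set0.
  apply/set0P/eqP => T0; have := probability_setT P; rewrite T0 measure0 => /eqP.
  by rewrite eq_sym onee_eq0.
by case=> w _; apply/card_gt0P; exists (G w).
Qed.

End random_graph_events.

Section concentration_sizes.
Variables (R : realType) (d : nat) (C : set (Xbar R d)).

Definition concentrates (a : Xgraph d) (e : R) (s : nat) : Prop :=
  #|[pred g : reg_graph d s | ~~ (dX R (Xgraph_of g) a < e)]|%:R
    <= e * #|{: reg_graph d s}|%:R :> R.

Lemma concentrates_le (a : Xgraph d) (e e' : R) (s : nat) :
  e <= e' -> concentrates a e s -> concentrates a e' s.
Proof.
move=> le conc; apply: le_trans (ler_wpM2r (ler0n _ _) le); apply: le_trans conc.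
rewrite ler_nat; apply: subset_leq_card; apply/fintype.subsetP => g; rewrite !inE.
by apply: contraNN => lt; exact: lt_le_trans lt le.
Qed.

(** Existence of a regular graph provides the parity and size conditions in [typical], by
    [reg_graph_size]. *)
Definition concentration_size (l s : nat) : Prop :=
  (0 < #|{: reg_graph d s}|)%N /\
  exists a : Xgraph d, C (completion_incl (@dX_refl R d) a) /\ concentrates a (2 ^- l) s.

Lemma pow2V_gt0 l : 0 < 2 ^- l :> R.
Proof. by rewrite invr_gt0 exprn_gt0. Qed.

Lemma exists_concentration_size (disp : measure_display) (T : measurableType disp)
    (P : probability T R) (n : nat -> nat) (G : forall i : nat, T -> reg_graph d (n i)) :
  (0 < d)%N -> (forall i, uniform_random_graph P (G i)) -> n @ \oo --> \oo ->
  ~ (fun i => P [set w | C (Xbar_of R (G i w))]) @ \oo --> 0%E ->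
  forall l N, exists2 s, (N <= s)%N & concentration_size l s.
Proof.
move=> d0 uG n_oo ncvg l N.
pose D i : set (reg_graph d (n i)) := [set g | C (Xbar_of R g)].
pose p i : R := #|[pred g | `[< D i g >]]|%:R / #|{: reg_graph d (n i)}|%:R.
have pE i : P [set w | C (Xbar_of R (G i w))] = (p i)%:E by exact: (uniform_event (uG i) (D i)).2.
have p0 i : 0 <= p i by rewrite divr_ge0.
have [e e0 eP] : exists2 e : R, 0 < e & forall N, exists2 i, (N <= i)%N & e <= p i.
  apply: contrapT => no; apply: ncvg; under eq_fun do rewrite pE.
  apply/fine_cvgP; split; first exact: nearW.
  apply/cvgr0Pnorm_le => e e0; apply: contrapT => nn; apply: no; exists e => // M.
  apply: contrapT => no; apply: nn; exists M => // i Mi /=; rewrite ger0_norm//.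
  by rewrite leNgt; apply/negP => lt; apply: no; exists i => //; exact: ltW.
(* One number serves as density of the set, as distance to [a] and as exceptional fraction. *)
pose e' := Num.min e (2 ^- l).
have e'0 : 0 < e' by rewrite lt_min e0 pow2V_gt0.
have [n0 conc] := random_graph_concentration d0 e'0.
have [M _ nM] := n_oo _ (nbhs_infty_ge (maxn n0 N)).
have [i Mi ei] := eP M.
have /= := nM i Mi; rewrite geq_max => /andP[n0i Ni].
exists (n i) => //; have c0 := random_graph_card P (G i).
split=> //.
have [|a aD le] := conc (n i) n0i c0 (finset.finset (fun g => `[< D i g >])).
  rewrite -ler_pdivlMr ?ltr0n//; apply: le_trans (_ : e <= _); first by rewrite ge_min lexx.
  by apply: (le_trans ei); rewrite /p finset.cardsE.
exists (Xgraph_of a); split; first by move: aD; rewrite finset.inE => /asboolP.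
by apply: concentrates_le le; rewrite ge_min lexx orbT.
Qed.

End concentration_sizes.

Lemma reg_graph_size (d n : nat) : (0 < #|{: reg_graph d n}|)%N -> ~~ odd (d * n) /\ (d < n)%N.
Proof.
case/card_gt0P => G _; split; first by rewrite mulnC (regular_even G) odd_double.
have n0 := sgraph_gt0 (val G); have /forallP/(_ (Ordinal n0))/eqP deg := valP G.
rewrite -deg -[X in (_ < X)%N]card_ord (cardD1 (Ordinal n0) 'I_n) inE add1n ltnS.
apply: subset_leq_card; apply/fintype.subsetP => j; rewrite !inE => ij.
by rewrite andbT; apply/eqP => ji; move: ij; rewrite ji; apply/negP/negP/(@adj_irrefl n (val G)).
Qed.

Lemma cvg_pow2V (R : realType) : (fun l => 2 ^- l) @ \oo --> (0 : R).
Proof.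
under eq_fun do rewrite -exprVn.
by apply: cvg_expr; rewrite ger0_norm ?invr_ge0// invf_lt1// ltr1n.
Qed.

(** * From concentration to typicality *)

Section typicality.
Variables (R : realType) (d : nat) (g : graphing R d).
Variables (s : nat -> nat) (a : nat -> Xgraph d).
Hypothesis s_mono : {homo s : i j / (i < j)%N}.
Hypothesis s_card : forall l, (0 < #|{: reg_graph d (s l)}|)%N.
Hypothesis a_conc : forall l, concentrates (a l) (2 ^- l : R) (s l).
Hypothesis g_proper : proper_qfamily (Qgraphing g).
Hypothesis a_cvg : graphing_dist g \o a @ \oo --> (0 : R).

(** The exceptional probabilities [2 ^- l] are summable, so almost surely finitely many sizes fail;
    at the others the random graph is within [2 ^- l] of [a l], which converges to [g]. *)
Lemma typical_of_concentration : typical g.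
Proof.
have s_inj : injective s.
  move=> i j; case: (ltngtP i j) => // /s_mono lt e; first by rewrite e ltnn in lt.
  by rewrite e ltnn in lt.
have s_ge i j : (i <= j)%N -> (s i <= s j)%N.
  by rewrite leq_eqVlt => /orP[/eqP->//|/s_mono/ltnW].
exists (range s); split.
- move=> fin; apply: infinite_nat; have := finite_preimage (f := s) _ fin.
  rewrite (_ : s @^-1` _ = setT); last by apply/seteqP; split=> // i _; exists i.
  by apply=> i j _ _ /s_inj.
- by move=> _ [l _ <-]; exact: reg_graph_size.
move=> disp T P G uG _.
have lift_in l : s l \in range s by rewrite inE; exists l.
pose lift l : range s := SigSub (lift_in l).
pose B l := G (lift l) @^-1` [set h | ~ (dX R (Xgraph_of h) (a l) < 2 ^- l)].
have mB l : measurable (B l) by exact: (uniform_event (uG (lift l)) _).1.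
have PB l : (P (B l) <= (2 ^- l)%:E)%E.
  rewrite (uniform_event (uG (lift l)) _).2 lee_fin ler_pdivrMr ?ltr0n ?s_card//.
  apply: le_trans (a_conc l); rewrite ler_nat; apply: subset_leq_card.
  by apply/fintype.subsetP => h /asboolP nlt; apply/negP.
have lim0 : P (lim_sup_set B) = 0%E.
  apply: lim_sup_set_cvg0 => //.
  apply: (@le_lt_trans _ _ (\sum_(l <oo) (2 / (2 ^ (l + 1))%:R)%:E)%E).
    apply: lee_nneseries => // l _; apply: (le_trans (PB l)).
    by rewrite lee_fin natrX addn1 exprS invfM mulrA divff ?mul1r.
  have /cvg_lim := @cvg_geometric_eseries_half R 2 0.
  by rewrite /eseries/= => ->//; rewrite ltry.
exists (lim_sup_set B); split=> //.
  by apply: bigcap_measurable => // i _; exact: bigcup_measurable.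
move=> w nconv; apply: contrapT => nlim; apply: nconv => e e0.
have [L LP] : exists L, forall l, (L <= l)%N -> ~ B l w.
  apply: contrapT => no; apply: nlim => L _; apply: contrapT => nB; apply: no.
  by exists L => l Ll Bl; apply: nB; exists l.
have [K _ KP] := (cvgr0Pnorm_lt _).1 a_cvg (e / 2) (divr_gt0 e0 (ltr0n _ 2)).
have [K' _ KP'] : \forall l \near \oo, 2 ^- l < e / 2 :> R.
  have [K' _ KP'] := (cvgr0Pnorm_lt _).1 (@cvg_pow2V R) (e / 2) (divr_gt0 e0 (ltr0n _ 2)).
  by exists K' => // l /KP'; rewrite /= ger0_norm// invr_ge0 exprn_ge0.
exists (s (maxn L (maxn K K'))) => // N /= sN m Nm.
have [l _ sl] : range s (val m) by exact: set_valP m.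
have ml : m = lift l by apply: val_inj.
rewrite ml; have : (maxn L (maxn K K') <= l)%N.
  by rewrite leqNgt; apply/negP => /s_mono; rewrite sl ltnNge (leq_trans sN Nm).
rewrite !geq_max => /and3P[Ll Kl K'l].
apply: le_lt_trans (graphing_dist_triangle (a l) (Xgraph_of (G (lift l) w)) g_proper) _.
rewrite (splitr e); apply: ltrD; last by apply: le_lt_trans (ler_norm _) (KP _ Kl).
apply: lt_trans (KP' l K'l); apply: contrapT; exact: LP Ll.
Qed.

End typicality.

Theorem proposition2p2 (R : realType) (d : nat) (d_ge3 : (3 <= d)%N)
    (disp : measure_display) (T : measurableType disp) (P : probability T R)
    (n : nat -> nat) (G : forall i : nat, T -> reg_graph d (n i))
    (G_uniform : forall i, uniform_random_graph P (G i))
    (G_independent : independent_graphs P G)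
    (n_oo : n @ \oo --> \oo)
    (C : set (Xbar R d)) (C_closed : closed C)
    (C_typical : forall (g : graphing R d) (x : Xbar R d),
       represents g x -> C x -> ~ typical g) :
  (fun i => P [set w | C (Xbar_of R (G i w))]) @ \oo --> 0%E.
Proof.
apply: contrapT => ncvg; have d0 : (0 < d)%N by apply: leq_trans d_ge3.
have [s s_mono good] : exists2 s : nat -> nat,
    {homo s : i j / (i < j)%N} & forall l, concentration_size C l (s l).
  apply: extract_subsequence => l N.
  exact: exists_concentration_size d0 G_uniform n_oo ncvg l N.
have /boolp.choice[a aP] l := (good l).2.
(* Along an ultrafilter finer than the tails, all limits needed for the graphing exist at once. *)
have [F [FU Foo]] := @ultraFilterLemma nat \oo _.
have FF := @ultra_proper _ _ FU.
have [g [pg near_g]] := graphing_ultralimit R a FU.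
(* A genuine subsequence is recovered because every set of [F] meets every tail. *)
have [phi phi_mono phi_g] : exists2 phi : nat -> nat,
    {homo phi : i j / (i < j)%N} & forall l, graphing_dist g (a (phi l)) < 2 ^- l.
  apply: (@extract_subsequence (fun l m => graphing_dist g (a m) < 2 ^- l)) => l N.
  have FN : F [set m | (N <= m)%N] by apply: Foo; exact: nbhs_infty_ge.
  by have [m [mg mN]] := filter_ex (filterI (near_g _ (pow2V_gt0 R l)) FN); exists m.
have a_cvg : graphing_dist g \o (a \o phi) @ \oo --> (0 : R).
  apply: (@squeeze_cvgr _ _ _ _ (fun=> 0) (fun l => 2 ^- l)).
  - by apply: nearW => l; rewrite graphing_dist_ge0//=; exact: ltW (phi_g l).
  - exact: cvg_cst.
  - exact: cvg_pow2V.
have phi_ge l : (l <= phi l)%N.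
  by elim: l => // l IH; apply: leq_ltn_trans IH _; exact: phi_mono.
pose x := completion_point (cauchy_of_limit pg a_cvg).
have gx : represents g x by exact: represents_point.
apply: (C_typical g x gx).
  apply: (closed_limit C_closed) => e e0.
  have [K _ KP] := (cvgr0Pnorm_lt _).1 a_cvg e e0.
  exists (completion_incl (@dX_refl R d) (a (phi K))); first by have [] := aP (phi K).
  rewrite (completion_dist_incl _ pg gx).
  exact: le_lt_trans (ler_norm _) (KP K (leqnn K)).
apply: (@typical_of_concentration R d g (s \o phi) (a \o phi)) => //.
- by move=> i j ij; apply: s_mono; exact: phi_mono.
- by move=> l; have [] := good (phi l).
(* Thinning keeps the rate: [l <= phi l] gives [2 ^- (phi l) <= 2 ^- l]. *)
- move=> l; have [_] := aP (phi l); apply: concentrates_le.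
  by rewrite lef_pV2 ?posrE ?exprn_gt0// ler_eXn2l ?phi_ge// ltr1n.
Qed.
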